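(* Let $m\geq 3$. There does not exist any Hopf real hypersurface $M$ in $\mathbb{C}P^m$ such that, for some nonzero real number $k$, the structure Jacobi operator $R_\xi$ of $M$ satisfies $$\big((\mathcal{L}_X^{(k)}-\mathcal{L}_X)R_{\xi}\big)Y=\big((\mathcal{L}_Y^{(k)}-\mathcal{L}_Y)R_{\xi}\big)X$$ for all $X,Y$ tangent to $M$.
   Context: $\mathbb{C}P^m$ is complex projective space with complex structure $J$ and Fubini-Study metric $g$ of constant holomorphic sectional curvature $4$. A real hypersurface $M$ of $\mathbb{C}P^m$ is a connected $C^\infty$ real hypersurface without boundary, with induced metric $g$, Levi-Civita connection $\nabla$, and (locally defined) unit normal vector field $N$; $A$ is the shape operator associated to $N$. All vector fields etc. are $C^\infty$. The structure (Reeb) vector field is $\xi=-JN$. For $X$ tangent to $M$ write $JX=\phi X+\eta(X)N$ with $\phi X$ tangent to $M$ and $\eta(X)=g(X,\xi)$; then $\nabla_X\xi=\phi AX$. $M$ is called Hopf if $A\xi=\alpha\xi$ for some function $\alpha$ on $M$. The structure Jacobi operator is $R_\xi X=R(X,\xi)\xi$, where $R$ is the curvature tensor of $M$; by the Gauss equation, $R_\xi X=X-\eta(X)\xi+g(A\xi,\xi)AX-g(A\xi,X)A\xi$. For a nonzero real number $k$, the $k$-th generalized Tanaka-Webster connection on $M$ is $\hat\nabla^{(k)}_XY=\nabla_XY+g(\phi AX,Y)\xi-\eta(Y)\phi AX-k\eta(X)\phi Y$. Let $\mathcal{L}$ be the Lie derivative on $M$, so $\mathcal{L}_XY=\nabla_XY-\nabla_YX$,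 and define $\mathcal{L}^{(k)}_XY=\hat\nabla^{(k)}_XY-\hat\nabla^{(k)}_YX$. These act on $R_\xi$ by $(\mathcal{L}_XR_\xi)Y=\mathcal{L}_X(R_\xi Y)-R_\xi(\mathcal{L}_XY)$ and $(\mathcal{L}^{(k)}_XR_\xi)Y=\mathcal{L}^{(k)}_X(R_\xi Y)-R_\xi(\mathcal{L}^{(k)}_XY)$. *)

(* Defs.v *)
(* MathComp / MathComp-Analysis. *)
From HB Require Import structures.
From mathcomp Require Import all_boot all_order all_algebra.
From mathcomp Require Import complex.
From mathcomp Require Import boolp classical_sets cardinality functions reals.
From mathcomp Require Import topology normedtype derive.

Set Implicit Arguments.
Unset Strict Implicit.
Unset Printing Implicit Defensive.

Import Order.TTheory GRing.Theory Num.Theory.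
Import numFieldNormedType.Exports.
Local Open Scope classical_set_scope.
Local Open Scope ring_scope.
Local Open Scope complex_scope.

Section ComplexProjectiveSpace.
Context {R : realType} {m : nat}.
Implicit Types P X Y : 'M[R[i]]_m.+1.

Definition adjmx p q (X : 'M[R[i]]_(p, q)) : 'M[R[i]]_(q, p) := (map_mx conjc X)^T.

Definition CP : set 'M[R[i]]_m.+1 :=
  [set P | [/\ adjmx P = P, P *m P = P & \tr P = 1]].

Definition TCP P : set 'M[R[i]]_m.+1 :=
  [set X | adjmx X = X /\ X *m P + P *m X = X].

Definition fs X Y : R := complex.Re (\tr (X *m Y)) / 2.

Definition cpJ P X : 'M[R[i]]_m.+1 := 'i%C *: (X *m P - P *m X).

Definition rscale (a : R) X : 'M[R[i]]_m.+1 := a%:C%C *: X.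

Definition tproj (T : set 'M[R[i]]_m.+1) X : 'M[R[i]]_m.+1 :=
  xget 0 [set Y | T Y /\ forall Z, T Z -> fs (X - Y) Z = 0].

Definition hopf_lift_push (z v : 'cV[R[i]]_m.+1) : 'M[R[i]]_m.+1 :=
  v *m adjmx z + z *m adjmx v.

Lemma adjmxK p q (X : 'M[R[i]]_(p, q)) : adjmx (adjmx X) = X.
Proof. by apply/matrixP => i j; rewrite !mxE conjcK. Qed.

Lemma adjmxD p q (X Y : 'M[R[i]]_(p, q)) : adjmx (X + Y) = adjmx X + adjmx Y.
Proof. by apply/matrixP => i j; rewrite !mxE rmorphD. Qed.

Lemma adjmxN p q (X : 'M[R[i]]_(p, q)) : adjmx (- X) = - adjmx X.
Proof. by apply/matrixP => i j; rewrite !mxE rmorphN. Qed.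

Lemma adjmxM p q r (X : 'M[R[i]]_(p, q)) (Y : 'M[R[i]]_(q, r)) :
  adjmx (X *m Y) = adjmx Y *m adjmx X.
Proof. by rewrite /adjmx map_mxM trmx_mul. Qed.

Lemma adjmxZ p q a (X : 'M[R[i]]_(p, q)) : adjmx (a *: X) = a^*%C *: adjmx X.
Proof. by apply/matrixP => i j; rewrite !mxE rmorphM. Qed.

Lemma trace_adjmx_eq0 p q (X : 'M[R[i]]_(p, q)) : \tr (adjmx X *m X) = 0 -> X = 0.
Proof.
move=> /eqP; rewrite /mxtrace psumr_eq0; last first.
  move=> j _; rewrite mxE sumr_ge0// => i _; rewrite !mxE mulrC.
  exact: mul_conjC_ge0.
move=> /allP h; apply/matrixP => i j; rewrite [RHS]mxE.
have := h j (mem_index_enum j); rewrite mxE psumr_eq0 /=; last first.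
  by move=> k _; rewrite !mxE mulrC; exact: mul_conjC_ge0.
move=> /allP /(_ i (mem_index_enum i)) /=.
by rewrite !mxE mulf_eq0 conjc_eq0 orbb => /eqP.
Qed.

Lemma CP_hopf P :
  CP P <-> exists2 z : 'cV[R[i]]_m.+1, adjmx z *m z = 1%:M & P = z *m adjmx z.
Proof.
split=> [[Pa PP Pt]|[z zz ->]]; last first.
  split; first by rewrite adjmxM adjmxK.
    by rewrite mulmxA -(mulmxA z) zz mulmx1.
  by rewrite mxtrace_mulC zz mxtrace1.
have P0 : P != 0 by apply: contra_eq_neq Pt => ->; rewrite mxtrace0 eq_sym oner_neq0.
have [j cj] : exists j, col j P != 0.
  apply/existsP; apply: contraNT P0; rewrite negb_exists => /forallP h.
  apply/eqP/matrixP => a b; have /eqP/matrixP/(_ a 0) := negbNE (h b).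
  by rewrite !mxE.
pose c := col j P; pose s := \tr (adjmx c *m c).
have s0 : 0 < s.
  rewrite lt_neqAle eq_sym; apply/andP; split.
    by apply: contra_neq cj; exact: trace_adjmx_eq0.
  rewrite /s /mxtrace sumr_ge0// => a _; rewrite mxE sumr_ge0// => b _.
  by rewrite !mxE mulrC; exact: mul_conjC_ge0.
have Pc : P *m c = c by rewrite /c colE mulmxA PP.
pose r := (sqrtC s)^-1; pose z := r *: c.
have rr : r^*%C = r.
  by rewrite -[LHS]/(Num.conj r) conj_Creal // realE invr_ge0 sqrtC_ge0 ltW.
have r2 : r * r * s = 1.
  by rewrite /r -invfM -expr2 sqrtCK mulVf// gt_eqF.
have zz : adjmx z *m z = 1%:M.
  rewrite adjmxZ rr -scalemxAl -scalemxAr scalerA; apply/matrixP => a b.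
  rewrite !ord1 !mxE mulr1n -r2 /s; congr (_ * _).
  by rewrite /mxtrace big_ord1 mxE.
have Pz : P *m z = z by rewrite -scalemxAr Pc.
have zP : adjmx z *m P = adjmx z by rewrite -{1}Pa -adjmxM Pz.
exists z => //; apply/eqP; rewrite -subr_eq0; apply/eqP/trace_adjmx_eq0.
have -> : adjmx (P - z *m adjmx z) = P - z *m adjmx z.
  by rewrite adjmxD adjmxN adjmxM adjmxK Pa.
rewrite mulmxBl !mulmxBr PP mulmxA Pz -(mulmxA _ (adjmx z)) zP.
rewrite -(mulmxA z (adjmx z) (z *m _)) (mulmxA (adjmx z) z) zz mul1mx subrr subr0.
by rewrite raddfB /= mxtrace_mulC zz mxtrace1 Pt subrr.
Qed.

Lemma TCP_hopf (z : 'cV[R[i]]_m.+1) X : adjmx z *m z = 1%:M ->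
  TCP (z *m adjmx z) X <->
  exists2 v : 'cV[R[i]]_m.+1, adjmx z *m v = 0 & X = hopf_lift_push z v.
Proof.
move=> zz; split=> [[Xa XX]|[v zv ->]].
  have zXz : adjmx z *m (X *m z) = 0.
    have : adjmx z *m X *m z + adjmx z *m X *m z = adjmx z *m X *m z.
      rewrite -{3}XX mulmxDr mulmxDl !mulmxA zz mul1mx.
      by rewrite -(mulmxA _ (adjmx z) z) zz mulmx1.
    by move=> /eqP; rewrite -subr_eq0 addrK => /eqP; rewrite mulmxA.
  by exists (X *m z) => //; rewrite /hopf_lift_push adjmxM Xa !mulmxA; rewrite -{1}XX mulmxA.
have vz : adjmx v *m z = 0.
  by rewrite -[adjmx v *m z]adjmxK adjmxM adjmxK zv /adjmx map_mx0 trmx0.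
split; first by rewrite adjmxD !adjmxM !adjmxK addrC.
rewrite /hopf_lift_push mulmxDl mulmxDr !mulmxA.
rewrite -(mulmxA v) zz mulmx1 -(mulmxA z (adjmx v)) vz mulmx0 mul0mx addr0.
by rewrite -(mulmxA z (adjmx z) v) zv mulmx0 mul0mx add0r -(mulmxA z (adjmx z) z) zz mulmx1.
Qed.

Lemma fs_hopf (z v w : 'cV[R[i]]_m.+1) :
  adjmx z *m z = 1%:M -> adjmx z *m v = 0 -> adjmx z *m w = 0 ->
  fs (hopf_lift_push z v) (hopf_lift_push z w) = complex.Re (\tr (adjmx v *m w)).
Proof.
move=> zz zv zw; rewrite /fs /hopf_lift_push mulmxDl !mulmxDr.
rewrite !mulmxA -(mulmxA v _ w) zw mulmx0 mul0mx add0r.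
rewrite -(mulmxA v _ z) zz mulmx1.
have vz : adjmx v *m z = 0.
  by rewrite -[adjmx v *m z]adjmxK adjmxM adjmxK zv /adjmx map_mx0 trmx0.
rewrite -(mulmxA z (adjmx v) z) vz mulmx0 mul0mx addr0 !raddfD /=.
rewrite (mxtrace_mulC v) -!(mulmxA z) (mxtrace_mulC z) -(mulmxA _ (adjmx z)) zz mulmx1.
have -> : complex.Re (\tr (adjmx w *m v)) = complex.Re (\tr (adjmx v *m w)).
  have -> : adjmx w *m v = adjmx (adjmx v *m w) by rewrite adjmxM adjmxK.
  by rewrite /adjmx mxtrace_tr /mxtrace !big_ord1 [in LHS]mxE; case: (_ 0 0).
by set c := complex.Re _; rewrite -mulr2n -[c *+ 2]mulr_natr mulfK ?pnatr_eq0.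
Qed.

Lemma cpJ_hopf (z v : 'cV[R[i]]_m.+1) :
  adjmx z *m z = 1%:M -> adjmx z *m v = 0 ->
  cpJ (z *m adjmx z) (hopf_lift_push z v) = hopf_lift_push z ('i%C *: v).
Proof.
move=> zz zv; have vz : adjmx v *m z = 0.
  by rewrite -[adjmx v *m z]adjmxK adjmxM adjmxK zv /adjmx map_mx0 trmx0.
rewrite /cpJ /hopf_lift_push mulmxDl mulmxDr !mulmxA.
rewrite -(mulmxA v) zz mulmx1 -(mulmxA z (adjmx v)) vz mulmx0 mul0mx addr0.
rewrite -(mulmxA z (adjmx z) v) zv mulmx0 mul0mx add0r -(mulmxA z (adjmx z) z) zz mulmx1.
rewrite adjmxZ scalerBr -scalemxAl -scalemxAr; congr (_ + _).
by rewrite -scaleNr; congr (_ *: _); apply/eqP; rewrite eq_complex /= oppr0 !eqxx.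
Qed.

End ComplexProjectiveSpace.

Infix "*:r" := rscale (at level 40, left associativity) : ring_scope.

Section Calculus.
Context {R : realType}.

Fixpoint Ck n (k : nat) (U : set 'rV[R]_n) (h : 'rV[R]_n -> R) : Prop :=
  if k is k'.+1 then
    (forall u, U u -> differentiable h u) /\
    (forall w, Ck k' U (fun u => 'D_w h u))
  else forall u, U u -> {for u, continuous h}.

Definition smooth n (U : set 'rV[R]_n) (h : 'rV[R]_n -> R) : Prop :=
  forall k, Ck k U h.

Definition smooth_rV n p (U : set 'rV[R]_n) (t : 'rV[R]_n -> 'rV[R]_p) : Prop :=
  forall j, smooth U (fun u => t u 0 j).

Definition smooth_mx n d (U : set 'rV[R]_n) (F : 'rV[R]_n -> 'M[R[i]]_d) : Prop :=
  forall a b, smooth U (fun u => complex.Re (F u a b)) /\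
              smooth U (fun u => complex.Im (F u a b)).

Definition dmx n d (F : 'rV[R]_n -> 'M[R[i]]_d) (u w : 'rV[R]_n) : 'M[R[i]]_d :=
  \matrix_(a, b) ('D_w (fun x => complex.Re (F x a b)) u
                  +i* 'D_w (fun x => complex.Im (F x a b)) u).

End Calculus.

Section Manifolds.
Context {R : realType}.

Definition chart n (M : Type) : Type := (set 'rV[R]_n * ('rV[R]_n -> M))%type.

Definition is_chart n (M : topologicalType) (c : chart n M) : Prop :=
  [/\ open c.1,
      forall u v, c.1 u -> c.1 v -> c.2 u = c.2 v -> u = v,
      forall u, c.1 u -> {for u, continuous c.2}
    & forall W, open W -> W `<=` c.1 -> open (c.2 @` W)].

Definition compatible n (M : Type) (c c' : chart n M) : Prop :=
  let W := c'.1 `&` c'.2 @^-1` (c.2 @` c.1) in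
  exists t : 'rV[R]_n -> 'rV[R]_n,
    smooth_rV W t /\ forall u, W u -> c.1 (t u) /\ c.2 (t u) = c'.2 u.

Record manifold n := Manifold {
  points :> topologicalType;
  atlas : set (chart n points);
  points_hausdorff : hausdorff_space points;
  points_second_countable : @second_countable points;
  atlas_chart : forall c, atlas c -> is_chart c;
  atlas_cover : forall p : points, exists2 c, atlas c & (c.2 @` c.1) p;
  atlas_compatible : forall c c', atlas c -> atlas c' -> compatible c c'
}.

Context {n d : nat} (M : manifold n).

Definition smooth_on (V : set M) (F : M -> 'M[R[i]]_d) : Prop :=
  forall c, atlas c -> smooth_mx (c.1 `&` c.2 @^-1` V) (F \o c.2).

Definition smooth_immersion (f : M -> 'M[R[i]]_d) : Prop :=
  smooth_on setT f /\
  forall c u, atlas c -> c.1 u -> injective (dmx (f \o c.2) u).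

Definition chart_at (p : M) : chart n M * 'rV[R]_n :=
  xget ((set0, fun=> p), 0) [set cu | [/\ atlas cu.1, cu.1.1 cu.2 & cu.1.2 cu.2 = p]].

Definition pullback T (F : M -> T) (p : M) : 'rV[R]_n -> T := F \o (chart_at p).1.2.

Definition tangent (f : M -> 'M[R[i]]_d) (p : M) : set 'M[R[i]]_d :=
  range (dmx (pullback f p) (chart_at p).2).

Definition chart_coord (f : M -> 'M[R[i]]_d) (p : M) (v : 'M[R[i]]_d) : 'rV[R]_n :=
  xget 0 [set w | dmx (pullback f p) (chart_at p).2 w = v].

Definition dir_deriv (f : M -> 'M[R[i]]_d) (p : M) (v : 'M[R[i]]_d)
    (F : M -> 'M[R[i]]_d) : 'M[R[i]]_d :=
  dmx (pullback F p) (chart_at p).2 (chart_coord f p v).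

Definition vfield (f : M -> 'M[R[i]]_d) (V : set M) (X : M -> 'M[R[i]]_d) : Prop :=
  smooth_on V X /\ forall p, V p -> tangent f p (X p).

End Manifolds.


Section Hypersurfaces.
Context {R : realType} {m n : nat} {M : manifold (R := R) n}.
Variable f : M -> 'M[R[i]]_m.+1.

Notation field := (M -> 'M[R[i]]_m.+1).

Definition real_hypersurface : Prop :=
  [/\ n = (2 * m - 1)%N, [set: M] !=set0, connected [set: M],
      forall p, CP (f p) & smooth_immersion f].

(* For a submanifold of a Euclidean space, the Levi-Civita connection of the
   induced metric is the orthogonal projection of the flat derivative onto the
   tangent spaces.  It is characterized by [nabla_metric] and
   [nabla_torsion_free] below. *)
Definition nabla (X Y : field) : field := fun p =>
  tproj (tangent f p) (dir_deriv f p (X p) Y).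

(* The Levi-Civita connection of CP^m, obtained in the same way from the
   tangent spaces of CP^m, acting on fields along [f] that need not be tangent
   to [M]. *)
Definition nablabar (X W : field) : field := fun p =>
  tproj (TCP (f p)) (dir_deriv f p (X p) W).

Definition lie (X Y : field) : field := fun p => nabla X Y p - nabla Y X p.

Definition curvature (X Y Z : field) : field := fun p =>
  nabla X (nabla Y Z) p - nabla Y (nabla X Z) p - nabla (lie X Y) Z p.

Definition unit_normal (V : set M) (N : field) : Prop :=
  smooth_on V N /\
  forall p, V p -> [/\ TCP (f p) (N p), fs (N p) (N p) = 1
                     & forall v, tangent f p v -> fs (N p) v = 0].

Section Structure.
Variables (N : field) (k : R).

Definition shape (X : field) : field := fun p => - nablabar X N p.

Definition xi : field := fun p => - cpJ (f p) (N p).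

Definition eta (X : field) : M -> R := fun p => fs (X p) (xi p).

Definition phi (X : field) : field := fun p =>
  cpJ (f p) (X p) - eta X p *:r N p.

Definition Rxi (X : field) : field := curvature X xi xi.

Definition nablak (X Y : field) : field := fun p =>
  nabla X Y p + fs (phi (shape X) p) (Y p) *:r xi p
  - eta Y p *:r phi (shape X) p - (k * eta X p) *:r phi Y p.

Definition liek (X Y : field) : field := fun p => nablak X Y p - nablak Y X p.

End Structure.

(* [deriv_op L T X Y] is (L_X T) Y for an operator T on vector fields. *)
Definition deriv_op (L : field -> field -> field) (T : field -> field)
  (X Y : field) : field := fun p => L X (T Y) p - T (L X Y) p.

Definition hopf : Prop :=
  forall V N, open V -> unit_normal V N ->
  exists alpha : M -> R, forall p, V p -> shape N (xi N) p = alpha p *:r xi N p.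

(* The normal N is only local.  Replacing N by -N replaces the k-th connection
   by the (-k)-th one, so for a fixed k the identity is required around each
   point for one of the two local unit normals. *)
Definition jacobi_condition (k : R) : Prop :=
  forall p, exists V N, [/\ open V, V p, unit_normal V N &
    forall X Y, vfield f V X -> vfield f V Y -> forall q, V q ->
      deriv_op (liek N k) (Rxi N) X Y q - deriv_op lie (Rxi N) X Y q =
      deriv_op (liek N k) (Rxi N) Y X q - deriv_op lie (Rxi N) Y X q].

End Hypersurfaces.

(* Main.v *)
Require Import Defs.
From mathcomp Require Import all_boot all_order all_algebra complex.
From mathcomp Require Import boolp classical_sets functions reals.
From mathcomp Require Import topology normedtype landau derive.
From mathcomp Require Import ring lra.

Set Implicit Arguments.
Unset Strict Implicit.
Unset Printing Implicit Defensive.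

Import Order.TTheory GRing.Theory Num.Theory.
Import numFieldNormedType.Exports.
Local Open Scope classical_set_scope.
Local Open Scope ring_scope.
Local Open Scope complex_scope.

(** At a point of M write D for the orthogonal complement of xi in the tangent
    space.  The operator [L^(k) - L] is a skew tensor T, and the condition reads
    [T (X, R Y) + T (R X, Y) = 2 R (T (X, Y))] with [R = R_xi].  When
    [A xi = alpha xi], [R xi = 0] and [R = 1 + alpha A] on D, and
      - [X = xi] gives [phi (A - k) (1 + alpha A) = 2 (1 + alpha A) phi (A - k)],
      - the xi-component, for X and Y in D, gives
        [(1 + alpha A) S + S (1 + alpha A) = 0] where [S = phi A + A phi],
      - the Codazzi equation gives [2 A phi A = alpha S + 2 phi].
    The first equation minus its transpose, simplified by the other two, is
    [(k alpha - 3 - 3 alpha^2) S = (6 alpha - 2 k) phi], whence [S = c phi] and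
    then [c (2 + alpha c) = 0].  If [c = 0] then [A^2 = -1] on D, which is absurd
    for a symmetric A.  If [alpha c = -2] then [A phi A = 0], the first equation
    becomes [(1 + k alpha) phi A = - k phi], and multiplying it by A gives
    [A = 0] on D, hence [k = 0].

    CP^m is the manifold of rank one projectors P, so all connections are
    tangential parts of flat derivatives, computed in one chart.  If pi is the
    field of orthogonal projections onto the tangent spaces of M, then
    [R (X, Y) Z = pi ((D_X pi) (D_Y Z) - (D_Y pi) (D_X Z))], which is the Gauss
    equation once [D_Y xi] is computed.  The Codazzi equation on D comes from
    [<D_w N, xi> + alpha <xi, D_w f> = 0], differentiated in a second direction
    and antisymmetrized. *)

(** * Linear algebra of the structure equations *)

(* Here [w X Y] stands for [g (phi X, Y)] and [B] for the shape operator on D; the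
   hypotheses are the Codazzi equation and the two halves of the condition. *)
Lemma no_structure_operator (R : realFieldType) (T : Type) (D : T -> Prop) (B : T -> T)
    (w : T -> T -> R) (al k : R) :
  k != 0 ->
  (forall X, D X -> D (B X)) ->
  (forall X Y, D X -> D Y -> w X Y = - w Y X) ->
  (forall X Y, D X -> D Y ->
     al * (w (B X) Y + w X (B Y)) - 2 * w (B X) (B Y) + 2 * w X Y = 0) ->
  (forall X Y, D X -> D Y ->
     w (B X) Y + al * w (B (B X)) Y - k * (w X Y + al * w (B X) Y) =
     2 * (w (B X) Y + al * w (B X) (B Y) - k * (w X Y + al * w X (B Y)))) ->
  (forall X Y, D X -> D Y ->
     2 * (w (B X) Y + w X (B Y)) + al * (w (B X) (B Y) + w X (B (B Y)))
       + al * (w (B (B X)) Y + w (B X) (B Y)) = 0) ->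
  forall X Y, D X -> D Y -> 0 < w X Y -> 0 <= w X (B (B Y)) -> False.
Proof.
move=> k0 DB wC codazzi jac_xi jac_D X Y DX DY w0 w4.
have key : forall X Y, D X -> D Y ->
    (k * al - 3 - 3 * al ^+ 2) * (w (B X) Y + w X (B Y)) = (6 * al - 2 * k) * w X Y.
  move=> {w0 w4 DX DY}X {}Y DX DY.
  have e1 := codazzi _ _ DX DY.
  (* In these terms [e2] plus [e3] is the first equation minus its transpose. The equation [e4]
     removes the terms with two factors [B] on one side, and [3 * al] times [e1] removes
     [w (B X) (B Y)]. *)
  have e2 := jac_xi _ _ DX DY; have e3 := jac_xi _ _ DY DX; have e4 := jac_D _ _ DX DY.
  rewrite (wC (B Y) X) ?(wC (B (B Y)) X) ?(wC (B Y) (B X))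
    ?(wC Y X) ?(wC Y (B X)) in e3; do ?by auto.
  nra.
(* If this coefficient vanished, then [k = 3 * al] because [w X Y] is positive, and the coefficient
   would equal [-3]. *)
have k3 : k * al - 3 - 3 * al ^+ 2 != 0.
  apply/eqP => k30; have := key _ _ DX DY; rewrite k30 mul0r => /esym/eqP.
  rewrite mulf_eq0 (gt_eqF w0) orbF => /eqP h; nra.
pose c := (6 * al - 2 * k) / (k * al - 3 - 3 * al ^+ 2).
have wBc : forall X Y, D X -> D Y -> w (B X) Y + w X (B Y) = c * w X Y.
  by move=> X1 Y1 DX1 DY1; rewrite /c mulrAC -key// mulrC mulKf.
(* Applying [wBc] at [(X, Y)], [(X, B Y)] and [(B X, Y)] turns [jac_D] into
   [c * (2 + al * c) * w X Y = 0]. *)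
have := jac_D _ _ DX DY.
rewrite wBc// (wBc X (B Y))//; last by auto.
rewrite (wBc (B X) Y)//; last by auto.
rewrite -addrA -mulrDr -mulrDr -(addrC (w (B X) Y)) wBc// => h.
have : (c * (2 + al * c)) * w X Y = 0 by rewrite -h; ring.
move=> /eqP; rewrite mulf_eq0 (gt_eqF w0) orbF mulf_eq0 => /orP[/eqP c0|/eqP alc].
  (* Here [w (B X) (B Y) = w X Y], so [w X (B (B Y)) = - w X Y] is negative, against the last
     hypothesis. *)
  have := codazzi _ _ DX DY; rewrite wBc// c0.
  by have := wBc X (B Y) DX (DB _ DY); rewrite c0 => h1 h2; lra.
have {}alc : al * c = -2 by lra.
have t3 : forall X Y, D X -> D Y -> w (B X) (B Y) = 0.
  move=> X1 Y1 DX1 DY1; have := codazzi _ _ DX1 DY1; rewrite wBc// mulrA alc => e.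
  lra.
have t1 : forall X Y, D X -> D Y -> (1 + k * al) * w (B X) Y = - k * w X Y.
  move=> X1 Y1 DX1 DY1; have := jac_xi _ _ DX1 DY1; rewrite t3//.
  have := wBc _ _ (DB _ DX1) DY1; rewrite t3// addr0 => ->.
  have /(canRL (addKr _)) -> := wBc _ _ DX1 DY1.
  rewrite (mulrDr al (- _)) !(mulrA al c) alc => e; lra.
(* This is [t1] at [(X, B Y)], whose left side vanishes by [t3]. *)
have t2 : forall X Y, D X -> D Y -> w X (B Y) = 0.
  move=> X1 Y1 DX1 DY1; have := t1 _ _ DX1 (DB _ DY1); rewrite t3// mulr0 => /esym/eqP.
  by rewrite mulf_eq0 oppr_eq0 (negbTE k0) => /eqP.
have := t1 _ _ DX DY; rewrite wC ?t2//; last by auto.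
rewrite oppr0 mulr0 => /esym/eqP.
by rewrite mulf_eq0 oppr_eq0 (negbTE k0) gt_eqF.
Qed.

(** * Pointwise geometry of the projector model of CP^m *)

Lemma mxtraceB (K : pzRingType) n (A B : 'M[K]_n) : \tr (A - B) = \tr A - \tr B.
Proof. exact: raddfB. Qed.

(** * Real scalars and the real inner product on Hermitian matrices *)

Section RealScaling.
Context {R : realType} {m : nat}.
Implicit Types (X Y Z P : 'M[R[i]]_m.+1) (a b : R).

Lemma Re_realM a (x : R[i]) : complex.Re (a%:C * x) = a * complex.Re x.
Proof. by case: x => x y /=; rewrite mul0r subr0. Qed.

Lemma Im_realM a (x : R[i]) : complex.Im (a%:C * x) = a * complex.Im x.
Proof. by case: x => x y /=; rewrite mul0r addr0. Qed.

Lemma Re_iM (x : R[i]) : complex.Re ('i%C * x) = - complex.Im x.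
Proof. by rewrite mulrC ReiNIm. Qed.

Lemma Re_conjc (x : R[i]) : complex.Re (x^*)%C = complex.Re x.
Proof. by case: x. Qed.

Lemma Im_conjc (x : R[i]) : complex.Im (x^*)%C = - complex.Im x.
Proof. by case: x. Qed.

Lemma conjc_i : ('i^*)%C = - 'i%C :> R[i].
Proof. by apply/eqP; rewrite eq_complex /= oppr0 !eqxx. Qed.

Lemma mulii : 'i%C * 'i%C = -1 :> R[i].
Proof. by rewrite -expr2 sqr_i. Qed.

Lemma rscale0r X : 0 *:r X = 0. Proof. by rewrite /rscale scale0r. Qed.
Lemma rscale1r X : 1 *:r X = X. Proof. by rewrite /rscale scale1r. Qed.
Lemma rscaler0 a : a *:r (0 : 'M[R[i]]_m.+1) = 0. Proof. by rewrite /rscale scaler0. Qed.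
Lemma rscaleDl a b X : (a + b) *:r X = a *:r X + b *:r X.
Proof. by rewrite /rscale rmorphD scalerDl. Qed.
Lemma rscaleNl a X : (- a) *:r X = - (a *:r X).
Proof. by rewrite /rscale rmorphN scaleNr. Qed.
Lemma rscaleDr a X Y : a *:r (X + Y) = a *:r X + a *:r Y.
Proof. by rewrite /rscale scalerDr. Qed.
Lemma rscaleNr a X : a *:r (- X) = - (a *:r X).
Proof. by rewrite /rscale scalerN. Qed.
Lemma rscalerA a b X : a *:r (b *:r X) = (a * b) *:r X.
Proof. by rewrite /rscale scalerA rmorphM. Qed.
Lemma rscalemxl a X Y : (a *:r X) *m Y = a *:r (X *m Y).
Proof. by rewrite /rscale scalemxAl. Qed.
Lemma rscalemxr a X Y : X *m (a *:r Y) = a *:r (X *m Y).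
Proof. by rewrite /rscale scalemxAr. Qed.
Lemma adjmx_rscale a X : adjmx (a *:r X) = a *:r adjmx X.
Proof. by rewrite adjmxZ conjc_real. Qed.

Lemma fs_def X Y : fs X Y = complex.Re (\tr (X *m Y)) / 2.
Proof. by []. Qed.
Lemma fsC X Y : fs X Y = fs Y X.
Proof. by rewrite /fs mxtrace_mulC. Qed.
Lemma fsDl X Y Z : fs (X + Y) Z = fs X Z + fs Y Z.
Proof. by rewrite /fs mulmxDl !raddfD /= mulrDl. Qed.
Lemma fsNl X Z : fs (- X) Z = - fs X Z.
Proof. by rewrite /fs mulNmx !raddfN /= mulNr. Qed.
Lemma fsZl a X Z : fs (a *:r X) Z = a * fs X Z.
Proof. by rewrite /fs rscalemxl linearZ /= Re_realM mulrA. Qed.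
Lemma fs0l Z : fs 0 Z = 0.
Proof. by rewrite /fs mul0mx mxtrace0 mul0r. Qed.
Lemma fsDr X Y Z : fs Z (X + Y) = fs Z X + fs Z Y.
Proof. by rewrite !(fsC Z) fsDl. Qed.
Lemma fsNr X Z : fs Z (- X) = - fs Z X.
Proof. by rewrite !(fsC Z) fsNl. Qed.
Lemma fsZr a X Z : fs Z (a *:r X) = a * fs Z X.
Proof. by rewrite !(fsC Z) fsZl. Qed.
Lemma fs0r Z : fs Z 0 = 0. Proof. by rewrite fsC fs0l. Qed.

Lemma trace_adjmx_Im X : complex.Im (\tr (adjmx X *m X)) = 0.
Proof.
apply: ger0_Im; rewrite sumr_ge0// => j _; rewrite mxE sumr_ge0// => k _.
by rewrite !mxE mulrC; exact: mul_conjC_ge0.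
Qed.

Lemma fs_ge0 X : adjmx X = X -> 0 <= fs X X.
Proof.
move=> XX; rewrite /fs divr_ge0//.
have : 0 <= \tr (adjmx X *m X).
  rewrite sumr_ge0// => j _; rewrite mxE sumr_ge0// => k _.
  by rewrite !mxE mulrC; exact: mul_conjC_ge0.
by rewrite XX lecE => /andP[].
Qed.

Lemma fs_eq0 X : adjmx X = X -> fs X X = 0 -> X = 0.
Proof.
move=> XX; rewrite /fs => /eqP; rewrite mulf_eq0 invr_eq0 pnatr_eq0 orbF => /eqP h.
apply: trace_adjmx_eq0; have := trace_adjmx_Im X; rewrite XX => h2.
by rewrite (complexE (\tr _)) h h2 mulr0 addr0.
Qed.

Lemma fs_gt0 X : adjmx X = X -> X != 0 -> 0 < fs X X.
Proof.
move=> XX X0; rewrite lt_neqAle fs_ge0// andbT eq_sym.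
by apply: contra_neq X0; exact: fs_eq0.
Qed.

End RealScaling.

Lemma addmxE (V : nmodType) p q (A B : 'M[V]_(p, q)) i j : (A + B) i j = A i j + B i j.
Proof. by rewrite mxE. Qed.
Lemma oppmxE (V : zmodType) p q (A : 'M[V]_(p, q)) i j : (- A) i j = - A i j.
Proof. by rewrite mxE. Qed.
Lemma scalemxE (K : pzRingType) p q a (A : 'M[K]_(p, q)) i j : (a *: A) i j = a * A i j.
Proof. by rewrite mxE. Qed.
Lemma zeromxE (V : nmodType) p q i j : (0 : 'M[V]_(p, q)) i j = 0.
Proof. by rewrite mxE. Qed.

(* Decides identities in the additive group of matrices, treating matrix
   products as atoms. *)
Ltac mxlin :=
  rewrite /rscale ?mulr2n;
  repeat match goal with |- context [@mulmx ?K ?a ?b ?c ?A ?B] =>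
    let t := fresh "t" in set t := (@mulmx K a b c A B); clearbody t end;
  apply/matrixP => ? ?; rewrite ?(addmxE, oppmxE, scalemxE, zeromxE); ring.

(** * Tangent spaces of CP^m and their complex structure *)

Section ProjectiveTangent.
Context {R : realType} {m : nat}.
Implicit Types (X Y Z P C : 'M[R[i]]_m.+1) (a b : R).

Lemma TCP0 P : TCP P 0.
Proof. by split; rewrite ?mul0mx ?mulmx0 ?addr0// /adjmx map_mx0 trmx0. Qed.

Lemma TCPD P X Y : TCP P X -> TCP P Y -> TCP P (X + Y).
Proof.
move=> [Xa XP] [Ya YP]; split; first by rewrite adjmxD Xa Ya.
by rewrite mulmxDl mulmxDr addrACA XP YP.
Qed.

Lemma TCPN P X : TCP P X -> TCP P (- X).
Proof.
move=> [Xa XP]; split; first by rewrite adjmxN Xa.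
by rewrite mulNmx mulmxN -opprD XP.
Qed.

Lemma TCPZ P a X : TCP P X -> TCP P (a *:r X).
Proof.
move=> [Xa XP]; split; first by rewrite adjmx_rscale Xa.
by rewrite rscalemxl rscalemxr -rscaleDr XP.
Qed.

Lemma TCP_PXP P X : P *m P = P -> TCP P X -> P *m X *m P = 0.
Proof.
move=> PP [_ XP]; have /(congr1 (mulmx P)) := XP.
by rewrite mulmxDr !mulmxA PP -[RHS]add0r => /addIr.
Qed.

Lemma TCP_XPr P X : TCP P X -> X *m P = X - P *m X.
Proof. by move=> [_ XP]; rewrite -{2}XP addrK. Qed.

Lemma TCP_PX P X : TCP P X -> P *m X = X - X *m P.
Proof. by move=> [_ XP]; rewrite -{2}XP [X in X - _]addrC addrK. Qed.

Lemma cpJE P X : TCP P X -> cpJ P X = 'i%C *: (X - P *m X *+ 2).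
Proof. by move=> h; rewrite /cpJ TCP_XPr// mulr2n opprD addrA. Qed.

Lemma cpJD P X Y : cpJ P (X + Y) = cpJ P X + cpJ P Y.
Proof. by rewrite /cpJ mulmxDl mulmxDr opprD addrACA scalerDr. Qed.

Lemma cpJN P X : cpJ P (- X) = - cpJ P X.
Proof. by rewrite /cpJ mulNmx mulmxN -scalerN !opprD. Qed.

Lemma cpJZ P a X : cpJ P (a *:r X) = a *:r cpJ P X.
Proof.
by rewrite /cpJ rscalemxl rscalemxr -rscaleNr -rscaleDr /rscale !scalerA mulrC.
Qed.

Lemma TCP_cpJ P X : CP P -> TCP P X -> TCP P (cpJ P X).
Proof.
move=> [Pa PP _] h; have PXP := TCP_PXP PP h; have [Xa XP] := h; split.
  rewrite /cpJ adjmxZ adjmxD adjmxN !adjmxM Xa Pa conjc_i scaleNr -scalerN.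
  by rewrite opprB.
rewrite /cpJ -scalemxAl -scalemxAr -scalerDr; congr (_ *: _).
by rewrite mulmxBl mulmxBr !mulmxA -(mulmxA X) PP PXP subr0 sub0r.
Qed.

Lemma cpJJ P X : CP P -> TCP P X -> cpJ P (cpJ P X) = - X.
Proof.
move=> [Pa PP _] h; have PXP := TCP_PXP PP h; have [Xa XP] := h.
rewrite /cpJ -scalemxAl -scalemxAr -scalerBr scalerA mulii scaleN1r; congr (- _).
rewrite mulmxBl mulmxBr !mulmxA -(mulmxA X) PP PXP subr0 sub0r.
by rewrite opprK.
Qed.

Lemma fs_cpJl P X Y : fs (cpJ P X) Y = - fs X (cpJ P Y).
Proof.
have e : \tr ((X *m P - P *m X) *m Y) = - \tr (X *m (Y *m P - P *m Y)).
  rewrite mulmxBl mulmxBr !mxtraceB opprB !mulmxA; congr (_ - _).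
  by rewrite -[P *m X *m Y]mulmxA mxtrace_mulC.
rewrite /fs /cpJ -scalemxAl -scalemxAr !mxtraceZ e mulrN -[RHS]mulNr; congr (_ / _).
by case: (_ * _).
Qed.

Lemma fs_cpJJ P X Y : CP P -> TCP P X -> TCP P Y -> fs (cpJ P X) (cpJ P Y) = fs X Y.
Proof. by move=> hP hX hY; rewrite fs_cpJl cpJJ// fsNr opprK. Qed.

Lemma fs_cpJ_self P X : fs X (cpJ P X) = 0.
Proof. by have := fs_cpJl P X X; rewrite fsC; lra. Qed.

(** With respect to the splitting into image and kernel of [P], a tangent vector is block
    off-diagonal and a matrix commuting with [P] is block diagonal. This is the test for normality
    to CP^m used throughout. *)
Lemma fs_TCP_comm P X C : P *m P = P -> TCP P X -> P *m C = C *m P -> fs X C = 0.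
Proof.
move=> PP h PC; have PXP := TCP_PXP PP h; have [Xa XP] := h.
have e : \tr (P *m (X *m C)) = 0.
  by rewrite -{1}PP -mulmxA mxtrace_mulC -!mulmxA -PC !mulmxA PXP mul0mx mxtrace0.
rewrite /fs -XP mulmxDl raddfD /= -[P *m X *m C]mulmxA e addr0.
by rewrite -mulmxA PC mulmxA mxtrace_mulC e mul0r.
Qed.

(** The off-diagonal part [P X (1 - P) + (1 - P) X P], that is, the orthogonal projection of
    Hermitian matrices onto the tangent space of CP^m. *)
Definition projCP P X := X *m P + P *m X - (P *m X *m P) *+ 2.

Lemma TCP_projCP P X : CP P -> adjmx X = X -> TCP P (projCP P X).
Proof.
move=> [Pa PP _] Xa; rewrite /projCP mulr2n; split.
  by rewrite adjmxD adjmxN !adjmxD !adjmxM Pa Xa !mulmxA [P *m X + _]addrC.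
have APP A : A *m P *m P = A *m P by rewrite -mulmxA PP.
by rewrite !(mulmxDl, mulmxDr, mulmxN, mulNmx) !mulmxA !APP PP; mxlin.
Qed.

End ProjectiveTangent.

Opaque mulmx mxtrace adjmx.

(** * Hermitian products of horizontal lifts *)

Section HopfLift.
Context {R : realType} {m : nat}.
Implicit Types (x y z v w : 'cV[R[i]]_m.+1) (P X Y Z N E : 'M[R[i]]_m.+1).

Definition ip x y : R[i] := (adjmx x *m y) 0 0.

Lemma ip_scalar x y : adjmx x *m y = (ip x y)%:M.
Proof. by rewrite [LHS]mx11_scalar. Qed.

Lemma ipC x y : ip y x = (ip x y)^*%C.
Proof. by rewrite /ip -[adjmx y *m x]adjmxK adjmxM adjmxK !mxE. Qed.

Lemma outerM x y v w : x *m adjmx y *m (v *m adjmx w) = ip y v *: (x *m adjmx w).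
Proof.
by rewrite mulmxA -(mulmxA x) ip_scalar mul_mx_scalar -scalemxAl.
Qed.

Lemma tr_outer x y : \tr (x *m adjmx y) = ip y x.
Proof. by rewrite mxtrace_mulC ip_scalar mxtrace_scalar mulr1n. Qed.

Lemma pushM z v w : ip z z = 1 -> ip z v = 0 -> ip z w = 0 ->
  hopf_lift_push z v *m hopf_lift_push z w =
  v *m adjmx w + ip v w *: (z *m adjmx z).
Proof.
move=> zz zv zw; have vz : ip v z = 0 by rewrite ipC zv conjc0.
rewrite /hopf_lift_push mulmxDl !mulmxDr !outerM zz zw vz !scale0r scale1r.
by rewrite add0r addr0.
Qed.

Lemma tr_pushM z x y v w : ip z z = 1 ->
  ip z x = 0 -> ip z y = 0 -> ip z v = 0 -> ip z w = 0 ->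
  \tr (hopf_lift_push z x *m hopf_lift_push z y *m
       (hopf_lift_push z v *m hopf_lift_push z w)) =
  ip y v * ip w x + ip x y * ip v w.
Proof.
move=> zz zx zy zv zw; rewrite (pushM zz zx zy) (pushM zz zv zw).
have yz : ip y z = 0 by rewrite ipC zy conjc0.
rewrite mulmxDl mulmxDr (mulmxDr (_ *: _)) -!scalemxAl -!scalemxAr !outerM.
by rewrite zz zv yz !scale0r !scaler0 addr0 add0r scale1r mxtraceD !mxtraceZ !tr_outer zz mulr1.
Qed.

Opaque hopf_lift_push.

(* For [X] and [Y] tangent to CP^m at [P = z z^*], this is the Hermitian product
   [x^* y] of their horizontal lifts. *)
Definition hermCP P X Y : R[i] := \tr (P *m (X *m Y)).

Lemma hermCP_push z v w : ip z z = 1 -> ip z v = 0 -> ip z w = 0 ->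
  hermCP (z *m adjmx z) (hopf_lift_push z v) (hopf_lift_push z w) = ip v w.
Proof.
move=> zz zv zw; rewrite /hermCP (pushM zz zv zw) mulmxDr -scalemxAr !outerM.
by rewrite zz zv scale0r add0r mxtraceZ scale1r tr_outer zz mulr1.
Qed.

Lemma hermCP_Jr P X Y : CP P -> TCP P X -> TCP P Y ->
  hermCP P X (cpJ P Y) = 'i%C * hermCP P X Y.
Proof.
move=> hP hX hY; have [_ PP _] := hP.
rewrite /hermCP /cpJ -!scalemxAr mxtraceZ mulmxBr mulmxBr mxtraceB; congr (_ * _).
rewrite !mulmxA mxtrace_mulC !mulmxA PP.
by rewrite -(mulmxA P X P) (TCP_XPr hX) mulmxBr mulmxA PP subrr mul0mx mxtrace0 subr0.
Qed.

Lemma hermCP_Nr P X Y : hermCP P X (- Y) = - hermCP P X Y.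
Proof. by rewrite /hermCP !mulmxN raddfN. Qed.

Opaque hermCP.

Lemma CP_lift P : CP P -> exists2 z, ip z z = 1 & P = z *m adjmx z.
Proof. by move=> /CP_hopf[z zz ->]; exists z => //; rewrite /ip zz mxE. Qed.

Lemma TCP_lift z X : ip z z = 1 -> TCP (z *m adjmx z) X ->
  exists2 v, ip z v = 0 & X = hopf_lift_push z v.
Proof.
move=> zz /TCP_hopf[|v zv ->]; first by rewrite ip_scalar zz.
by exists v => //; rewrite /ip zv mxE.
Qed.

(** A product of two tangent vectors is block diagonal, and the two summands are the traces of the
    fourfold product over the kernel and over the image of [P]. The curvature computations thereby
    become scalar. *)
Lemma tr_TCP4 P X Y Z E : CP P -> TCP P X -> TCP P Y -> TCP P Z -> TCP P E ->
  \tr (X *m Y *m (Z *m E)) =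
  hermCP P Y Z * hermCP P E X + hermCP P X Y * hermCP P Z E.
Proof.
move=> /CP_lift[z zz ->] /(TCP_lift zz)[x zx ->] /(TCP_lift zz)[y zy ->].
move=> /(TCP_lift zz)[v zv ->] /(TCP_lift zz)[w zw ->].
rewrite (hermCP_push zz zy zv) (hermCP_push zz zw zx) (hermCP_push zz zx zy).
by rewrite (hermCP_push zz zv zw); exact: tr_pushM.
Qed.

Lemma hermCP_fs P X Y : CP P -> TCP P X -> TCP P Y ->
  fs X Y = complex.Re (hermCP P X Y).
Proof.
move=> /CP_lift[z zz ->] /(TCP_lift zz)[x zx ->] /(TCP_lift zz)[y zy ->].
by rewrite (hermCP_push zz zx zy) fs_hopf ?tr_outer ?ip_scalar ?zz ?zx ?zy
  ?mxtrace_scalar ?mulr1n ?raddf0.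
Qed.

Lemma hermCP_conj P X Y : CP P -> TCP P X -> TCP P Y ->
  hermCP P Y X = (hermCP P X Y)^*%C.
Proof.
move=> /CP_lift[z zz ->] /(TCP_lift zz)[x zx ->] /(TCP_lift zz)[y zy ->].
by rewrite (hermCP_push zz zx zy) (hermCP_push zz zy zx) ipC.
Qed.

Lemma hermCP_Jl P X Y : CP P -> TCP P X -> TCP P Y ->
  hermCP P (cpJ P X) Y = - 'i%C * hermCP P X Y.
Proof.
move=> hP hX hY; rewrite (hermCP_conj hP hY (TCP_cpJ hP hX)) hermCP_Jr//.
by rewrite rmorphM /= (hermCP_conj hP hX hY) conjcK; congr (_ * _); exact: conjc_i.
Qed.

Lemma hermCP_self P X : CP P -> TCP P X -> complex.Im (hermCP P X X) = 0.
Proof.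
by move=> hP hX; have := hermCP_conj hP hX hX; case: (hermCP _ _ _) => a b [] /= h; lra.
Qed.

Lemma complex_ReIm (c : R[i]) a b : complex.Re c = a -> complex.Im c = b -> c = a +i* b.
Proof. by case: c => ? ? /= -> ->. Qed.

End HopfLift.

Opaque cpJ fs.

(** * Curvature and second fundamental form of CP^m *)

Section CurvatureOfCP.
Context {R : realType} {m : nat}.
Variables (P N : 'M[R[i]]_m.+1).
Hypotheses (hP : CP P) (hN : TCP P N) (NN : fs N N = 1).
Implicit Types X Y Z : 'M[R[i]]_m.+1.

(** The double bracket is the curvature R(X, E)E of the symmetric space CP^m. Its holomorphic term
    is a multiple of [J E = N], hence invisible to [X] and [Z]; in the proof this appears as the
    reality of the Hermitian products with [E]. *)
Lemma curvature_CP X Z : TCP P X -> TCP P Z -> fs X N = 0 -> fs Z N = 0 ->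
  let E := - cpJ P N in let C := X *m E - E *m X in
  fs (C *m E - E *m C) Z = fs X Z - fs X E * fs Z E.
Proof.
move=> hX hZ XN ZN E C.
have hE : TCP P E by exact/TCPN/TCP_cpJ.
have EE : hermCP P E E = 1.
  apply: complex_ReIm; last exact: hermCP_self.
  by rewrite -hermCP_fs// fsNl fsNr opprK fs_cpJJ.
have real_herm Y : TCP P Y -> fs Y N = 0 -> hermCP P Y E = (fs Y E)%:C.
  move=> hY YN; apply: complex_ReIm; first by rewrite -hermCP_fs.
  rewrite hermCP_Nr hermCP_Jr//; have : complex.Re (hermCP P Y N) = 0 by rewrite -hermCP_fs.
  by case: (hermCP _ _ _) => a b /= ->; rewrite mul1r mul0r add0r oppr0.
have XE := real_herm _ hX XN; have ZE := real_herm _ hZ ZN.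
have EX : hermCP P E X = (fs X E)%:C by rewrite (hermCP_conj hP hX hE) XE conjc_real.
have EZ : hermCP P E Z = (fs Z E)%:C by rewrite (hermCP_conj hP hZ hE) ZE conjc_real.
clearbody E; rewrite [LHS]fs_def.
have -> : (C *m E - E *m C) *m Z = X *m E *m (E *m Z) - E *m X *m (E *m Z)
    - E *m X *m (E *m Z) + E *m E *m (X *m Z).
  by rewrite /C !(mulmxBl, mulmxBr) !mulmxA; mxlin.
rewrite mxtraceD !mxtraceB !(tr_TCP4 hP)// EE XE EX EZ ZE (hermCP_conj hP hX hZ).
rewrite (hermCP_fs hP hX hZ).
case: (hermCP P X Z) => a b /=.
by field.
Qed.

(* The Hermitian matrix [Q (Y N + N Y)] is the component of the derivative of
   a tangent field [N] in the direction [Y] that is normal to CP^m. *)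
Lemma codazzi_CP X Y : TCP P X -> TCP P Y ->
  fs X N = 0 -> fs Y N = 0 -> fs X (cpJ P N) = 0 -> fs Y (cpJ P N) = 0 ->
  fs ((Y *m N + N *m Y) - (P *m (Y *m N + N *m Y)) *+ 2)
     ('i%C *: (X *m N - N *m X)) = fs (cpJ P X) Y.
Proof.
move=> hX hY XN YN XJN YJN.
(* Orthogonality to [N] kills the real part of the Hermitian product, orthogonality to [J N] the
   imaginary part. *)
have herm0 Z : TCP P Z -> fs Z N = 0 -> fs Z (cpJ P N) = 0 -> hermCP P Z N = 0.
  move=> hZ; rewrite (hermCP_fs hP hZ hN) (hermCP_fs hP hZ (TCP_cpJ hP hN)) hermCP_Jr// Re_iM.
  by case: (hermCP _ _ _) => a b /= -> /eqP; rewrite oppr_eq0 => /eqP ->.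
have hXN := herm0 _ hX XN XJN; have hYN := herm0 _ hY YN YJN.
have hNX : hermCP P N X = 0 by rewrite (hermCP_conj hP hX hN) hXN conjc0.
have hNY : hermCP P N Y = 0 by rewrite (hermCP_conj hP hY hN) hYN conjc0.
have hNN : hermCP P N N = 1.
  by apply: complex_ReIm; [rewrite -hermCP_fs|exact: hermCP_self].
(* The factor [1 - 2 P] acts on tangent vectors as [- 'i J]. The normal component thus becomes a sum
   of products of two tangent vectors, to which [tr_TCP4] applies. *)
have QJ Z : TCP P Z -> Z - (P *m Z) *+ 2 = - 'i%C *: cpJ P Z.
  by move=> hZ; rewrite cpJE// scalerA mulNr mulii opprK scale1r.
rewrite (_ : _ - _ *+ 2 = - 'i%C *: (cpJ P Y *m N + cpJ P N *m Y)); last first.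
  rewrite scalerDr !scalemxAl -!QJ// !mulmxBl mulmxDr !mulmxA !mulr2n !mulmxDl.
  by mxlin.
rewrite [LHS]fs_def -scalemxAl -scalemxAr scalerA mulNr mulii opprK scale1r.
rewrite mulmxDl (mulmxBr (cpJ P Y *m N)) (mulmxBr (cpJ P N *m Y)) mxtraceD 2!mxtraceB.
have hJY := TCP_cpJ hP hY; have hJN := TCP_cpJ hP hN.
rewrite !(tr_TCP4 hP)// !hermCP_Jl// !hermCP_Jr// !(hXN, hYN, hNX, hNY, hNN).
rewrite (hermCP_fs hP (TCP_cpJ hP hX) hY) hermCP_Jl//.
rewrite (hermCP_conj hP hX hY); case: (hermCP P X Y) => a b /=.
by field.
Qed.

End CurvatureOfCP.

Transparent mulmx mxtrace adjmx hopf_lift_push hermCP cpJ fs.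

(** * Differential calculus in a chart *)

Section ScalarCalculus.
Context {R : realType} {n : nat}.
Implicit Types (u v w : 'rV[R]_n) (h g : 'rV[R]_n -> R) (U : set 'rV[R]_n).

Lemma near_eq_differentiable (V W : normedModType R) (f g : V -> W) x :
  (\near x, f x = g x) -> differentiable f x -> differentiable g x.
Proof.
move=> fg df; have /diff_locallyP[dc /eqaddoP dE] := df.
have fgx : f x = g x := nbhs_singleton fg.
have gE : g \o shift x = cst (g x) + 'd f x +o_ 0 id.
  apply/eqaddoP => e e0; have := dE e e0.
  apply: filter_app; have : \forall y \near 0, f (y + x) = g (y + x).
    by move: fg; rewrite (near_shift 0 x); apply: filter_app; near=> y; rewrite /= subr0.
  apply: filter_app; near=> y => /= fgy.
  by rewrite !fctE /= fgy fgx.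
apply/diff_locallyP; rewrite (diff_unique dc gE); split=> //.
Unshelve. all: by end_near. Qed.

Lemma derive_lineE h u v (r : R) :
  differentiable h (r *: v + u) ->
  is_derive r 1 (fun t : R => h (t *: v + u)) ('D_v h (r *: v + u)).
Proof.
move=> dh.
have E : (fun t : R => t^-1 *: (h ((t *: 1 + r) *: v + u) - h (r *: v + u))) =
    (fun t : R => t^-1 *: (h (t *: v + (r *: v + u)) - h (r *: v + u))).
  by apply/funext => t; rewrite scalerDl -scalerA scale1r addrA.
have dv : derivable h (r *: v + u) v by exact: diff_derivable.
apply: DeriveDef; first by rewrite /derivable E.
by rewrite /derive E.
Qed.

(** The mean value theorem along [v], applied to the difference of [h] on two parallel segments,
    leaves a difference of two values of ['D_v h]; its differentiability at [u] estimates that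
    difference. *)
Lemma second_difference h u v w : (\forall x \near u, differentiable h x) ->
  differentiable ('D_v h) u -> forall e, 0 < e ->
  \forall s \near 0^'+,
    `|h (s *: v + (s *: w + u)) - h (s *: v + u) - (h (s *: w + u) - h u)
      - s ^+ 2 * 'D_w ('D_v h) u| <= e * s ^+ 2.
Proof.
move=> hd kd e e0; set k := 'D_v h.
(* The two remainders are at most [e'] times the norms of [c *: v + s *: w] and [c *: v], together
   at most [e' * s * (2 * |v| + |w|)]. The added 1 keeps the denominator positive. *)
pose e' := e / (2 * `|v| + `|w| + 1).
have c0 : 0 < 2 * `|v| + `|w| + 1 by rewrite ltr_wpDl// addr_ge0// mulr_ge0.
have e'0 : 0 < e' by rewrite divr_gt0.
have [_ /eqaddoP/(_ e' e'0) kE] := (diff_locallyP _ _).1 kd.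
have {}hd : \forall x \near (0 : 'rV[R]_n), differentiable h (x + u).
  by move: hd; rewrite (near_shift 0 u); apply: filter_app; near=> y; rewrite /= subr0.
have : \forall x \near (0 : 'rV[R]_n), differentiable h (x + u) /\
     `|k (x + u) - k u - 'd k u x| <= e' * `|x|.
  near=> x; split; first by near: x.
  have : `|(k \o shift u - (cst (k u) + 'd k u)) x| <= e' * `|x| by near: x.
  by rewrite !fctE /= opprD addrA.
move=> /nbhs_ballP[d /= d0 H].
near=> s.
have s0 : 0 < s by [].
have small (a b : R) : 0 <= a <= s -> 0 <= b <= s -> ball 0 d (a *: v + b *: w).
  move=> /andP[a0 ae] /andP[b0 be]; rewrite -ball_normE /= add0r normrN.
  rewrite (le_lt_trans (ler_normD _ _))// !normrZ !ger0_norm//.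
  apply: (@le_lt_trans _ _ (s * (`|v| + `|w|))).
    by rewrite mulrDr lerD// ler_wpM2r.
  apply: (@lt_le_trans _ _ (s * (`|v| + `|w| + 1))).
    by rewrite ltr_pM2l// ltrDl.
  rewrite -ler_pdivlMr ?ltr_wpDl ?addr_ge0//.
  by near: s; apply: nbhs_right_le; rewrite divr_gt0// ltr_wpDl// addr_ge0.
pose g (r : R) := h (r *: v + (s *: w + u)) - h (r *: v + u).
pose g' (r : R) := k (r *: v + (s *: w + u)) - k (r *: v + u).
have gg' (r : R) : 0 <= r <= s -> is_derive r 1 g (g' r).
  move=> rs; apply: is_deriveB; apply: derive_lineE.
    rewrite addrA; apply: (H _ _).1; apply: small => //.
    by rewrite lexx ltW.
  have := small r 0 rs; rewrite lexx ltW// scale0r addr0 => /(_ isT) /H[]//.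
have gg'_in (r : R) : r \in `]0, s[ -> is_derive r 1 g (g' r).
  by rewrite in_itv /= => /andP[r0 rs]; apply: gg'; rewrite !ltW.
have [|c /[!in_itv]/= /andP[c0' cs]] := MVT s0 gg'_in.
  apply: derivable_within_continuous => r; rewrite in_itv /= => rs.
  by have [] := gg' _ rs.
rewrite {1 2}/g scale0r !add0r subr0 => ->.
have cs' : 0 <= c <= s by rewrite !ltW.
have [_ b1] := H _ (small c s cs' ltac:(by rewrite lexx ltW)).
have [_ b2] := H _ (small c 0 cs' ltac:(by rewrite lexx ltW)).
rewrite scale0r addr0 in b2.
rewrite deriveE//.
have -> : g' c * s - s ^+ 2 * 'd k u w =
   s * ((k (c *: v + s *: w + u) - k u - 'd k u (c *: v + s *: w))
       - (k (c *: v + u) - k u - 'd k u (c *: v))).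
  by rewrite /g' addrA !linearD !linearZ /= /GRing.scale /=; ring.
rewrite normrM gtr0_norm// expr2 mulrCA ler_pM2l//.
rewrite (le_trans (ler_normB _ _))//.
rewrite (le_trans (lerD b1 b2))//.
have n1 : `|c *: v + s *: w| <= s * `|v| + s * `|w|.
  rewrite (le_trans (ler_normD _ _))// !normrZ !gtr0_norm// lerD2r ler_wpM2r// ltW//.
have n2 : `|c *: v| <= s * `|v| by rewrite normrZ gtr0_norm// ler_wpM2r// ltW.
rewrite -mulrDr (@le_trans _ _ (e' * (s * (2 * `|v| + `|w| + 1))))//.
  rewrite ler_pM2l// (le_trans (lerD n1 n2))//.
  by have := ltW s0; nra.
by rewrite mulrCA /e' divfK ?gt_eqF// mulrC.
Unshelve. all: by end_near. Qed.

(** The second difference does not change when [v] and [w] are exchanged, and divided by [s ^+ 2] it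
    tends to either mixed derivative. *)
Lemma derive_symm h u v w : (\forall x \near u, differentiable h x) ->
  differentiable ('D_v h) u -> differentiable ('D_w h) u ->
  'D_w ('D_v h) u = 'D_v ('D_w h) u.
Proof.
move=> hd dv dw; apply/eqP; rewrite -subr_eq0 -normr_le0; apply/ler_addgt0Pl => e e0.
rewrite addr0.
have e20 : 0 < e / 2 by rewrite divr_gt0.
have N1 := second_difference w hd dv e20; have N2 := second_difference v hd dw e20.
have N3 : \forall s \near (0 : R)^'+, 0 < s by exact: nbhs_right_gt.
have [s [[/= H1 H2] /= s0]] := @filter_ex _ _ _ _ (filterI (filterI N1 N2) N3).
rewrite (addrCA (s *: w)) in H2.
have s2 : 0 < s ^+ 2 by rewrite exprn_gt0.
move: ('D_w ('D_v h) u) ('D_v ('D_w h) u) H1 H2 => A B.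
move: (h (s *: v + (s *: w + u))) (h (s *: v + u)) (h (s *: w + u)) (h u) => a b c d H1 H2.
rewrite -(ler_pM2l s2) -[X in X * `|_|]gtr0_norm// -normrM.
have -> : s ^+ 2 * (A - B) = (a - c - (b - d) - s ^+ 2 * B) - (a - b - (c - d) - s ^+ 2 * A).
  by ring.
rewrite (le_trans (ler_normB _ _))// (le_trans (lerD H2 H1))//.
by rewrite -mulrDl -splitr mulrC.
Qed.

End ScalarCalculus.

(** * Differentiation rules for real, complex and matrix valued functions *)

Section Differentials.
Context {R : realType} {n : nat}.
Implicit Types (u v w : 'rV[R]_n) (U : set 'rV[R]_n).

Fact dm_key : unit. Proof. by []. Qed.
(* [dmx], locked so that unification never unfolds the underlying limits. *)
Definition dm d : ('rV[R]_n -> 'M[R[i]]_d) -> _ := locked_with dm_key (@dmx R n d).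
Lemma dmE d (F : 'rV[R]_n -> 'M[R[i]]_d) u w : dm F u w = dmx F u w.
Proof. by rewrite /dm locked_withE. Qed.

(** Keeping differentiability and the value of the derivative in one predicate lets the rules below
    compute a derivative by composition. *)
Definition rD (h : 'rV[R]_n -> R) u (L : 'rV[R]_n -> R) : Prop :=
  differentiable h u /\ forall w, 'D_w h u = L w.

Definition cD (h : 'rV[R]_n -> R[i]) u (L : 'rV[R]_n -> R[i]) : Prop :=
  rD (fun x => complex.Re (h x)) u (fun w => complex.Re (L w)) /\
  rD (fun x => complex.Im (h x)) u (fun w => complex.Im (L w)).

Definition mD p (F : 'rV[R]_n -> 'M[R[i]]_p) u (L : 'rV[R]_n -> 'M[R[i]]_p) : Prop :=
  forall a b, cD (fun x => F x a b) u (fun w => L w a b).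

Definition mdiff p (F : 'rV[R]_n -> 'M[R[i]]_p) u : Prop := mD F u (dm F u).

Lemma rD_ext h g u L K : rD h u L -> (\near u, h u = g u) -> L =1 K -> rD g u K.
Proof.
move=> [dh hL] hg LK; split; first exact: near_eq_differentiable dh.
by move=> w; rewrite -LK -hL; apply/esym/near_eq_derive.
Qed.

Lemma rD_lin h u L : rD h u L -> forall a v w, L (a *: v + w) = a * L v + L w.
Proof. by move=> [dh hL] a v w; rewrite -!hL !deriveE// linearP. Qed.

Lemma rD_cst (c : R) u : rD (fun=> c) u (fun=> 0).
Proof. by split=> [|w]; [exact: differentiable_cst|exact: derive_cst]. Qed.

Lemma rD_add h g u L K : rD h u L -> rD g u K ->
  rD (fun x => h x + g x) u (fun w => L w + K w).
Proof.
move=> [dh hL] [dg gK]; split; first exact: differentiableD.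
by move=> w; rewrite -hL -gK; apply: deriveD; exact: diff_derivable.
Qed.

Lemma rD_opp h u L : rD h u L -> rD (fun x => - h x) u (fun w => - L w).
Proof.
move=> [dh hL]; split; first exact: differentiableN.
by move=> w; rewrite -hL; apply: deriveN; exact: diff_derivable.
Qed.

Lemma rD_mul h g u L K : rD h u L -> rD g u K ->
  rD (fun x => h x * g x) u (fun w => L w * g u + h u * K w).
Proof.
move=> [dh hL] [dg gK]; split; first exact: differentiableM.
move=> w; rewrite -hL -gK addrC (mulrC ('D_w h u)).
by apply: deriveM; exact: diff_derivable.
Qed.

Lemma cD_ext h g u L K : cD h u L -> (\near u, h u = g u) -> L =1 K -> cD g u K.
Proof.
move=> [h1 h2] hg LK; split; [apply: rD_ext h1 _ _|apply: rD_ext h2 _ _].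
- by move: hg; apply: filter_app; near=> x => ->.
- by move=> w; rewrite LK.
- by move: hg; apply: filter_app; near=> x => ->.
- by move=> w; rewrite LK.
Unshelve. all: by end_near. Qed.

Lemma cD_cst (c : R[i]) u : cD (fun=> c) u (fun=> 0).
Proof. by split; exact: rD_cst. Qed.

Lemma cD_add h g u L K : cD h u L -> cD g u K ->
  cD (fun x => h x + g x) u (fun w => L w + K w).
Proof.
move=> [h1 h2] [g1 g2]; split.
  apply: (rD_ext (rD_add h1 g1)) => [|w]; last by case: (L w) (K w) => ? ? [].
  by near=> x; case: (h x) (g x) => ? ? [].
apply: (rD_ext (rD_add h2 g2)) => [|w]; last by case: (L w) (K w) => ? ? [].
by near=> x; case: (h x) (g x) => ? ? [].
Unshelve. all: by end_near. Qed.

Lemma cD_mul h g u L K : cD h u L -> cD g u K ->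
  cD (fun x => h x * g x) u (fun w => L w * g u + h u * K w).
Proof.
move=> [h1 h2] [g1 g2]; split.
  apply: (rD_ext (rD_add (rD_mul h1 g1) (rD_opp (rD_mul h2 g2)))) => [|w].
    by near=> x; case: (h x) (g x) => ? ? [].
  by case: (L w) (K w) (h u) (g u) => ? ? [? ?] [? ?] [? ?] /=; ring.
apply: (rD_ext (rD_add (rD_mul h1 g2) (rD_mul h2 g1))) => [|w].
  by near=> x; case: (h x) (g x) => ? ? [].
by case: (L w) (K w) (h u) (g u) => ? ? [? ?] [? ?] [? ?] /=; ring.
Unshelve. all: by end_near. Qed.

Lemma cD_sum I (s : seq I) (h : I -> 'rV[R]_n -> R[i]) u L :
  (forall i, cD (h i) u (L i)) ->
  cD (fun x => \sum_(i <- s) h i x) u (fun w => \sum_(i <- s) L i w).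
Proof.
move=> H; elim: s => [|i s IH].
  apply: (cD_ext (cD_cst 0 u)) => [|w]; rewrite ?big_nil//.
  by near=> x; rewrite big_nil.
apply: (cD_ext (cD_add (H i) IH)) => [|w]; rewrite ?big_cons//.
by near=> x; rewrite big_cons.
Unshelve. all: by end_near. Qed.

Section Matrices.
Context {p : nat}.
Implicit Types F G : 'rV[R]_n -> 'M[R[i]]_p.

Lemma mD_ext F G u L K : mD F u L -> (\near u, F u = G u) -> L =1 K -> mD G u K.
Proof.
move=> H FG LK a b; apply: (cD_ext (H a b)) => [|w]; last by rewrite LK.
by move: FG; apply: filter_app; near=> x => ->.
Unshelve. all: by end_near. Qed.

Lemma mDE F u L : mD F u L -> forall w, dm F u w = L w.
Proof.
move=> H w; apply/matrixP => a b; rewrite dmE mxE; have [[_ h1] [_ h2]] := H a b.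
by rewrite h1 h2; case: (L w a b).
Qed.

Lemma mD_mdiff F u L : mD F u L -> mdiff F u.
Proof.
move=> H; apply: (mD_ext H); first by near=> x.
by move=> w; rewrite (mDE H).
Unshelve. all: by end_near. Qed.

Lemma mdiffP F u : (forall a b, differentiable (fun x => complex.Re (F x a b)) u /\
  differentiable (fun x => complex.Im (F x a b)) u) -> mdiff F u.
Proof.
by move=> H a b; have [h1 h2] := H a b; split; split=> // w; rewrite dmE mxE.
Qed.

Lemma mD_add F G u L K : mD F u L -> mD G u K ->
  mD (fun x => F x + G x) u (fun w => L w + K w).
Proof.
move=> H1 H2 a b; apply: (cD_ext (cD_add (H1 a b) (H2 a b))).
  by near=> x; rewrite mxE.
by move=> w; rewrite mxE.
Unshelve. all: by end_near. Qed.

Lemma mD_scale F c u L K : cD c u K -> mD F u L ->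
  mD (fun x => c x *: F x) u (fun w => K w *: F u + c u *: L w).
Proof.
move=> H1 H2 a b; apply: (cD_ext (cD_mul H1 (H2 a b))).
  by near=> x; rewrite mxE.
by move=> w; rewrite !mxE.
Unshelve. all: by end_near. Qed.

Lemma mD_scalec F c u L : mD F u L -> mD (fun x => c *: F x) u (fun w => c *: L w).
Proof.
move=> H; apply: (mD_ext (mD_scale (cD_cst c u) H)); first by near=> x.
by move=> w; rewrite scale0r add0r.
Unshelve. all: by end_near. Qed.

Lemma mD_opp F u L : mD F u L -> mD (fun x => - F x) u (fun w => - L w).
Proof.
move=> H; apply: (mD_ext (mD_scalec (-1) H)) => [|w]; last by rewrite scaleN1r.
by near=> x; rewrite scaleN1r.
Unshelve. all: by end_near. Qed.

Lemma mD_mul F G u L K : mD F u L -> mD G u K ->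
  mD (fun x => F x *m G x) u (fun w => L w *m G u + F u *m K w).
Proof.
move=> H1 H2 a b; apply: (cD_ext (cD_sum (index_enum 'I_p)
    (fun c => cD_mul (H1 a c) (H2 c b)))) => [|w].
  by near=> x; rewrite mxE.
by rewrite !mxE -big_split.
Unshelve. all: by end_near. Qed.

Lemma mD_sum I (s : seq I) (F : I -> 'rV[R]_n -> 'M[R[i]]_p) u L :
  (forall i, mD (F i) u (L i)) ->
  mD (fun x => \sum_(i <- s) F i x) u (fun w => \sum_(i <- s) L i w).
Proof.
move=> H a b; apply: (cD_ext (cD_sum s (fun i => H i a b))) => [|w].
  by near=> x; rewrite summxE.
by rewrite summxE.
Unshelve. all: by end_near. Qed.

Lemma cD_tr F u L : mD F u L -> cD (fun x => \tr (F x)) u (fun w => \tr (L w)).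
Proof. by move=> H; exact: (cD_sum _ (fun i => H i i)). Qed.

Lemma mD_adjmx F u L : mD F u L -> mD (fun x => adjmx (F x)) u (fun w => adjmx (L w)).
Proof.
move=> H a b; have [h1 h2] := H b a; split.
  apply: (rD_ext h1) => [|w]; last by rewrite !mxE Re_conjc.
  by near=> x; rewrite !mxE Re_conjc.
apply: (rD_ext (rD_opp h2)) => [|w]; last by rewrite !mxE Im_conjc.
by near=> x; rewrite !mxE Im_conjc.
Unshelve. all: by end_near. Qed.

Lemma dmx_lin F u : mdiff F u -> forall a v w,
  dm F u (a *: v + w) = a%:C *: dm F u v + dm F u w.
Proof.
move=> H a v w; apply/matrixP => i j; have [h1 h2] := H i j.
apply: (etrans (complexE _)); rewrite (rD_lin h1) (rD_lin h2) !mxE.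
case: (dm F u v i j) (dm F u w i j) => ? ? [? ?].
by apply/eqP; rewrite eq_complex /=; apply/andP; split; apply/eqP; ring.
Qed.

Lemma dmx_near F G u w : (\near u, F u = G u) -> dm F u w = dm G u w.
Proof.
move=> FG; apply/matrixP => a b; rewrite !dmE !mxE; congr (_ +i* _); apply: near_eq_derive.
  by move: FG; apply: filter_app; near=> x => ->.
by move: FG; apply: filter_app; near=> x => ->.
Unshelve. all: by end_near. Qed.

Lemma mdiff_near F G u : (\near u, F u = G u) -> mdiff F u -> mdiff G u.
Proof. by move=> FG H; apply: (mD_ext H) => // w; exact: dmx_near. Qed.

End Matrices.

Section Square.
Context {m : nat}.
Implicit Types F G : 'rV[R]_n -> 'M[R[i]]_m.+1.

Lemma mD_rscale F r u L K : rD r u K -> mD F u L ->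
  mD (fun x => r x *:r F x) u (fun w => K w *:r F u + r u *:r L w).
Proof.
move=> H1 H2; apply: mD_scale H2.
by split => //=; exact: rD_cst.
Qed.

Lemma rD_fs F G u L K : mD F u L -> mD G u K ->
  rD (fun x => fs (F x) (G x)) u (fun w => fs (L w) (G u) + fs (F u) (K w)).
Proof.
move=> H1 H2; have [h _] := cD_tr (mD_mul H1 H2).
apply: (rD_ext (rD_mul h (rD_cst 2^-1 u))); first by near=> x.
by move=> w; rewrite mulr0 addr0 /fs !raddfD /= mulrDl.
Unshelve. all: by end_near. Qed.

End Square.

End Differentials.

(** * Closure properties of smooth functions *)

Section Smooth.
Context {R : realType} {n : nat} {U : set 'rV[R]_n}.
Hypothesis oU : open U.
Implicit Types (u v w : 'rV[R]_n) (h g : 'rV[R]_n -> R).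

Lemma near_open (P : 'rV[R]_n -> Prop) u : U u -> (forall x, U x -> P x) ->
  \forall x \near u, P x.
Proof. by move=> Uu H; near=> x; apply: H; near: x; exact: open_nbhs_nbhs.
Unshelve. all: by end_near. Qed.

Lemma Ck_ext k h g : (forall u, U u -> h u = g u) -> Ck k U h -> Ck k U g.
Proof.
elim: k h g => [|k IH] h g hg /=.
  move=> H u Uu; rewrite /prop_for /continuous_at -hg//.
  have E : {near nbhs u, h =1 g} := near_open Uu hg.
  exact: cvg_trans (near_eq_cvg E) (H u Uu).
move=> [dh dwh]; split=> [u Uu|w].
  by apply: (near_eq_differentiable _ (dh u Uu)); exact: (near_open Uu hg).
apply: IH (dwh w) => u Uu; apply: near_eq_derive; exact: (near_open Uu hg).
Qed.

Lemma CkW k h : Ck k.+1 U h -> Ck k U h.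
Proof.
elim: k h => [|k IH] h [dh dwh].
  by move=> u Uu; exact/differentiable_continuous/dh.
by split=> // w; apply: IH; exact: dwh.
Qed.

Lemma CkS_rD k h u : Ck k.+1 U h -> U u -> rD h u (fun w => 'D_w h u).
Proof. by move=> [dh _] Uu; split => //; exact: dh. Qed.

Lemma Ck_cst k c : Ck k U (fun=> c).
Proof.
elim: k c => [|k IH] c /=; first by move=> u _; exact: cst_continuous.
split=> [u _|w]; first exact: differentiable_cst.
by apply: (Ck_ext _ (IH 0)) => u _; rewrite (derive_cst c).
Qed.

Lemma Ck_add k h g : Ck k U h -> Ck k U g -> Ck k U (fun x => h x + g x).
Proof.
elim: k h g => [|k IH] h g hh hg.
  by move=> u Uu; apply: continuousD; [exact: hh|exact: hg].
split=> [u Uu|w].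
  by have [] := rD_add (CkS_rD hh Uu) (CkS_rD hg Uu).
apply: (Ck_ext _ (IH _ _ (hh.2 w) (hg.2 w))) => u Uu.
by have [_ ->] := rD_add (CkS_rD hh Uu) (CkS_rD hg Uu).
Qed.

Lemma Ck_mul k h g : Ck k U h -> Ck k U g -> Ck k U (fun x => h x * g x).
Proof.
elim: k h g => [|k IH] h g hh hg.
  by move=> u Uu; apply: continuousM; [exact: hh|exact: hg].
split=> [u Uu|w].
  by have [] := rD_mul (CkS_rD hh Uu) (CkS_rD hg Uu).
apply: (Ck_ext _ (Ck_add (IH _ _ (hh.2 w) (CkW hg)) (IH _ _ (CkW hh) (hg.2 w)))) => u Uu.
by have [_ ->] := rD_mul (CkS_rD hh Uu) (CkS_rD hg Uu).
Qed.

Lemma smooth_ext h g : (forall u, U u -> h u = g u) -> smooth U h -> smooth U g.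
Proof. by move=> hg H k; exact: Ck_ext hg (H k). Qed.

Lemma smooth_cst c : smooth U (fun=> c). Proof. by move=> k; exact: Ck_cst. Qed.

Lemma smooth_add h g : smooth U h -> smooth U g -> smooth U (fun x => h x + g x).
Proof. by move=> hh hg k; exact: Ck_add. Qed.

Lemma smooth_mul h g : smooth U h -> smooth U g -> smooth U (fun x => h x * g x).
Proof. by move=> hh hg k; exact: Ck_mul. Qed.

Lemma smooth_opp h : smooth U h -> smooth U (fun x => - h x).
Proof.
by move=> hh; apply: (smooth_ext _ (smooth_mul (smooth_cst (-1)) hh)) => u _; rewrite mulN1r.
Qed.

Lemma smooth_derive h w : smooth U h -> smooth U ('D_w h).
Proof. by move=> hh k; have [_] := hh k.+1; exact. Qed.

Lemma smooth_differentiable h u : smooth U h -> U u -> differentiable h u.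
Proof. by move=> /(_ 1%N) [H _] Uu; exact: H. Qed.

Definition csmooth (h : 'rV[R]_n -> R[i]) :=
  smooth U (fun u => complex.Re (h u)) /\ smooth U (fun u => complex.Im (h u)).

Lemma csmooth_ext (h g : 'rV[R]_n -> R[i]) : (forall u, U u -> h u = g u) -> csmooth h -> csmooth g.
Proof. by move=> hg [h1 h2]; split; [apply: smooth_ext h1|apply: smooth_ext h2] => u /hg ->. Qed.

Lemma csmooth_cst c : csmooth (fun=> c). Proof. by split; exact: smooth_cst. Qed.

Lemma csmooth_add (h g : 'rV[R]_n -> R[i]) : csmooth h -> csmooth g -> csmooth (fun x => h x + g x).
Proof.
move=> [h1 h2] [g1 g2]; split.
  by apply: (smooth_ext _ (smooth_add h1 g1)) => u _; case: (h u) (g u) => ? ? [].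
by apply: (smooth_ext _ (smooth_add h2 g2)) => u _; case: (h u) (g u) => ? ? [].
Qed.

Lemma csmooth_mul (h g : 'rV[R]_n -> R[i]) : csmooth h -> csmooth g -> csmooth (fun x => h x * g x).
Proof.
move=> [h1 h2] [g1 g2]; split.
  apply: (smooth_ext _ (smooth_add (smooth_mul h1 g1) (smooth_opp (smooth_mul h2 g2)))).
  by move=> u _; case: (h u) (g u) => ? ? [].
apply: (smooth_ext _ (smooth_add (smooth_mul h1 g2) (smooth_mul h2 g1))).
by move=> u _; case: (h u) (g u) => ? ? [].
Qed.

Lemma csmooth_sum I (s : seq I) (h : I -> 'rV[R]_n -> R[i]) :
  (forall i, csmooth (h i)) -> csmooth (fun x => \sum_(i <- s) h i x).
Proof.
move=> H; elim: s => [|i s IH].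
  by apply: (csmooth_ext _ (csmooth_cst 0)) => u _; rewrite big_nil.
by apply: (csmooth_ext _ (csmooth_add (H i) IH)) => u _; rewrite big_cons.
Qed.

Section Matrices.
Context {p : nat}.
Implicit Types F G : 'rV[R]_n -> 'M[R[i]]_p.

Lemma smooth_mx_cst (A : 'M[R[i]]_p) : smooth_mx U (fun=> A).
Proof. by move=> a b; exact: csmooth_cst. Qed.

Lemma smooth_mx_add F G : smooth_mx U F -> smooth_mx U G -> smooth_mx U (fun x => F x + G x).
Proof.
move=> H1 H2 a b; apply: (csmooth_ext _ (csmooth_add (H1 a b) (H2 a b))) => u _.
by rewrite mxE.
Qed.

Lemma smooth_mx_scale F c : csmooth c -> smooth_mx U F -> smooth_mx U (fun x => c x *: F x).
Proof.
move=> H1 H2 a b; apply: (csmooth_ext _ (csmooth_mul H1 (H2 a b))) => u _.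
by rewrite mxE.
Qed.

Lemma smooth_mx_opp F : smooth_mx U F -> smooth_mx U (fun x => - F x).
Proof.
move=> H a b; apply: (csmooth_ext _ (csmooth_mul (csmooth_cst (-1)) (H a b))) => u _.
by rewrite mxE mulN1r.
Qed.

Lemma smooth_mx_mul F G : smooth_mx U F -> smooth_mx U G -> smooth_mx U (fun x => F x *m G x).
Proof.
move=> H1 H2 a b.
apply: (csmooth_ext _ (csmooth_sum (index_enum 'I_p) (fun c => csmooth_mul (H1 a c) (H2 c b)))).
by move=> u _; rewrite mxE.
Qed.

Lemma smooth_mx_mdiff F u : smooth_mx U F -> U u -> mdiff F u.
Proof.
by move=> H Uu; apply: mdiffP => a b; have [h1 h2] := H a b; split; exact: smooth_differentiable.
Qed.

Lemma smooth_mx_dmx F w : smooth_mx U F -> smooth_mx U (fun u => dm F u w).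
Proof.
move=> H a b; have [h1 h2] := H a b; split.
  by apply: (smooth_ext _ (smooth_derive w h1)) => u _; rewrite dmE mxE.
by apply: (smooth_ext _ (smooth_derive w h2)) => u _; rewrite dmE mxE.
Qed.

Lemma dmx_symm F u v w : smooth_mx U F -> U u ->
  dm (fun x => dm F x v) u w = dm (fun x => dm F x w) u v.
Proof.
move=> H Uu; apply/matrixP => a b; have [h1 h2] := H a b.
have symm h : smooth U h -> 'D_w ('D_v h) u = 'D_v ('D_w h) u.
  move=> hh; apply: derive_symm.
  - by apply: near_open => // x Ux; exact: smooth_differentiable hh Ux.
  - exact: smooth_differentiable (smooth_derive v hh) Uu.
  - exact: smooth_differentiable (smooth_derive w hh) Uu.
have ReE x : (fun y => complex.Re (dm F y x a b)) = 'D_x (fun y => complex.Re (F y a b)).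
  by apply/funext => y; rewrite dmE mxE.
have ImE x : (fun y => complex.Im (dm F y x a b)) = 'D_x (fun y => complex.Im (F y a b)).
  by apply/funext => y; rewrite dmE mxE.
rewrite 2!dmE [LHS]mxE [RHS]mxE.
rewrite ReE.
rewrite ReE.
rewrite ImE ImE.
rewrite (symm _ h1).
by rewrite (symm _ h2).
Qed.

End Matrices.

Section Square.
Context {m : nat}.
Implicit Types F G : 'rV[R]_n -> 'M[R[i]]_m.+1.

Lemma smooth_fs F G : smooth_mx U F -> smooth_mx U G -> smooth U (fun x => fs (F x) (G x)).
Proof.
move=> H1 H2; have [h _] := csmooth_sum (index_enum 'I_m.+1) (fun a => smooth_mx_mul H1 H2 a a).
by apply: (smooth_ext _ (smooth_mul h (smooth_cst 2^-1))) => u _.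
Qed.

Lemma smooth_mx_rscale F r : smooth U r -> smooth_mx U F -> smooth_mx U (fun x => r x *:r F x).
Proof. by move=> H1 H2; apply: smooth_mx_scale H2; split=> //=; exact: smooth_cst. Qed.

End Square.
End Smooth.

(** * Hypersurface tangent spaces *)

Section Projections.
Context {R : realType} {m : nat}.
Implicit Types (X Y Z P C N V : 'M[R[i]]_m.+1).

(** Since [tproj] is a choice, it must be identified: two candidates differ by an element of [T]
    orthogonal to [T], hence to itself, and [fs] is definite on Hermitian matrices. *)
Lemma tproj_unique (T : set 'M[R[i]]_m.+1) X Y :
  (forall Z, T Z -> adjmx Z = Z) -> (forall Z Z', T Z -> T Z' -> T (Z - Z')) ->
  T Y -> (forall Z, T Z -> fs (X - Y) Z = 0) -> tproj T X = Y.
Proof.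
move=> Th TB TY XY; rewrite /tproj.
case: (xgetPex 0 (ex_intro _ Y (conj TY XY) :
  exists Y, [set Y | T Y /\ forall Z, T Z -> fs (X - Y) Z = 0] Y)).
set Y' := xget _ _ => TY' XY'.
have TYY := TB _ _ TY' TY.
apply/eqP; rewrite -subr_eq0; apply/eqP/fs_eq0; first exact: Th.
have E : Y' - Y = (X - Y) - (X - Y') by mxlin.
by rewrite {1}E fsDl fsNl XY// XY'// subr0.
Qed.

Lemma projCP_comm P X : CP P -> P *m (X - projCP P X) = (X - projCP P X) *m P.
Proof.
move=> [_ PP _]; rewrite /projCP mulr2n.
have APP A : A *m P *m P = A *m P by rewrite -mulmxA PP.
rewrite !(mulmxDl, mulmxDr, mulmxN, mulNmx) !mulmxA !APP PP.
by mxlin.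
Qed.

Lemma fs_projCP P X Z : CP P -> TCP P Z -> fs (projCP P X) Z = fs X Z.
Proof.
move=> hP hZ; have [_ PP _] := hP.
have := fs_TCP_comm PP hZ (projCP_comm X hP).
by rewrite fsDr fsNr !(fsC Z) => /eqP; rewrite subr_eq0 => /eqP.
Qed.

Lemma projCP_id P X : CP P -> TCP P X -> projCP P X = X.
Proof.
move=> [_ PP _] hX; rewrite /projCP (TCP_PXP PP hX) mul0rn subr0.
by case: hX.
Qed.

Lemma projCPD P X Y : projCP P (X + Y) = projCP P X + projCP P Y.
Proof. by rewrite /projCP (mulmxDl X) (mulmxDr P X) (mulmxDl (P *m X)); mxlin. Qed.

Lemma projCPZ P a X : projCP P (a *:r X) = a *:r projCP P X.
Proof. by rewrite /projCP !rscalemxl !rscalemxr !rscalemxl !mulr2n; mxlin. Qed.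

Lemma tproj_TCP P X : CP P -> adjmx X = X -> tproj (TCP P) X = projCP P X.
Proof.
move=> hP Xa; apply: tproj_unique.
- by move=> Z [].
- by move=> Z Z' hZ hZ'; apply: TCPD => //; exact: TCPN.
- exact: TCP_projCP.
- by move=> Z hZ; rewrite fsDl fsNl fs_projCP// subrr.
Qed.

(* The tangent space at [P] of a real hypersurface with unit normal [N]. *)
Definition Thyp P N : set 'M[R[i]]_m.+1 := [set X | TCP P X /\ fs X N = 0].

(** An explicit formula for the orthogonal projection of Hermitian matrices onto [Thyp P N]; unlike
    the choice [tproj] it can be differentiated in [P] and [N]. *)
Definition projhyp P N X := projCP P X - fs X N *:r N.

Lemma ThypD P N X Y : Thyp P N X -> Thyp P N Y -> Thyp P N (X + Y).
Proof. by move=> [hX XN] [hY YN]; split; [exact: TCPD|rewrite fsDl XN YN addr0]. Qed.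

Lemma ThypN P N X : Thyp P N X -> Thyp P N (- X).
Proof. by move=> [hX XN]; split; [exact: TCPN|rewrite fsNl XN oppr0]. Qed.

Lemma ThypZ P N a X : Thyp P N X -> Thyp P N (a *:r X).
Proof. by move=> [hX XN]; split; [exact: TCPZ|rewrite fsZl XN mulr0]. Qed.

Section Hypersurface.
Variables (P N : 'M[R[i]]_m.+1).
Hypotheses (hP : CP P) (hN : TCP P N) (NN : fs N N = 1).

Lemma Thyp_projhyp X : adjmx X = X -> Thyp P N (projhyp P N X).
Proof.
move=> Xa; split.
  by apply: TCPD; [exact: TCP_projCP|apply/TCPN/TCPZ].
by rewrite /projhyp fsDl fsNl fs_projCP// fsZl NN mulr1 subrr.
Qed.

Lemma fs_projhyp X Z : Thyp P N Z -> fs (projhyp P N X) Z = fs X Z.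
Proof.
by move=> [hZ ZN]; rewrite /projhyp fsDl fsNl fsZl fs_projCP// (fsC N) ZN mulr0 subr0.
Qed.

Lemma tproj_Thyp X : adjmx X = X -> tproj (Thyp P N) X = projhyp P N X.
Proof.
move=> Xa; apply: tproj_unique.
- by move=> Z [[]].
- by move=> Z Z' hZ hZ'; apply: ThypD => //; exact: ThypN.
- exact: Thyp_projhyp.
- by move=> Z hZ; rewrite fsDl fsNl fs_projhyp// subrr.
Qed.

Lemma projhyp_id X : Thyp P N X -> projhyp P N X = X.
Proof. by move=> [hX XN]; rewrite /projhyp projCP_id// XN rscale0r subr0. Qed.

(** Meant for Lie brackets: [Z] is the second derivative of the parametrization common to both
    covariant derivatives. *)
Lemma projhypB_tangent X Y Z : Thyp P N X -> Thyp P N Y ->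
  projhyp P N (X + Z) - projhyp P N (Y + Z) = X - Y.
Proof.
move=> [hX XN] [hY YN]; rewrite /projhyp !projCPD (projCP_id hP hX) (projCP_id hP hY).
rewrite 2!fsDl XN YN !add0r.
by mxlin.
Qed.

Lemma Thyp_eq X Y : Thyp P N X -> Thyp P N Y ->
  (forall Z, Thyp P N Z -> fs X Z = fs Y Z) -> X = Y.
Proof.
move=> hX hY XY; have hXY : Thyp P N (X - Y) by apply: ThypD => //; exact: ThypN.
apply/eqP; rewrite -subr_eq0; apply/eqP/fs_eq0; first by case: hXY => -[].
by rewrite fsDl fsNl !XY// subrr.
Qed.

Lemma Thyp_Reeb : Thyp P N (- cpJ P N).
Proof.
by split; [exact/TCPN/TCP_cpJ|rewrite fsNl fsC fs_cpJ_self oppr0].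
Qed.

Lemma Thyp_phi X : TCP P X -> Thyp P N (cpJ P X - fs X (- cpJ P N) *:r N).
Proof.
move=> hX; split; first by apply: TCPD; [exact: TCP_cpJ|exact/TCPN/TCPZ].
by rewrite fsDl fsNl fsZl NN fs_cpJl fsNr mulr1 subrr.
Qed.

End Hypersurface.

(** More than 2m tangent vectors are linearly dependent over the reals. A tangent vector [X] is
    determined by [X *m z], which is orthogonal to [z]; as [z j 0] is nonzero, the other [m] complex
    entries determine the remaining one. *)
Lemma TCP_dim P q (B : 'I_q -> 'M[R[i]]_m.+1) : (m + m < q)%N -> CP P ->
  (forall i, TCP P (B i)) ->
  exists2 c : 'rV[R]_q, c != 0 & \sum_i c 0 i *:r B i = 0.
Proof.
move=> mq /CP_lift[z zz ->] hB.
have z0 : z != 0 by apply: contra_eq_neq zz => ->; rewrite /ip mulmx0 mxE eq_sym oner_neq0.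
have [j zj] : exists j, z j 0 != 0.
  apply/existsP; apply: contraNT z0; rewrite negb_exists => /forallP h.
  apply/eqP/matrixP => a b; rewrite ord1 mxE.
  by have /eqP := negbNE (h a).
pose M : 'M[R]_(q, m + m) :=
  row_mx (\matrix_(i, k) complex.Re ((B i *m z) (lift j k) 0))
         (\matrix_(i, k) complex.Im ((B i *m z) (lift j k) 0)).
have /rowV0Pn[c cM c0] : kermx M != 0.
  rewrite kermx_eq0 -row_leq_rank -ltnNge.
  exact: leq_ltn_trans (rank_leq_col _) mq.
have {}cM : c *m M = 0 by apply/sub_kermxP.
exists c => //; set X0 := \sum_i _.
have hX0 : TCP (z *m adjmx z) X0.
  rewrite /X0; elim/big_ind: _ => [|? ?|i _]; [exact: TCP0|exact: TCPD|exact: TCPZ].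
have [v zv Xv] := TCP_lift zz hX0.
have X0z : X0 *m z = v.
  rewrite Xv /hopf_lift_push mulmxDl -!mulmxA !ip_scalar zz ipC zv conjc0.
  by rewrite mulmx1 raddf0 mulmx0 addr0.
have vk k : v (lift j k) 0 = 0.
  have E : v (lift j k) 0 = \sum_i (c 0 i)%:C * (B i *m z) (lift j k) 0.
    rewrite -X0z /X0 mulmx_suml summxE; apply: eq_bigr => i _.
    by rewrite /rscale -scalemxAl mxE.
  have eRe : complex.Re (v (lift j k) 0) = 0.
    have /matrixP/(_ 0 (lshift m k)) := cM; rewrite [RHS]mxE => <-.
    rewrite E raddf_sum mxE; apply: eq_bigr => i _ /=.
    by rewrite Re_realM row_mxEl [in RHS]mxE.
  have eIm : complex.Im (v (lift j k) 0) = 0.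
    have /matrixP/(_ 0 (rshift m k)) := cM; rewrite [RHS]mxE => <-.
    rewrite E raddf_sum mxE; apply: eq_bigr => i _ /=.
    by rewrite Im_realM row_mxEr [in RHS]mxE.
  by rewrite (complexE (v _ _)) eRe eIm mulr0 addr0.
(* All other entries of [v] vanish, so orthogonality to [z] reduces to the conjugate of [z j 0]
   times [v j 0] being zero. *)
have vj : v j 0 = 0.
  have := zv; rewrite /ip mxE (bigD1 j)//= big1 ?addr0; last first.
    by move=> i ij; case: (unliftP j i) ij => [k ->|->]; rewrite ?vk ?mulr0 ?eqxx.
  rewrite !mxE => /eqP; rewrite mulf_eq0 conjc_eq0 (negbTE zj) /= => /eqP //.
have v0 : v = 0.
  apply/matrixP => i k; rewrite ord1 mxE.
  by case: (unliftP j i) => [l ->|->].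
by rewrite Xv v0 /hopf_lift_push /adjmx map_mx0 trmx0 mul0mx mulmx0 addr0.
Qed.

End Projections.

(** * Coordinates of tangent vectors *)

Section RealMatrixDifferentiability.
Context {R : realType} {n : nat}.
Implicit Types (u : 'rV[R]_n).

Lemma differentiable_bigsum (W : normedModType R) I (s : seq I) (P : pred I)
    (h : I -> 'rV[R]_n -> W) u :
  (forall i, differentiable (h i) u) ->
  differentiable (fun x => \sum_(i <- s | P i) h i x) u.
Proof.
move=> H; elim: s => [|i s IH].
  rewrite (_ : (fun _ => _) = fun=> 0); first exact: differentiable_cst.
  by apply/funext => x; rewrite big_nil.
rewrite (_ : (fun _ => _) = (fun x => (if P i then h i x else 0)
    + \sum_(j <- s | P j) h j x)); last first.
  by apply/funext => x; rewrite big_cons; case: ifP; rewrite ?add0r.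
apply: differentiableD => //; case: (P i) => //; exact: differentiable_cst.
Qed.

Lemma differentiable_bigprod I (s : seq I) (h : I -> 'rV[R]_n -> R) u :
  (forall i, differentiable (h i) u) ->
  differentiable (fun x => \prod_(i <- s) h i x) u.
Proof.
move=> H; elim: s => [|i s IH].
  rewrite (_ : (fun _ => _) = fun=> 1); first exact: differentiable_cst.
  by apply/funext => x; rewrite big_nil.
rewrite (_ : (fun _ => _) = (fun x => h i x * \prod_(j <- s) h j x)); last first.
  by apply/funext => x; rewrite big_cons.
exact: differentiableM.
Qed.

Lemma differentiable_det p (A : 'rV[R]_n -> 'M[R]_p) u :
  (forall i j, differentiable (fun x => A x i j) u) ->
  differentiable (fun x => \det (A x)) u.
Proof.
move=> H; apply: differentiable_bigsum => s.
apply: differentiableM; first exact: differentiable_cst.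
exact: differentiable_bigprod.
Qed.

(** By Cramer's rule the entries are cofactors divided by the determinant. *)
Lemma differentiable_invmx p (A : 'rV[R]_n -> 'M[R]_p) u :
  (\forall x \near u, A x \in unitmx) ->
  (forall i j, differentiable (fun x => A x i j) u) ->
  forall i j, differentiable (fun x => invmx (A x) i j) u.
Proof.
move=> uA dA i j.
have dd := differentiable_det dA.
apply: (@near_eq_differentiable _ _ _ (fun x => (\det (A x))^-1 * cofactor (A x) j i)).
  by move: uA; apply: filter_app; near=> x => Ax; rewrite /invmx Ax !mxE.
apply: differentiableM.
  apply: differentiableV => //.
  by have := nbhs_singleton uA; rewrite unitmxE unitfE.
apply: differentiableM; first exact: differentiable_cst.
apply: differentiable_det => k l.
rewrite (_ : (fun _ => _) = (fun x => A x (lift j k) (lift i l))) //.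
by apply/funext => x; rewrite !mxE.
Unshelve. all: by end_near. Qed.

End RealMatrixDifferentiability.

(** * The coordinate frame of an immersion and its Gram matrix *)

Section Frame.
Context {R : realType} {m n : nat} {U : set 'rV[R]_n}.
Context (F : 'rV[R]_n -> 'M[R[i]]_m.+1).
Hypotheses (oU : open U) (sF : smooth_mx U F) (cF : forall u, U u -> CP (F u)).
Hypothesis iF : forall u, U u -> injective (dm F u).
Implicit Types (u v w : 'rV[R]_n).

Lemma mdF u : U u -> mdiff F u. Proof. exact: smooth_mx_mdiff. Qed.

(** The two tangency conditions are the derivatives of the identities saying that [F] is Hermitian
    and idempotent. *)
Lemma TCP_dmx u w : U u -> TCP (F u) (dm F u w).
Proof.
move=> Uu; split.
  rewrite -(mDE (mD_adjmx (mdF Uu))); apply: dmx_near.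
  by apply: (near_open oU Uu) => x Ux; case: (cF Ux).
rewrite -(mDE (mD_mul (mdF Uu) (mdF Uu))); apply: dmx_near.
by apply: (near_open oU Uu) => x Ux; case: (cF Ux).
Qed.

Lemma dmx_delta G u w : mdiff G u ->
  dm G u w = \sum_j w 0 j *:r dm G u (delta_mx 0 j) :> 'M[R[i]]_m.+1.
Proof.
move=> dG; rewrite {1}(row_sum_delta w).
have D0 : dm G u 0 = 0.
  have := dmx_lin dG 1 0 0; rewrite scaler0 addr0 rmorph1 scale1r.
  by move=> /esym/eqP; rewrite -subr_eq0 addrK => /eqP.
elim/big_ind2 : _ => //.
- move=> A a B b <- <-; have := dmx_lin dG 1 a b.
  by rewrite scale1r rmorph1 scale1r.
- move=> j _; have := dmx_lin dG (w 0 j) (delta_mx 0 j) 0.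
  by rewrite addr0 D0 addr0.
Qed.

Definition gram u : 'M[R]_n :=
  \matrix_(i, j) fs (dm F u (delta_mx 0 i)) (dm F u (delta_mx 0 j)).

Definition covec u (X : 'M[R[i]]_m.+1) : 'rV[R]_n := \row_j fs X (dm F u (delta_mx 0 j)).

(** Solving the normal equations of the frame gives a rational formula, so that the coordinates of a
    differentiable field are differentiable functions of the point. *)
Definition crd u X : 'rV[R]_n := covec u X *m invmx (gram u).

Lemma fs_sumr I (s : seq I) (X : 'M[R[i]]_m.+1) (Y : I -> 'M[R[i]]_m.+1) :
  fs X (\sum_(i <- s) Y i) = \sum_(i <- s) fs X (Y i).
Proof. by elim/big_ind2 : _ => [|a A b B <- <-|//]; rewrite ?fs0r ?fsDr. Qed.

Lemma covec_dmx u w : U u -> covec u (dm F u w) = w *m gram u.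
Proof.
move=> Uu; apply/rowP => j; rewrite !mxE fsC (dmx_delta w (mdF Uu)) fs_sumr.
by apply: eq_bigr => i _; rewrite fsZr !mxE fsC.
Qed.

(** A row vector killed by the Gram matrix has an image under [dm F u] that is orthogonal to itself,
    hence zero, and [dm F u] is injective. *)
Lemma gram_unit u : U u -> gram u \in unitmx.
Proof.
move=> Uu; rewrite -row_free_unit; apply/inj_row_free => w wG.
apply: (iF Uu); rewrite (dmx_delta 0 (mdF Uu)) big1; last first.
  by move=> j _; rewrite mxE rscale0r.
apply: fs_eq0; first by case: (TCP_dmx w Uu).
rewrite {2}(dmx_delta w (mdF Uu)) fs_sumr big1// => j _.
have /rowP/(_ j) := covec_dmx w Uu; rewrite wG !mxE => e.
by rewrite fsZr e mulr0.
Qed.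

Lemma crd_dmx u w : U u -> crd u (dm F u w) = w.
Proof. by move=> Uu; rewrite /crd covec_dmx// mulmxK// gram_unit. Qed.

Lemma crdD u X Y : crd u (X + Y) = crd u X + crd u Y.
Proof.
rewrite /crd -mulmxDl; congr (_ *m _).
by apply/rowP => j; rewrite !mxE fsDl.
Qed.

Lemma crdZ u a X : crd u (a *:r X) = a *: crd u X.
Proof.
rewrite /crd scalemxAl; congr (_ *m _).
by apply/rowP => j; rewrite !mxE fsZl.
Qed.

Lemma crd_differentiable X u j : U u -> mdiff X u ->
  differentiable (fun x => crd x (X x) 0 j) u.
Proof.
move=> Uu dX.
have dF i : mdiff (fun x => dm F x (delta_mx 0 i)) u.
  exact: (smooth_mx_mdiff (smooth_mx_dmx oU _ sF)).
rewrite (_ : (fun _ => _) = (fun x => \sum_i fs (X x) (dm F x (delta_mx 0 i))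
    * invmx (gram x) i j)); last first.
  by apply/funext => x; rewrite mxE; apply: eq_bigr => i _; rewrite mxE.
apply: differentiable_bigsum => i; apply: differentiableM.
  by have [] := rD_fs dX (dF i).
apply: differentiable_invmx => [|k l].
  by apply: (near_open oU Uu) => x; exact: gram_unit.
rewrite (_ : (fun _ => _) = (fun x => fs (dm F x (delta_mx 0 k)) (dm F x (delta_mx 0 l)))).
  by have [] := rD_fs (dF k) (dF l).
by apply/funext => x; rewrite mxE.
Qed.

Definition dcrd (y : 'rV[R]_n -> 'rV[R]_n) u w : 'rV[R]_n := \row_j 'D_w (fun x => y x 0 j) u.

(** A product rule: the first term differentiates the argument [y], the second is the second
    derivative of [G] with the argument frozen at [y u]. *)
Lemma mD_dmx_along (G : 'rV[R]_n -> 'M[R[i]]_m.+1) (y : 'rV[R]_n -> 'rV[R]_n) u :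
  U u -> smooth_mx U G ->
  (forall j, differentiable (fun x => y x 0 j) u) ->
  mD (fun x => dm G x (y x)) u
     (fun w => dm G u (dcrd y u w) + dm (fun x => dm G x (y u)) u w).
Proof.
move=> Uu sG dy.
have dG x : U x -> mdiff G x by exact: smooth_mx_mdiff.
have dGj j : mdiff (fun x => dm G x (delta_mx 0 j)) u.
  exact: (smooth_mx_mdiff (smooth_mx_dmx oU _ sG)).
(* Expansion in the standard basis, for a general argument. It is used for [y] and again for the
   constant [y u], which identifies the second term. *)
have along (z : 'rV[R]_n -> 'rV[R]_n) : (forall j, differentiable (fun x => z x 0 j) u) ->
    mD (fun x => dm G x (z x)) u (fun w => \sum_j ('D_w (fun x => z x 0 j) u *:r
      dm G u (delta_mx 0 j) + z u 0 j *:r dm (fun x => dm G x (delta_mx 0 j)) u w)).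
  move=> dz.
  apply: (mD_ext (mD_sum (index_enum 'I_n) (fun j => mD_rscale (_ : rD _ u _) (dGj j)))).
  - by move=> j; split; [exact: dz|].
  - by apply: (near_open oU Uu) => x Ux; rewrite [RHS](dmx_delta _ (dG _ Ux)).
  - by [].
apply: (mD_ext (along y dy)); first by near=> x.
move=> w; rewrite big_split /=; congr (_ + _).
  rewrite [RHS](dmx_delta _ (dG _ Uu)); apply: eq_bigr => j _.
  by rewrite mxE.
have yc j : differentiable (fun _ : 'rV[R]_n => y u 0 j) u by exact: differentiable_cst.
rewrite (mDE (along (fun=> y u) yc)); apply: eq_bigr => j _.
by rewrite (derive_cst (y u 0 j)) rscale0r add0r.
Unshelve. all: by end_near. Qed.

End Frame.

(** * Derivatives of the normal, of the Reeb field and of the projections *)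

Section NormalDerivatives.
Context {R : realType} {m : nat}.
Variables (P N : 'M[R[i]]_m.+1).
Hypotheses (hP : CP P) (hN : TCP P N).
Implicit Types (X Y Z V : 'M[R[i]]_m.+1).

Lemma TCP_mulC X Y : TCP P X -> TCP P Y -> P *m (X *m Y) = X *m Y *m P.
Proof.
move=> hX hY; rewrite mulmxA (TCP_PX hX) mulmxBl -(mulmxA X P Y) (TCP_PX hY).
by rewrite mulmxBr mulmxA; mxlin.
Qed.

(** The second fundamental form of CP^m in the Hermitian matrices, evaluated at [X] and [N]. *)
Definition normal_part X := X *m N + N *m X - (P *m (X *m N + N *m X)) *+ 2.

(** The hypothesis is the derivative in direction [X] of the tangency equation [N P + P N = N], with
    [V] the derivative of [N]. Multiplying it by [P] on both sides determines [P V P]. *)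
Lemma projCP_normal X V : TCP P X -> V *m P + N *m X + (X *m N + P *m V) = V ->
  V = projCP P V + normal_part X.
Proof.
move=> hX VE; have [_ PP _] := hP; rewrite /normal_part.
set S := X *m N + N *m X.
have PS : P *m S = S *m P by rewrite /S mulmxDr mulmxDl !TCP_mulC.
have {}VE : V = V *m P + P *m V + S by rewrite -{1}VE /S; mxlin.
clearbody S.
have PSP : P *m S *m P = P *m S by rewrite PS -mulmxA PP.
have : P *m V *m P = P *m V *m P + P *m V *m P + P *m S.
  have := congr1 (fun A => P *m A *m P) VE; rewrite /= => {1}->.
  rewrite 2!mulmxDr 2!mulmxDl PSP (mulmxA P V P) (mulmxA P P V) PP.
  by rewrite -(mulmxA (P *m V) P P) PP.
move=> h; have {}h : P *m V *m P = - (P *m S).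
  by move: h; rewrite -{1}[P *m V *m P]addr0 -addrA => /addrI/eqP; rewrite eq_sym addr_eq0 => /eqP.
by rewrite {1}VE /projCP h; mxlin.
Qed.

Lemma normal_part_comm X : TCP P X -> P *m normal_part X = normal_part X *m P.
Proof.
move=> hX; have [_ PP _] := hP; rewrite /normal_part.
set S := X *m N + N *m X.
have PS : P *m S = S *m P by rewrite /S mulmxDr mulmxDl !TCP_mulC.
clearbody S; rewrite mulr2n mulmxBr mulmxBl mulmxDr mulmxDl (mulmxA P P S) PP.
by rewrite -(mulmxA P S P) -PS (mulmxA P P S) PP.
Qed.

(** The left side is the product rule for the Reeb field [- 'i (N P - P N)]. The normal part of [V]
    commutes with [P], so [cpJ P] annihilates it and only the shape operator survives in the first
    term. *)
Lemma Reeb_derivative X V : TCP P X -> V *m P + N *m X + (X *m N + P *m V) = V ->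
  - ('i%C *: (V *m P + N *m X - (X *m N + P *m V))) =
  cpJ P (- projCP P V) + 'i%C *: (X *m N - N *m X).
Proof.
move=> hX VE; have E := projCP_normal hX VE.
have J0 : cpJ P (normal_part X) = 0.
  by rewrite /cpJ normal_part_comm// subrr scaler0.
have -> : projCP P V = V - normal_part X by rewrite [X in X - _]E addrK.
rewrite opprB cpJD J0 add0r cpJN /cpJ.
rewrite -!scalerN -scalerDr; congr (_ *: _); mxlin.
Qed.

(* The variation, in the direction [X], of the projections onto the tangent
   spaces of CP^m, applied to [V]. *)
Definition dprojCP X V :=
  V *m X + X *m V - (X *m V *m P) *+ 2 - (P *m V *m X) *+ 2.

Lemma dprojCPD X V W : dprojCP X (V + W) = dprojCP X V + dprojCP X W.
Proof.
rewrite /dprojCP (mulmxDl V W X) (mulmxDr X V W) (mulmxDr P V W).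
by rewrite (mulmxDl _ _ P) (mulmxDl _ _ X); mxlin.
Qed.

(** The variation of the projections sends tangent vectors to matrices commuting with [P], which are
    normal. *)
Lemma fs_dprojCP_tangent X V Z : TCP P X -> TCP P V -> TCP P Z -> fs (dprojCP X V) Z = 0.
Proof.
move=> hX hV hZ; have [_ PP _] := hP; rewrite fsC; apply: (fs_TCP_comm PP hZ).
have e1 := TCP_mulC hV hX; have e2 := TCP_mulC hX hV.
rewrite /dprojCP -(mulmxA P V X) e1 -e2.
move: (V *m X) (X *m V) e1 e2 => A B e1 e2.
rewrite mulr2n mulr2n !mulmxBr !mulmxBl 3!mulmxDr 3!mulmxDl.
have -> : A *m P *m P = A *m P by rewrite -mulmxA PP.
have -> : P *m B *m P = P *m B by rewrite e2 -mulmxA PP.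
have -> : P *m (A *m P) = A *m P by rewrite mulmxA e1 -mulmxA PP.
by rewrite (mulmxA P P B) PP e1 e2.
Qed.

(** The argument is the normal component of the derivative of the Reeb vector [E] along [Y].
    Rewriting the result through [E] alone prepares the double bracket of [curvature_CP]. *)
Lemma dprojCP_normal X Y : TCP P Y ->
  let E := - cpJ P N in let S := Y *m E + E *m Y in
  dprojCP X ('i%C *: (Y *m N - N *m Y)) = S *m X + X *m S.
Proof.
move=> hY E S; have [_ PP _] := hP.
set V := 'i%C *: _.
have PV : P *m V = V *m P.
  by rewrite /V -scalemxAr -scalemxAl mulmxBr mulmxBl !TCP_mulC.
have SE : S = V - (P *m V) *+ 2.
  rewrite /S /E cpJE// -scalerN -scalemxAr -scalemxAl -scalerDr.
  rewrite /V -scalemxAr [in RHS]mulr2n -scalerDr -scalerBr; congr (_ *: _).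
  have YPN : Y *m (P *m N) = Y *m N - P *m (Y *m N).
    by rewrite mulmxA (TCP_XPr hY) mulmxBl mulmxA.
  rewrite opprB mulr2n mulmxBr mulmxBl mulmxDr mulmxDl YPN (mulmxBr P).
  by rewrite !(mulmxA P N Y); mxlin.
have XPV : X *m (P *m V) = X *m V *m P by rewrite PV mulmxA.
clearbody V; rewrite /dprojCP SE (mulmxBl V) (mulmxBr X) !mulr2n.
by rewrite (mulmxDl (P *m V) (P *m V) X) (mulmxDr X (P *m V)) XPV; mxlin.
Qed.

End NormalDerivatives.

(** * Hypersurfaces in a chart *)

Opaque fs mulmx projCP.

Section ChartHypersurface.
Context {R : realType} {m n : nat} {U : set 'rV[R]_n}.
Context (F N : 'rV[R]_n -> 'M[R[i]]_m.+1).
Hypotheses (oU : open U) (sF : smooth_mx U F) (cF : forall u, U u -> CP (F u)).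
Hypothesis iF : forall u, U u -> injective (dm F u).
Hypotheses (sN : smooth_mx U N) (hN : forall u, U u -> TCP (F u) (N u)).
Hypothesis NN : forall u, U u -> fs (N u) (N u) = 1.
Hypothesis NT : forall u w, U u -> fs (N u) (dm F u w) = 0.
Implicit Types (u v w : 'rV[R]_n) (X Y Z W : 'M[R[i]]_m.+1).

Local Notation T u := (Thyp (F u) (N u)).

Let mdN u : U u -> mdiff N u. Proof. exact: smooth_mx_mdiff. Qed.
Let mdF u : U u -> mdiff F u. Proof. exact: smooth_mx_mdiff. Qed.

Lemma T_dmx u w : U u -> T u (dm F u w).
Proof. by move=> Uu; split; [exact: (TCP_dmx oU sF cF)|rewrite fsC NT]. Qed.

(** A dimension count: the normal, [X] and the frame are n + 2 = 2m + 1 vectors tangent to CP^m,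
    hence dependent. *)
Lemma range_dmx u : n.+1 = (m + m)%N -> U u -> range (dm F u) = T u.
Proof.
move=> dim Uu; apply/seteqP; split => [_ [w _ <-]|X [hX XN]]; first exact: T_dmx.
pose B (i : 'I_n.+2) := if unlift ord0 i is Some j then
  if unlift ord0 j is Some k then dm F u (delta_mx 0 k) else X else N u.
have hB i : TCP (F u) (B i).
  rewrite /B; case: (unlift ord0 i) => [j|]; last exact: hN.
  by case: (unlift ord0 j) => [k|//]; exact: (TCP_dmx oU sF cF).
have [|c c0] := TCP_dim _ (cF Uu) hB; first by rewrite -dim.
rewrite big_ord_recl big_ord_recl /B unlift_none liftK unlift_none.
pose w := \row_k c 0 (lift ord0 (lift ord0 k)).
rewrite (_ : \sum_(i < n) _ = dm F u w); last first.
  rewrite (dmx_delta w (mdF Uu)); apply: eq_bigr => k _.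
  by rewrite !liftK mxE.
move=> E.
(* Pairing with the normal removes its coefficient; injectivity of [dm F u] then forces a nonzero
   coefficient of [X], for which the relation is solved. *)
have cN : c 0 ord0 = 0.
  have := congr1 (fs (N u)) E; rewrite fs0r !fsDr !fsZr NN// NT// (fsC _ X) XN.
  by rewrite mulr1 mulr0 !addr0.
have cX : c 0 (lift ord0 ord0) != 0.
  apply: contra_neq c0 => cX; move: E; rewrite cN cX !rscale0r !add0r => w0.
  have {}w0 : w = 0.
    apply: (iF Uu); rewrite w0 (dmx_delta 0 (mdF Uu)) big1// => j _.
    by rewrite mxE rscale0r.
  apply/rowP => i; rewrite mxE; case: (unliftP ord0 i) => [j|] ->//.
  case: (unliftP ord0 j) => [k|] ->//.
  by have /rowP/(_ k) := w0; rewrite !mxE.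
move: E; rewrite cN rscale0r add0r; set a := c 0 _ in cX *.
move=> /eqP; rewrite addrC addr_eq0 => /eqP E.
exists (- a^-1 *: w) => //.
have := dmx_lin (mdF Uu) (- a^-1) w 0; rewrite addr0.
have -> : dm F u 0 = 0.
  by rewrite (dmx_delta 0 (mdF Uu)) big1// => j _; rewrite mxE rscale0r.
rewrite addr0 E => ->; rewrite -/(rscale _ _) rscaleNl rscaleNr opprK rscalerA.
by rewrite mulVf// rscale1r.
Qed.

Lemma dN_eq u w : U u ->
  dm N u w *m F u + N u *m dm F u w + (dm F u w *m N u + F u *m dm N u w) = dm N u w.
Proof.
move=> Uu; rewrite -(mDE (mD_add (mD_mul (mdN Uu) (mdF Uu)) (mD_mul (mdF Uu) (mdN Uu)))).
by apply: dmx_near; apply: (near_open oU Uu) => x Ux; case: (hN Ux).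
Qed.

Lemma dN_herm u w : U u -> adjmx (dm N u w) = dm N u w.
Proof.
move=> Uu; rewrite -(mDE (mD_adjmx (mdN Uu))); apply: dmx_near.
by apply: (near_open oU Uu) => x Ux; case: (hN Ux).
Qed.

Lemma fs_near0 (G K : 'rV[R]_n -> 'M[R[i]]_m.+1) (c : R) u w : U u ->
  mdiff G u -> mdiff K u -> (forall x, U x -> fs (G x) (K x) = c) ->
  fs (dm G u w) (K u) + fs (G u) (dm K u w) = 0.
Proof.
move=> Uu dG dK E; have [_ <-] := rD_fs dG dK.
rewrite -(derive_cst c u w); apply: near_eq_derive.
exact: (near_open oU Uu).
Qed.

(* The shape operator, as a function of the coordinates of a tangent vector. *)
Fact shp_key : unit. Proof. by []. Qed.
Definition shp := locked_with shp_key (fun u w => - projCP (F u) (dm N u w)).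

Lemma shpE u w : shp u w = - projCP (F u) (dm N u w).
Proof. by rewrite /shp locked_withE. Qed.

Lemma T_shp u w : U u -> T u (shp u w).
Proof.
move=> Uu; rewrite shpE; apply: ThypN; split.
  by apply: TCP_projCP; [exact: cF|exact: dN_herm].
rewrite fs_projCP//; [|exact: cF|exact: hN].
by have := fs_near0 w Uu (mdN Uu) (mdN Uu) NN; rewrite (fsC (N u)); lra.
Qed.

Lemma fs_shp u w Z : U u -> TCP (F u) Z -> fs (shp u w) Z = - fs (dm N u w) Z.
Proof. by move=> Uu hZ; rewrite shpE fsNl (fs_projCP _ (cF Uu) hZ). Qed.

(** Differentiating the orthogonality of [N] to the frame expresses the form through the second
    derivative of [F], which is symmetric. *)
Lemma shp_sym u v w : U u -> fs (shp u v) (dm F u w) = fs (shp u w) (dm F u v).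
Proof.
move=> Uu; have TF z := TCP_dmx oU sF cF z Uu.
rewrite (fs_shp v Uu (TF w)) (fs_shp w Uu (TF v)); congr (- _).
have sym z t : fs (dm N u z) (dm F u t) = - fs (N u) (dm (fun x => dm F x t) u z).
  have dFt : mdiff (fun x => dm F x t) u by exact: (smooth_mx_mdiff (smooth_mx_dmx oU _ sF)).
  by have := fs_near0 z Uu (mdN Uu) dFt (fun x Ux => NT t Ux); lra.
by rewrite (sym v w) (sym w v) (dmx_symm oU v w sF Uu).
Qed.

Definition Reeb x := - cpJ (F x) (N x).

Lemma smooth_Reeb : smooth_mx U Reeb.
Proof.
apply: (smooth_mx_opp oU).
have H := smooth_mx_add oU (smooth_mx_mul oU sN sF) (smooth_mx_opp oU (smooth_mx_mul oU sF sN)).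
exact: (smooth_mx_scale oU (csmooth_cst oU 'i%C) H).
Qed.

Lemma T_Reeb u : U u -> T u (Reeb u).
Proof. by move=> Uu; apply: Thyp_Reeb; [exact: cF|exact: hN]. Qed.

Lemma fs_ReebReeb u : U u -> fs (Reeb u) (Reeb u) = 1.
Proof.
by move=> Uu; rewrite fsNl fsNr opprK fs_cpJJ ?NN//; [exact: cF|exact: hN|exact: hN].
Qed.

Lemma dReeb u w : U u -> dm Reeb u w =
  cpJ (F u) (shp u w) + 'i%C *: (dm F u w *m N u - N u *m dm F u w).
Proof.
move=> Uu.
rewrite (mDE (mD_opp (mD_scalec 'i%C (mD_add (mD_mul (mdN Uu) (mdF Uu))
   (mD_opp (mD_mul (mdF Uu) (mdN Uu))))))).
rewrite shpE; apply: Reeb_derivative; [exact: cF|exact: hN|exact: (TCP_dmx oU sF cF)|exact: dN_eq].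
Qed.

Lemma fs_dReeb_N u w : U u -> fs (dm Reeb u w) (N u) = fs (shp u w) (Reeb u).
Proof.
move=> Uu; have dR : mdiff Reeb u := smooth_mx_mdiff smooth_Reeb Uu.
have := fs_near0 w Uu dR (mdN Uu) (fun x Ux => (T_Reeb Ux).2).
rewrite fs_shp//; last by case: (T_Reeb Uu).
by rewrite (fsC (Reeb u)); lra.
Qed.

Lemma mD_proj (G : 'rV[R]_n -> 'M[R[i]]_m.+1) L u : U u -> mD G u L ->
  exists2 K, mD (fun x => projhyp (F x) (N x) (G x)) u K &
  forall w Z, T u Z -> fs (K w) Z = fs (L w) Z + fs (dprojCP (F u) (dm F u w) (G u)) Z
     - fs (G u) (N u) * fs (dm N u w) Z.
Proof.
move=> Uu dG; have dF := mdF Uu; have dN := mdN Uu.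
have dGF := mD_mul dG dF; have dFG := mD_mul dF dG; have dFGF := mD_mul dFG dF.
have dP := mD_add (mD_add dGF dFG) (mD_opp (mD_add dFGF dFGF)).
have dfs := rD_fs dG dN.
eexists; first exact: (mD_add dP (mD_opp (mD_rscale dfs dN))).
move=> w Z [hZ ZN]; rewrite fsDl fsNl [fs (_ *:r _ + _) Z]fsDl 2!fsZl (fsC (N u)) ZN mulr0 add0r.
congr (_ - _); rewrite -(fs_projCP (L w) (cF Uu) hZ) -fsDl; congr (fs _ _).
Transparent projCP.
rewrite /projCP /dprojCP !mulr2n.
rewrite (mulmxDl (dm F u w *m G u) (F u *m L w) (F u)).
by mxlin.
Qed.

End ChartHypersurface.

Transparent fs mulmx projCP.

(** The arithmetic of [codazzi_hopf]: subtracting the two differentiated equations cancels the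
    second derivatives [n1], [n2] of the normal and [q1], [q2] of the immersion. *)
Lemma codazzi_identity (R : realFieldType) (a n1 n2 d1 d2 r1 r2 q1 q2 A A1 A2 W W2 W3 B B1 B2 : R) :
    n1 + d1 + a * (r1 + q1) = 0 -> n2 + d2 + a * (r2 + q2) = 0 -> n2 = n1 -> q2 = q1 ->
    d1 = - A1 + W -> d2 = - A2 + W2 -> r1 = B -> r2 = B1 ->
    A1 = A -> A = - A2 -> W2 = - W3 -> W3 = W -> B1 = - B2 ->
    a * (B + B2) - 2 * A + 2 * W = 0.
Proof. by move=> h1 h2 *; subst; lra. Qed.

(** * Gauss and Codazzi equations in a chart *)

Section ChartCurvature.
Context {R : realType} {m n : nat} {U : set 'rV[R]_n}.
Context (F N : 'rV[R]_n -> 'M[R[i]]_m.+1).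
Hypotheses (oU : open U) (sF : smooth_mx U F) (cF : forall u, U u -> CP (F u)).
Hypothesis iF : forall u, U u -> injective (dm F u).
Hypotheses (sN : smooth_mx U N) (hN : forall u, U u -> TCP (F u) (N u)).
Hypothesis NN : forall u, U u -> fs (N u) (N u) = 1.
Hypothesis NT : forall u w, U u -> fs (N u) (dm F u w) = 0.
Hypothesis dim : n.+1 = (m + m)%N.
Implicit Types (u v w : 'rV[R]_n).

Local Notation T u := (Thyp (F u) (N u)).
Local Notation Reeb := (Reeb F N).
Local Notation shp := (shp F N).

Lemma dm_crd u (X : 'M[R[i]]_m.+1) : U u -> T u X -> dm F u (crd F u X) = X.
Proof.
move=> Uu; rewrite -(range_dmx oU sF cF iF hN NN NT dim Uu) => -[w _ <-].
by rewrite (crd_dmx oU sF cF iF _ Uu).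
Qed.

Definition tfield (X : 'rV[R]_n -> 'M[R[i]]_m.+1) :=
  forall u, U u -> mdiff X u /\ T u (X u).

Definition cnab (X Y : 'rV[R]_n -> 'M[R[i]]_m.+1) u :=
  projhyp (F u) (N u) (dm Y u (crd F u (X u))).
Definition clie X Y u := cnab X Y u - cnab Y X u.
Definition ccurv X Y Z u :=
  cnab X (cnab Y Z) u - cnab Y (cnab X Z) u - cnab (clie X Y) Z u.

Lemma along_tfield (Y Z : 'rV[R]_n -> 'M[R[i]]_m.+1) u : smooth_mx U Z -> tfield Y -> U u ->
  mD (fun x => dm Z x (crd F x (Y x))) u
     (fun w => dm Z u (dcrd (fun x => crd F x (Y x)) u w)
               + dm (fun x => dm Z x (crd F u (Y u))) u w).
Proof.
move=> sZ tY Uu; apply: (mD_dmx_along oU) => // j.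
by apply: (crd_differentiable oU sF cF iF _ Uu); have [] := tY u Uu.
Qed.

Lemma mdiff_cnab (Y Z : 'rV[R]_n -> 'M[R[i]]_m.+1) u : smooth_mx U Z -> tfield Y -> U u ->
  mdiff (cnab Y Z) u.
Proof.
move=> sZ tY Uu.
by have [K /mD_mdiff] := mD_proj sF cF sN Uu (along_tfield sZ tY Uu).
Qed.

Lemma fs_cnab_cnab (X Y Z : 'rV[R]_n -> 'M[R[i]]_m.+1) u W :
  smooth_mx U Z -> tfield X -> tfield Y -> U u -> T u W ->
  let x := crd F u (X u) in let y := crd F u (Y u) in
  fs (cnab X (cnab Y Z) u) W =
  fs (dm Z u (dcrd (fun t => crd F t (Y t)) u x)) W + fs (dm (fun t => dm Z t y) u x) W
  + fs (dprojCP (F u) (X u) (dm Z u y)) W - fs (dm Z u y) (N u) * fs (dm N u x) W.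
Proof.
move=> sZ tX tY Uu hW x y.
have [K dK KE] := mD_proj sF cF sN Uu (along_tfield sZ tY Uu).
apply: (etrans (fs_projhyp (cF Uu) _ hW)); rewrite (mDE dK) (KE _ _ hW) fsDl.
by rewrite (dm_crd Uu (tX u Uu).2).
Qed.

Lemma dm_tfield (X Y : 'rV[R]_n -> 'M[R[i]]_m.+1) u w : tfield Y -> U u ->
  dm Y u w = dm F u (dcrd (fun t => crd F t (Y t)) u w)
             + dm (fun t => dm F t (crd F u (Y u))) u w.
Proof.
move=> tY Uu; rewrite -(mDE (along_tfield sF tY Uu)); apply: dmx_near.
by apply: (near_open oU Uu) => t Ut; rewrite (dm_crd Ut (tY t Ut).2).
Qed.

Lemma dmB (Z : 'rV[R]_n -> 'M[R[i]]_m.+1) u v w : mdiff Z u -> dm Z u (v - w) = dm Z u v - dm Z u w.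
Proof.
move=> dZ; have := dmx_lin dZ (-1) w v; rewrite scaleN1r addrC => ->.
by rewrite rmorphN rmorph1 scaleN1r addrC.
Qed.

(** Each field is [dm F] applied to its coordinates. The second derivatives of [F] agree by symmetry
    and cancel, leaving the coordinate bracket. *)
Lemma clieE (X Y : 'rV[R]_n -> 'M[R[i]]_m.+1) u : tfield X -> tfield Y -> U u ->
  clie X Y u = dm F u (dcrd (fun t => crd F t (Y t)) u (crd F u (X u))
                       - dcrd (fun t => crd F t (X t)) u (crd F u (Y u))).
Proof.
move=> tX tY Uu; rewrite /clie /cnab (dm_tfield X _ tY Uu) (dm_tfield Y _ tX Uu).
rewrite (dmB _ _ (smooth_mx_mdiff sF Uu)).
rewrite (dmx_symm oU (crd F u (X u)) (crd F u (Y u)) sF Uu).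
have TF z := T_dmx oU sF cF NT z Uu.
by apply: (projhypB_tangent (cF Uu)); exact: TF.
Qed.

(** The second derivatives of [Z] cancel by symmetry and the derivatives of the coordinates cancel
    against the bracket term, so only the variation of the projections remains. *)
Lemma fs_ccurv (X Y Z : 'rV[R]_n -> 'M[R[i]]_m.+1) u W :
  smooth_mx U Z -> tfield X -> tfield Y -> U u -> T u W ->
  let x := crd F u (X u) in let y := crd F u (Y u) in
  fs (ccurv X Y Z u) W =
  (fs (dprojCP (F u) (X u) (dm Z u y)) W - fs (dm Z u y) (N u) * fs (dm N u x) W)
  - (fs (dprojCP (F u) (Y u) (dm Z u x)) W - fs (dm Z u x) (N u) * fs (dm N u y) W).
Proof.
move=> sZ tX tY Uu hW x y.
have E1 := fs_cnab_cnab sZ tX tY Uu hW; have E2 := fs_cnab_cnab sZ tY tX Uu hW.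
have E3 : fs (cnab (clie X Y) Z u) W =
    fs (dm Z u (dcrd (fun t => crd F t (Y t)) u x)) W
    - fs (dm Z u (dcrd (fun t => crd F t (X t)) u y)) W.
  apply: (etrans (fs_projhyp (cF Uu) _ hW)).
  by rewrite (clieE tX tY Uu) (crd_dmx oU sF cF iF _ Uu)
    (dmB _ _ (smooth_mx_mdiff sZ Uu)) fsDl fsNl.
have symm := congr1 (fun A => fs A W) (dmx_symm oU y x sZ Uu).
have sub A B : fs (A - B) W = fs A W - fs B W by rewrite fsDl fsNl.
apply: (etrans (sub _ _)).
apply: (etrans (congr2 (fun a b => a - b) (etrans (sub _ _) (congr2 (fun a b => a - b) E1 E2)) E3)).
have ring_fact (p q s s' b1 c1 b2 c2 : R) : s = s' ->
    p + s + b1 - c1 - (q + s' + b2 - c2) - (p - q) = b1 - c1 - (b2 - c2).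
  by move=> ->; ring.
exact: ring_fact.
Qed.

Definition shpv u (X : 'M[R[i]]_m.+1) := shp u (crd F u X).

(** The Gauss equation: the variation of the projections onto CP^m yields the ambient curvature, and
    that of the normal yields the terms in the shape operator. *)
Lemma fs_ccurv_Reeb (X : 'rV[R]_n -> 'M[R[i]]_m.+1) u W : tfield X -> U u -> T u W ->
  fs (ccurv X Reeb Reeb u) W =
  fs (X u) W - fs (X u) (Reeb u) * fs W (Reeb u)
  + fs (shpv u (Reeb u)) (Reeb u) * fs (shpv u (X u)) W
  - fs (shpv u (X u)) (Reeb u) * fs (shpv u (Reeb u)) W.
Proof.
move=> tX Uu hW.
have sR : smooth_mx U Reeb by exact: smooth_Reeb.
have tR : tfield Reeb.
  by move=> t Ut; split; [exact: smooth_mx_mdiff sR Ut|exact: (T_Reeb cF hN Ut)].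
have hX := (tX u Uu).2; have hR := (tR u Uu).2.
have hP := cF Uu; have hNu := hN Uu.
have dprojE Y Z : T u Y -> T u Z -> fs (dprojCP (F u) Y (dm Reeb u (crd F u Z))) W =
    fs ((Z *m Reeb u + Reeb u *m Z) *m Y + Y *m (Z *m Reeb u + Reeb u *m Z)) W.
  move=> hY hZ; rewrite (dReeb oU sF cF sN hN _ Uu) (dm_crd Uu hZ) dprojCPD fsDl.
  have hJ := TCP_cpJ hP (T_shp oU cF sN hN NN (crd F u Z) Uu).1.
  apply: (etrans (congr2 +%R (fs_dprojCP_tangent hP hY.1 hJ hW.1) erefl)).
  rewrite add0r; exact: (congr1 (fun A => fs A W) (dprojCP_normal hP hNu _ hZ.1)).
have dNE Z : fs (dm N u Z) W = - fs (shp u Z) W.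
  by rewrite (fs_shp N cF _ Uu hW.1) opprK.
have dRE Z := fs_dReeb_N oU sF cF sN hN Z Uu.
apply: (etrans (fs_ccurv sR tX tR Uu hW)).
have congr_terms (a a' b b' c c' d d' e e' g g' : R) : a = a' -> b = b' -> c = c' ->
    d = d' -> e = e' -> g = g' -> a - b * c - (d - e * g) = a' - b' * c' - (d' - e' * g').
  by move=> -> -> -> -> -> ->.
apply: (etrans (congr_terms _ _ _ _ _ _ _ _ _ _ _ _ (dprojE _ _ hX hR)
  (dRE (crd F u (Reeb u))) (dNE (crd F u (X u))) (dprojE _ _ hR hX)
  (dRE (crd F u (X u))) (dNE (crd F u (Reeb u))))).
rewrite -/(shpv u (X u)) -/(shpv u (Reeb u)).
have := curvature_CP hP hNu (NN Uu) hX.1 hW.1 hX.2 hW.2.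
rewrite -/(Reeb u) /=.
set Ru := Reeb u; set Xu := X u => C.
(* The two matrices differ by the double bracket of [Xu] with [Ru], evaluated by [curvature_CP]. *)
have -> : fs ((Ru *m Ru + Ru *m Ru) *m Xu + Xu *m (Ru *m Ru + Ru *m Ru)) W =
  fs ((Xu *m Ru + Ru *m Xu) *m Ru + Ru *m (Xu *m Ru + Ru *m Xu)) W
  + (fs Xu W - fs Xu Ru * fs W Ru).
  rewrite -C -fsDl; congr (fs _ W).
  move: Ru Xu {C} => A B.
  by rewrite !mulmxDl !mulmxDr !mulNmx !mulmxN !mulmxA; mxlin.
have formula (s a p q r t : R) : s + a - p * - q - (s - r * - t) = a + p * q - r * t by ring.
exact: formula.
Qed.

Section Hopf.
Variable al : 'rV[R]_n -> R.
Hypothesis hopfE : forall u, U u -> shpv u (Reeb u) = al u *:r Reeb u.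

Let sR : smooth_mx U Reeb. Proof. exact: smooth_Reeb. Qed.
Let mdR u : U u -> mdiff Reeb u. Proof. exact: smooth_mx_mdiff. Qed.
Let tR : tfield Reeb.
Proof. by move=> t Ut; split; [exact: mdR|exact: (T_Reeb cF hN Ut)]. Qed.

Lemma fs_shp_Reeb u w : U u -> fs (shp u w) (Reeb u) = al u * fs (Reeb u) (dm F u w).
Proof.
move=> Uu; rewrite -fsZl -(hopfE Uu) /shpv (shp_sym oU sF cF sN NT _ _ Uu).
by rewrite (dm_crd Uu (tR Uu).2).
Qed.

(** The Hopf condition supplies [al] only as a function; pairing with the unit Reeb field writes it
    as an expression in differentiable data. *)
Lemma hopf_differentiable u : U u -> differentiable al u.
Proof.
move=> Uu; apply: (@near_eq_differentiable _ _ _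
    (fun x => - fs (dm N x (crd F x (Reeb x))) (Reeb x))).
  apply: (near_open oU Uu) => x Ux.
  rewrite -(fs_shp N cF _ Ux (tR Ux).2.1) -/(shpv x (Reeb x)) hopfE// fsZl.
  by rewrite (fs_ReebReeb cF hN NN Ux) mulr1.
by have [] := rD_opp (rD_fs (along_tfield sN tR Uu) (mdR Uu)).
Qed.

Lemma codazzi_hopf u v w : U u ->
  fs (dm F u v) (Reeb u) = 0 -> fs (dm F u w) (Reeb u) = 0 ->
  al u * (fs (cpJ (F u) (shp u v)) (dm F u w) + fs (cpJ (F u) (dm F u v)) (shp u w))
  - 2 * fs (cpJ (F u) (shp u v)) (shp u w) + 2 * fs (cpJ (F u) (dm F u v)) (dm F u w) = 0.
Proof.
move=> Uu vR wR; have hP := cF Uu; have hNu := hN Uu; have [_ PP _] := hP.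
have da : rD al u (fun w => 'D_w al u) by split; [exact: hopf_differentiable|].
have dFw z : mdiff (fun x => dm F x z) u by exact: (smooth_mx_mdiff (smooth_mx_dmx oU _ sF)).
have dNw z : mdiff (fun x => dm N x z) u by exact: (smooth_mx_mdiff (smooth_mx_dmx oU _ sN)).
(* The derivative in direction [t] of [fs_shp_Reeb]; the derivative of [al] is multiplied by a
   product that vanishes at [u]. *)
have E z t : fs (dm F u z) (Reeb u) = 0 ->
    fs (dm (fun x => dm N x z) u t) (Reeb u) + fs (dm N u z) (dm Reeb u t)
    + al u * (fs (dm Reeb u t) (dm F u z) + fs (Reeb u) (dm (fun x => dm F x z) u t)) = 0.
  move=> zR; have [_ /(_ t) D] := rD_add (rD_fs (dNw z) (mdR Uu))
    (rD_mul da (rD_fs (mdR Uu) (dFw z))).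
  have drop0 (a b c e g : R) : a + (b * c + e * g) = 0 -> c = 0 -> a + e * g = 0.
    by move=> h c0; rewrite -h c0 mulr0 add0r.
  apply: (drop0 _ _ _ _ _ (etrans (esym D) _) (etrans (fsC _ _) zR)).
  rewrite -(derive_cst (0 : R) u t); apply: near_eq_derive.
  apply: (near_open oU Uu) => x Ux.
  by rewrite -(fs_shp_Reeb _ Ux) (fs_shp N cF _ Ux (tR Ux).2.1) subrr.
(* Both factors split into parts tangent and normal to CP^m. The mixed products vanish, and
   [codazzi_CP] evaluates the product of the normal parts. *)
have dot z t : fs (dm F u z) (Reeb u) = 0 -> fs (dm F u t) (Reeb u) = 0 ->
    fs (dm N u t) (dm Reeb u z) =
    - fs (shp u t) (cpJ (F u) (shp u z)) + fs (cpJ (F u) (dm F u z)) (dm F u t).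
  move=> zR tR0.
  have [hz zN] := T_dmx oU sF cF NT z Uu; have [ht tN] := T_dmx oU sF cF NT t Uu.
  have [hAt _] := T_shp oU cF sN hN NN t Uu; have [hAz _] := T_shp oU cF sN hN NN z Uu.
  have JN y : fs y (Reeb u) = 0 -> fs y (cpJ (F u) (N u)) = 0.
    by rewrite fsNr => /eqP; rewrite oppr_eq0 => /eqP.
  have C := codazzi_CP hP hNu (NN Uu) hz ht zN tN (JN _ zR) (JN _ tR0).
  have comm0 : fs (shp u t) ('i%C *: (dm F u z *m N u - N u *m dm F u z)) = 0.
    apply: (fs_TCP_comm PP hAt).
    by rewrite -scalemxAr -scalemxAl mulmxBr mulmxBl (TCP_mulC hz hNu) (TCP_mulC hNu hz).
  have comm0' : fs (normal_part (F u) (N u) (dm F u t)) (cpJ (F u) (shp u z)) = 0.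
    by rewrite fsC; apply: (fs_TCP_comm PP (TCP_cpJ hP hAz)); exact: normal_part_comm.
  have dNt : dm N u t = - shp u t + normal_part (F u) (N u) (dm F u t).
    rewrite shpE opprK; apply: (projCP_normal hP hNu ht).
    exact: (dN_eq oU sF sN hN _ Uu).
  rewrite dNt (dReeb oU sF cF sN hN _ Uu) fsDl (fsDr _ _ (- shp u t)) !fsNl comm0 oppr0 addr0.
  by rewrite fsDr comm0' add0r -C.
have dRF z t : fs (dm Reeb u z) (dm F u t) = fs (cpJ (F u) (shp u z)) (dm F u t).
  rewrite (dReeb oU sF cF sN hN _ Uu) fsDl.
  have [hz _] := T_dmx oU sF cF NT z Uu; have [ht _] := T_dmx oU sF cF NT t Uu.
  rewrite [X in _ + X]fsC (fs_TCP_comm PP ht) ?addr0//.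
  by rewrite -scalemxAr -scalemxAl mulmxBr mulmxBl (TCP_mulC hz hNu) (TCP_mulC hNu hz).
have symN := congr1 (fun A => fs A (Reeb u)) (dmx_symm oU v w sN Uu).
have symF := congr1 (fs (Reeb u)) (dmx_symm oU v w sF Uu).
apply: (@codazzi_identity R _ _ _ _ _ _ _ _ _ _ _ _ _ _ _ _ _ _ (E w v wR) (E v w vR) symN symF
  (dot v w vR wR) (dot w v wR vR) (dRF v w) (dRF w v) (fsC _ _)
  (fs_cpJl _ _ _) (fs_cpJl _ _ _) (fsC _ _) (etrans (fs_cpJl _ _ _) (congr1 -%R (fsC _ _)))).
Qed.

End Hopf.

End ChartCurvature.

(** * The contradiction at a point *)

(* Linear identities stated apart from the geometric context, in which [lra]
   would have to compare every pair of real-valued terms by conversion. *)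
Lemma jacobi_Reeb_identity (R : realFieldType) (a b c d e k al : R) :
  a + al * b - k * (c + al * a) - (a - k * c + al * (d - k * e)) =
  a - k * c + al * (d - k * e) ->
  a + al * b - k * (c + al * a) = 2 * (a + al * d - k * (c + al * e)).
Proof. lra. Qed.

Lemma jacobi_horizontal_identity (R : realFieldType) (a b c d e al : R) :
  a + al * c - (- b + al * - d) = - b + al * - c - (a + al * e) ->
  2 * (a + b) + al * (c + d) + al * (e + c) = 0.
Proof. lra. Qed.

Section HopfPoint.
Context {R : realType} {m : nat}.
Variables (P N : 'M[R[i]]_m.+1) (A : 'M[R[i]]_m.+1 -> 'M[R[i]]_m.+1) (al k : R).
Hypotheses (hP : CP P) (hN : TCP P N) (NN : fs N N = 1).
Implicit Types X Y Z W : 'M[R[i]]_m.+1.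

Local Notation T := (Thyp P N).
Local Notation E := (- cpJ P N).

Definition phiv X := cpJ P X - fs X E *:r N.

(** The difference between the k-th connection and the Levi-Civita connection; it depends only on
    the values of the fields. *)
Definition torsion_part X Y := fs (phiv (A X)) Y *:r E - fs Y E *:r phiv (A X)
  - (k * fs X E) *:r phiv Y.

(* The tensor [L^(k)_X Y - L_X Y]. *)
Definition lie_defect X Y := torsion_part X Y - torsion_part Y X.

(* [g (R_xi X, W)] as given by the Gauss equation. *)
Definition jacobi_form X W := fs X W - fs X E * fs W E
  + fs (A E) E * fs (A X) W - fs (A X) E * fs (A E) W.

Lemma phivE X : fs X E = 0 -> phiv X = cpJ P X.
Proof. by rewrite /phiv => ->; rewrite rscale0r subr0. Qed.

Lemma phiv_Reeb : phiv E = 0.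
Proof.
rewrite /phiv fsNl fsNr opprK fs_cpJJ// NN rscale1r cpJN cpJJ// opprK subrr //.
Qed.

Lemma T_horizontal_cpJ X : T X -> fs X E = 0 -> T (cpJ P X) /\ fs (cpJ P X) E = 0.
Proof.
move=> [hX XN] XE; rewrite fsNr fs_cpJJ// XN oppr0; split=> //.
split; first exact: TCP_cpJ.
by rewrite fs_cpJl -fsNr XE.
Qed.

(** Being Hermitian orthogonal to [z] and to the lift of [N] is two complex equations in m + 1 > 2
    unknowns. Complex orthogonality to the lift gives orthogonality to both [N] and the Reeb
    vector. *)
Lemma horizontal_exists : (1 < m)%N -> exists2 X, T X /\ fs X E = 0 & X != 0.
Proof.
move=> m1; have [z zz PE] := CP_lift hP.
have [n zn NE] : exists2 n, ip z n = 0 & N = hopf_lift_push z n.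
  by apply: (TCP_lift zz); rewrite -PE.
pose M : 'M[R[i]]_(m.+1, 1 + 1) := row_mx (adjmx z)^T (adjmx n)^T.
have /rowV0Pn[x xM x0] : kermx M != 0.
  by rewrite kermx_eq0 -row_leq_rank -ltnNge (leq_ltn_trans (rank_leq_col _)).
have {}xM : x *m M = 0 by apply/sub_kermxP.
have xz : ip z x^T = 0.
  rewrite /ip -[adjmx z]trmxK -trmx_mul mxE.
  have /matrixP/(_ 0 (lshift 1 0)) := xM; rewrite mul_mx_row row_mxEl => ->.
  by rewrite mxE.
have xn : ip n x^T = 0.
  rewrite /ip -[adjmx n]trmxK -trmx_mul mxE.
  have /matrixP/(_ 0 (rshift 1 0)) := xM; rewrite mul_mx_row row_mxEr => ->.
  by rewrite mxE.
have hX : TCP P (hopf_lift_push z x^T).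
  by rewrite PE; apply/(TCP_hopf _); rewrite ?ip_scalar ?zz//;
    exists x^T; rewrite // ip_scalar xz raddf0.
have Xn : hermCP P N (hopf_lift_push z x^T) = 0.
  by rewrite PE NE (hermCP_push zz zn xz).
have nX : hermCP P (hopf_lift_push z x^T) N = 0.
  by rewrite (hermCP_conj hP hN hX) Xn conjc0.
exists (hopf_lift_push z x^T).
  split; first by split=> //; rewrite (hermCP_fs hP hX hN) nX.
  by rewrite fsNr (hermCP_fs hP hX (TCP_cpJ hP hN)) hermCP_Jr// nX mulr0 oppr0.
apply: contra_neq x0 => X0.
have xE : hopf_lift_push z x^T *m z = x^T.
  by rewrite /hopf_lift_push mulmxDl -!mulmxA !ip_scalar zz (ipC z) xz
    conjc0 raddf0 mulmx0 addr0 mulmx1.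
by rewrite -[x]trmxK -xE X0 mul0mx trmx0.
Qed.

Hypothesis AT : forall X, T X -> T (A X).
Hypothesis AD : forall X Y, A (X + Y) = A X + A Y.
Hypothesis AZ : forall a X, A (a *:r X) = a *:r A X.
Hypothesis Asym : forall X Y, T X -> T Y -> fs (A X) Y = fs (A Y) X.
Hypothesis AE : A E = al *:r E.
Hypothesis codazzi : forall X Y, T X -> T Y -> fs X E = 0 -> fs Y E = 0 ->
  al * (fs (cpJ P (A X)) Y + fs (cpJ P X) (A Y)) - 2 * fs (cpJ P (A X)) (A Y)
  + 2 * fs (cpJ P X) Y = 0.
Hypothesis jacobi : forall X Y, T X -> T Y -> exists RX RY, [/\ T RX, T RY,
  forall W, T W -> fs RX W = jacobi_form X W,
  forall W, T W -> fs RY W = jacobi_form Y W &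
  forall W, T W -> fs (lie_defect X RY) W - jacobi_form (lie_defect X Y) W =
                   fs (lie_defect Y RX) W - jacobi_form (lie_defect Y X) W].

Let hE : T E. Proof. exact: Thyp_Reeb. Qed.
Let EE : fs E E = 1. Proof. by rewrite fsNl fsNr opprK fs_cpJJ. Qed.

Lemma A_horizontal X : T X -> fs X E = 0 -> fs (A X) E = 0.
Proof. by move=> hX XE; rewrite Asym// AE fsZl fsC XE mulr0. Qed.

Lemma jacobi_form_horizontal X W : T X -> fs X E = 0 -> T W ->
  jacobi_form X W = fs (X + al *:r A X) W.
Proof.
move=> hX XE hW; rewrite /jacobi_form XE (A_horizontal hX XE) AE fsDl !fsZl EE.
ring.
Qed.

Lemma jacobi_form_Reeb W : T W -> jacobi_form E W = 0.
Proof. by move=> hW; rewrite /jacobi_form AE !fsZl EE (fsC W); ring. Qed.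

Lemma jacobi_formr_Reeb X : T X -> jacobi_form X E = 0.
Proof. by move=> hX; rewrite /jacobi_form AE !fsZl EE; ring. Qed.

Lemma jacobi_operator_horizontal X RX : T X -> fs X E = 0 -> T RX ->
  (forall W, T W -> fs RX W = jacobi_form X W) -> RX = X + al *:r A X.
Proof.
move=> hX XE hRX H; apply: (Thyp_eq hRX); first by apply: ThypD => //; exact/ThypZ/AT.
by move=> W hW; rewrite H// jacobi_form_horizontal.
Qed.

Lemma jacobi_operator_Reeb RE : T RE ->
  (forall W, T W -> fs RE W = jacobi_form E W) -> RE = 0.
Proof.
move=> hRE H; apply: (Thyp_eq hRE).
  by have := ThypD hE (ThypN hE); rewrite subrr.
by move=> W hW; rewrite H// fs0l jacobi_form_Reeb.
Qed.

Lemma lie_defect_Reeb Y : T Y -> fs Y E = 0 ->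
  lie_defect E Y = cpJ P (A Y) - k *:r cpJ P Y.
Proof.
move=> hY YE; have AYE := A_horizontal hY YE.
have [_ JAYE] := T_horizontal_cpJ (AT hY) AYE.
rewrite /lie_defect /torsion_part AE YE.
have -> : phiv (al *:r E) = 0.
  rewrite /phiv fsZl EE cpJZ; have := phiv_Reeb; rewrite /phiv EE rscale1r mulr1.
  by move=> /eqP; rewrite subr_eq0 => /eqP ->; rewrite subrr.
rewrite phiv_Reeb (phivE AYE) (phivE YE) JAYE EE fs0l !rscale0r rscaler0 rscale1r
  mulr1 ?mulr0 ?rscale0r.
mxlin.
Qed.

Lemma lie_defectN X Y : lie_defect Y X = - lie_defect X Y.
Proof. exact: (esym (opprB (torsion_part X Y) (torsion_part Y X))). Qed.

Lemma A0 : A 0 = 0.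
Proof. by have := AZ 0 0; rewrite !rscale0r. Qed.

Lemma phiv0 : phiv 0 = 0.
Proof. by rewrite /phiv fs0l rscale0r subr0 /cpJ mul0mx mulmx0 subrr scaler0. Qed.

Lemma lie_defect0 X : lie_defect X 0 = 0.
Proof.
have t1 : torsion_part X 0 = 0.
  by rewrite /torsion_part fs0r fs0l phiv0 rscaler0 2!rscale0r 2!subr0.
have t2 : torsion_part 0 X = 0.
  by rewrite /torsion_part A0 phiv0 2!fs0l mulr0 rscaler0 2!rscale0r 2!subr0.
by rewrite /lie_defect t1 t2 subr0.
Qed.

Lemma jacobi_formN X W : jacobi_form (- X) W = - jacobi_form X W.
Proof.
have AN : A (- X) = - A X by have := AZ (-1) X; rewrite !rscaleNl !rscale1r.
rewrite /jacobi_form AN 4!fsNl mulNr mulrN mulNr.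
by rewrite !opprD !opprK.
Qed.

Lemma hopf_point_contradiction : (1 < m)%N -> k != 0 -> False.
Proof.
move=> m1 k0; have [X0 [hX0 X0E] X0n0] := horizontal_exists m1.
pose D X := T X /\ fs X E = 0.
have DA X : D X -> D (A X) by move=> [hX XE]; split; [exact: AT|exact: A_horizontal].
(* The form is kept abstract behind an existential, so that only the equation [wE] can unfold it. *)
have [w wE] : exists w, forall X Y, fs (cpJ P X) Y = w X Y by exists (fun X Y => fs (cpJ P X) Y).
have wC X Y : w X Y = - w Y X by rewrite -!wE fs_cpJl fsC.
have wAr X Y Z : w X (Y + al *:r Z) = w X Y + al * w X Z by rewrite -!wE fsDr fsZr.
have wAl X Y Z : w (Y + al *:r Z) X = w Y X + al * w Z X.
  by rewrite wC wAr !(wC X) mulrN -opprD opprK.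
have [hJ0 JE0] := T_horizontal_cpJ hX0 X0E.
have DR Z : D Z -> D (Z + al *:r A Z).
  move=> DZ; have [hZ ZE] := DZ; have [hAZ AZE] := DA Z DZ.
  by split; [exact/ThypD/ThypZ|rewrite fsDl fsZl ZE AZE mulr0 addr0].
have AR X : A (X + al *:r A X) = A X + al *:r A (A X) by rewrite AD AZ.
have wARl X Y : w (A (X + al *:r A X)) Y = w (A X) Y + al * w (A (A X)) Y.
  exact: etrans (congr1 (w^~ Y) (AR X)) (wAl _ _ _).
(* The condition at the Reeb vector and [X], paired with [Y]. The Jacobi operator kills the Reeb
   vector, so the skewness of [lie_defect] leaves one term equal to twice the other. *)
have jac_xi X Y : D X -> D Y ->
    w (A X) Y + al * w (A (A X)) Y - k * (w X Y + al * w (A X) Y) =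
    2 * (w (A X) Y + al * w (A X) (A Y) - k * (w X Y + al * w X (A Y))).
  move=> DX DY; have [hX XE] := DX; have [hY YE] := DY.
  have [RE [RX [hRE hRX REE RXE H]]] := jacobi hE hX; have {}H := H Y hY.
  have e1 := jacobi_operator_Reeb hRE REE; subst RE.
  have e2 := jacobi_operator_horizontal hX XE hRX RXE; subst RX.
  have fsD V W : D V -> fs (lie_defect E V) W = w (A V) W - k * w V W.
    by move=> [hV VE]; rewrite (lie_defect_Reeb hV VE) fsDl fsNl fsZl !wE.
  have DZ : D (lie_defect E X).
    have [hJX JXE] := T_horizontal_cpJ hX XE.
    have [hJAX JAXE] := T_horizontal_cpJ (DA X DX).1 (DA X DX).2.
    rewrite (lie_defect_Reeb hX XE).
    by split; [exact/ThypD/ThypN/ThypZ|rewrite fsDl fsNl fsZl JXE JAXE mulr0 subr0].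
  have h1 := etrans (fsD _ Y (DR _ DX)) (congr2 (fun a b => a - k * b) (wARl X Y) (wAl Y X (A X))).
  have h2 : jacobi_form (lie_defect E X) Y =
      w (A X) Y - k * w X Y + al * (w (A X) (A Y) - k * w X (A Y)).
    rewrite (jacobi_form_horizontal DZ.1 DZ.2 hY) fsDl fsZl (Asym DZ.1 hY).
    by rewrite (fsC (A Y)) (fsD _ Y DX) (fsD _ (A Y) DX).
  have h3 : fs (lie_defect X 0) Y - jacobi_form (lie_defect X E) Y =
      jacobi_form (lie_defect E X) Y.
    by rewrite lie_defect0 fs0l sub0r (lie_defectN E X) jacobi_formN opprK.
  have := etrans (esym (congr2 (fun a b => a - b) h1 h2)) (etrans H (etrans h3 h2)).
  exact: jacobi_Reeb_identity.
(* The condition at two horizontal vectors, paired with the Reeb vector. Every [lie_defect] involved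
   is a multiple of the Reeb vector, so the [jacobi_form] terms vanish. *)
have jac_D X Y : D X -> D Y ->
    2 * (w (A X) Y + w X (A Y)) + al * (w (A X) (A Y) + w X (A (A Y)))
      + al * (w (A (A X)) Y + w (A X) (A Y)) = 0.
  move=> DX DY; have [hX XE] := DX; have [hY YE] := DY.
  have [RX [RY [hRX hRY RXE RYE H]]] := jacobi hX hY; have {}H := H E hE.
  have e1 := jacobi_operator_horizontal hX XE hRX RXE; subst RX.
  have e2 := jacobi_operator_horizontal hY YE hRY RYE; subst RY.
  have lieV Z W : D Z -> D W -> lie_defect Z W = (w (A Z) W - w (A W) Z) *:r E.
    move=> DZ DW; have tor V S : D V -> D S -> torsion_part V S = w (A V) S *:r E.
      move=> DV DS; rewrite /torsion_part DV.2 DS.2 mulr0 (rscale0r (phiv (A V))).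
      by rewrite (rscale0r (phiv S)) 2!subr0 (phivE (DA V DV).2) wE.
    apply: (etrans (congr2 (fun a b => a - b) (tor _ _ DZ DW) (tor _ _ DW DZ))).
    by rewrite rscaleDl rscaleNl.
  have lieE Z W Z' W' : D Z -> D W -> D Z' -> D W' ->
      fs (lie_defect Z W) E - jacobi_form (lie_defect Z' W') E = w (A Z) W - w (A W) Z.
    move=> DZ DW DZ' DW'.
    have lieT : T (lie_defect Z' W') by rewrite (lieV _ _ DZ' DW'); exact: ThypZ.
    have c : fs (lie_defect Z W) E = w (A Z) W - w (A W) Z.
      by rewrite (lieV _ _ DZ DW) fsZl EE mulr1.
    exact: etrans (congr2 (fun a b => a - b) c (jacobi_formr_Reeb lieT)) (subr0 _).
  have h1 := congr2 (fun a b => a - b) (wAr (A X) Y (A Y)) (wARl Y X).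
  have h2 := congr2 (fun a b => a - b) (wAr (A Y) X (A X)) (wARl X Y).
  have := etrans (esym h1) (etrans (etrans (esym (lieE _ _ _ _ DX (DR _ DY) DX DY))
    (etrans H (lieE _ _ _ _ DY (DR _ DX) DY DX))) h2).
  have c1 := wC (A Y) X; have c2 := wC (A (A Y)) X; have c3 := wC (A Y) (A X).
  move: c1 c2 c3; move: (w (A Y) X) (w (A (A Y)) X) (w (A Y) (A X)) => a1 a2 a3 -> -> ->.
  exact: jacobi_horizontal_identity.
(* With [Y = J X0] the two sign conditions become positivity of the squared length of [J X0] and
   nonnegativity of that of [A (J X0)]. *)
apply: (no_structure_operator (D := D) (B := A) (w := w) (al := al) k0 DA _ _ jac_xi jac_D
  (X := X0) (Y := cpJ P X0)) => //.
- by move=> X Y [hX XE] [hY YE]; rewrite -!wE; exact: codazzi.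
- rewrite -wE; have [[hJ _] _] := T_horizontal_cpJ hX0 X0E; apply: fs_gt0; first by case: hJ.
  apply: contra_neq X0n0 => J0; have := cpJJ hP hX0.1; rewrite J0.
  rewrite /cpJ mul0mx mulmx0 subrr scaler0 => /esym/eqP; rewrite oppr_eq0 => /eqP //.
- have hAJ := AT hJ0.
  by rewrite -wE fsC (Asym hAJ hJ0); apply: fs_ge0; case: hAJ => -[].
Qed.

End HopfPoint.

(** * From the manifold to a chart *)

Section ChainRule.
Context {R : realType} {n : nat}.
Implicit Types (u w : 'rV[R]_n) (t : 'rV[R]_n -> 'rV[R]_n).

Lemma differentiable_row t u : (forall j, differentiable (fun x => t x 0 j) u) ->
  differentiable t u.
Proof.
move=> dt.
rewrite (_ : t = fun x => \sum_j t x 0 j *: delta_mx 0 j); last first.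
  by apply/funext => x; exact: row_sum_delta.
by apply: differentiable_bigsum => j; exact: differentiableZl.
Qed.

Lemma diff_row t u w : (forall j, differentiable (fun x => t x 0 j) u) ->
  'd t u w = dcrd t u w.
Proof.
move=> dt; have dt' := differentiable_row dt.
rewrite -deriveE// derive_mx; last exact: diff_derivable.
by apply/rowP => j; rewrite !mxE.
Qed.

Lemma derive_comp (h : 'rV[R]_n -> R) t u w : (forall j, differentiable (fun x => t x 0 j) u) ->
  differentiable h (t u) -> 'D_w (h \o t) u = 'D_(dcrd t u w) h (t u).
Proof.
move=> dt dh; have dt' := differentiable_row dt.
have dht : differentiable (h \o t) u by exact: differentiable_comp.
rewrite (deriveE w dht) (deriveE _ dh).
exact: (etrans (congr1 (fun g : _ -> _ => g w) (diff_comp dt' dh))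
  (congr1 ('d h (t u)) (diff_row w dt))).
Qed.

Lemma dm_comp d (G : 'rV[R]_n -> 'M[R[i]]_d) t u w :
  (forall j, differentiable (fun x => t x 0 j) u) -> mdiff G (t u) ->
  dm (G \o t) u w = dm G (t u) (dcrd t u w).
Proof.
move=> dt dG; rewrite 2!dmE; apply/matrixP => a b; have [[h1 _] [h2 _]] := dG a b.
rewrite [LHS]mxE [RHS]mxE; congr (_ +i* _).
  exact: (derive_comp (h := fun x => complex.Re (G x a b)) w dt h1).
exact: (derive_comp (h := fun x => complex.Im (G x a b)) w dt h2).
Qed.

End ChainRule.

(** * Independence of the chosen charts *)

Section ChartChange.
Context {R : realType} {n : nat} {M : manifold (R := R) n}.

Lemma open_chart_preimage (c : chart (R := R) n M) (V : set M) : is_chart c -> open V ->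
  open (c.1 `&` c.2 @^-1` V).
Proof.
move=> [oc _ cc _] oV; rewrite openE => u [cu Vu]; rewrite /interior.
apply: filterI; first exact: open_nbhs_nbhs.
by apply: (cc u cu); exact: open_nbhs_nbhs.
Qed.

Lemma chart_atP (p : M) : [/\ atlas (chart_at p).1, (chart_at p).1.1 (chart_at p).2
  & (chart_at p).1.2 (chart_at p).2 = p].
Proof.
have [c ac [u cu cup]] := atlas_cover p.
exact: (xgetPex _ (ex_intro _ (c, u) (And3 ac cu cup) :
  exists cu, [set cu | [/\ atlas cu.1, cu.1.1 cu.2 & cu.1.2 cu.2 = p]] cu)).
Qed.

(** The definitions of [tangent] and [dir_deriv] use the chosen chart [chart_at]; the transition map
    relates it to an arbitrary chart of the atlas. *)
Lemma chart_change (c : chart (R := R) n M) u : atlas c -> c.1 u ->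
  let c' := (chart_at (c.2 u)).1 in let u' := (chart_at (c.2 u)).2 in
  exists t : 'rV[R]_n -> 'rV[R]_n, [/\ forall j, differentiable (fun x => t x 0 j) u', t u' = u &
    \forall x \near u', c.2 (t x) = c'.2 x].
Proof.
move=> ac cu c' u'; have [ac' cu' cup] := chart_atP (c.2 u).
have [oc ci cc cO] := atlas_chart ac.
have [t [ts tE]] := atlas_compatible ac ac'.
set W := _ `&` _ in ts tE.
have oW : open W by apply: open_chart_preimage; [exact: atlas_chart|exact: cO].
have Wu : W u' by split=> //=; exists u.
exists t; split.
- by move=> j; have [+ _] := ts j 1%N; apply.
- have [ct e] := tE _ Wu; apply: ci => //; rewrite e; exact: cup.
- by apply: (near_open oW Wu) => x /tE[].
Qed.

Context {m : nat} (f : M -> 'M[R[i]]_m.+1).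
Hypothesis f_immersion : smooth_immersion f.

Lemma smooth_chart c : atlas c -> smooth_mx c.1 (f \o c.2).
Proof.
move=> ac; have := f_immersion.1 c ac.
by rewrite (_ : c.1 `&` _ = c.1)//; apply/seteqP; split=> [x []|x].
Qed.

Lemma inj_chart c u : atlas c -> c.1 u -> injective (dm (f \o c.2) u).
Proof. by move=> ac cu x y; rewrite !dmE; exact: (f_immersion.2 c u ac cu). Qed.

(** One linear map [t] serves all [G]. It is injective because the immersion has injective
    differential in the chosen chart, and bijective because its matrix is square. *)
Lemma dm_pullback c u : atlas c -> c.1 u -> let u' := (chart_at (c.2 u)).2 in
  exists2 t : 'rV[R]_n -> 'rV[R]_n, bijective t &
  forall d (G : M -> 'M[R[i]]_d) w, mdiff (G \o c.2) u ->
    dm (pullback G (c.2 u)) u' w = dm (G \o c.2) u (t w).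
Proof.
move=> ac cu u'; have [ac' cu' cup] := chart_atP (c.2 u).
have [t [dt tu tE]] := chart_change ac cu.
have E d (G : M -> 'M[R[i]]_d) w : mdiff (G \o c.2) u ->
    dm (pullback G (c.2 u)) u' w = dm (G \o c.2) u (dcrd t u' w).
  move=> dG; have := dm_comp (u := u') (t := t) (G := G \o c.2) w dt; rewrite tu => <- //.
  by apply: dmx_near; apply: filterS tE => x /= ->.
exists (dcrd t u'); last by [].
have sF := smooth_chart ac.
have ti : injective (dcrd t u').
  move=> v w vw; apply: (inj_chart ac' cu').
  have dF : mdiff (f \o c.2) u := smooth_mx_mdiff sF cu.
  by have := E _ f v dF; rewrite vw -(E _ f w dF).
pose J := lin1_mx ('d t u').
have JE w : dcrd t u' w = w *m J by rewrite mul_rV_lin1 diff_row.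
have Ju : J \in unitmx.
  rewrite -row_free_unit; apply/inj_row_free => v vJ; apply: ti.
  by rewrite !JE vJ mul0mx.
exists (fun w => w *m invmx J) => w; rewrite JE ?mulmxK ?mulmxKV//.
Qed.

Lemma tangent_chart c u : atlas c -> c.1 u -> tangent f (c.2 u) = range (dm (f \o c.2) u).
Proof.
move=> ac cu; have [t [s ts st] tE] := dm_pullback ac cu.
have dF : mdiff (f \o c.2) u := smooth_mx_mdiff (smooth_chart ac) cu.
apply/seteqP; split=> [X [w _ <-]|X [w _ <-]].
  by rewrite -dmE tE//; exists (t w).
by exists (s w) => //; rewrite -dmE tE// st.
Qed.

Lemma dir_deriv_chart c u w (G : M -> 'M[R[i]]_m.+1) : atlas c -> c.1 u ->
  mdiff (G \o c.2) u ->
  dir_deriv f (c.2 u) (dm (f \o c.2) u w) G = dm (G \o c.2) u w.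
Proof.
move=> ac cu dG; have [t [s ts st] tE] := dm_pullback ac cu.
have dF : mdiff (f \o c.2) u := smooth_mx_mdiff (smooth_chart ac) cu.
have [ac' cu' cup] := chart_atP (c.2 u).
rewrite /dir_deriv -dmE tE//; congr (dm _ _ _).
rewrite /chart_coord; set S := [set w' | _].
have Sw : S (s w) by rewrite /S /= -dmE tE// st.
have : S (xget 0 S) by apply: (@xgetPex _ 0 S); exists (s w).
rewrite {1}/S /= -dmE tE// => h.
exact: (inj_chart ac cu h).
Qed.

End ChartChange.

Section MoreSmooth.
Context {R : realType} {n : nat}.

Lemma smooth_mx_subset p (U U' : set 'rV[R]_n) (F : 'rV[R]_n -> 'M[R[i]]_p) :
  U' `<=` U -> smooth_mx U F -> smooth_mx U' F.
Proof.
move=> UU; have CkS k h : Ck k U h -> Ck k U' h.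
  elim: k h => [|k IH] h /=; first by move=> H u /UU; exact: H.
  by move=> [dh Dh]; split=> [u /UU|w]; [exact: dh|exact: IH].
by move=> H a b; have [h1 h2] := H a b; split=> k; exact: CkS.
Qed.

Lemma smooth_projhyp m (U : set 'rV[R]_n) (F N G : 'rV[R]_n -> 'M[R[i]]_m.+1) : open U ->
  smooth_mx U F -> smooth_mx U N -> smooth_mx U G ->
  smooth_mx U (fun x => projhyp (F x) (N x) (G x)).
Proof.
move=> oU sF sN sG.
have sGF := smooth_mx_mul oU sG sF; have sFG := smooth_mx_mul oU sF sG.
have sFGF := smooth_mx_mul oU sFG sF.
apply: (smooth_mx_add oU).
  exact: (smooth_mx_add oU (smooth_mx_add oU sGF sFG)
    (smooth_mx_opp oU (smooth_mx_add oU sFGF sFGF))).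
exact: (smooth_mx_opp oU (smooth_mx_rscale oU (smooth_fs oU sG sN) sN)).
Qed.

Section Mdiff.
Context {m : nat}.
Implicit Types (F G K : 'rV[R]_n -> 'M[R[i]]_m.+1) (u : 'rV[R]_n).

Lemma mdiff_add F G u : mdiff F u -> mdiff G u -> mdiff (fun x => F x + G x) u.
Proof. by move=> h1 h2; exact: (mD_mdiff (mD_add h1 h2)). Qed.

Lemma mdiff_opp F u : mdiff F u -> mdiff (fun x => - F x) u.
Proof. by move=> h; exact: (mD_mdiff (mD_opp h)). Qed.

Lemma mdiff_mul F G u : mdiff F u -> mdiff G u -> mdiff (fun x => F x *m G x) u.
Proof. by move=> h1 h2; exact: (mD_mdiff (mD_mul h1 h2)). Qed.

Lemma mdiff_scalec c F u : mdiff F u -> mdiff (fun x => c *: F x) u.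
Proof. by move=> h; exact: (mD_mdiff (mD_scalec c h)). Qed.

Lemma mdiff_fsZ (k : R) F G K u : mdiff F u -> mdiff G u -> mdiff K u ->
  mdiff (fun x => (k * fs (F x) (G x)) *:r K x) u.
Proof.
by move=> h1 h2 h3; exact: (mD_mdiff (mD_rscale (rD_mul (rD_cst k u) (rD_fs h1 h2)) h3)).
Qed.

Lemma mdiff_fsZ1 F G K u : mdiff F u -> mdiff G u -> mdiff K u ->
  mdiff (fun x => fs (F x) (G x) *:r K x) u.
Proof.
by move=> h1 h2 h3; exact: (mD_mdiff (mD_rscale (rD_fs h1 h2) h3)).
Qed.

Lemma mdiff_cpJ F G u : mdiff F u -> mdiff G u -> mdiff (fun x => cpJ (F x) (G x)) u.
Proof.
move=> h1 h2; apply: mdiff_scalec; apply: mdiff_add; first exact: mdiff_mul.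
by apply: mdiff_opp; exact: mdiff_mul.
Qed.

Lemma mdiff_projCP F G u : mdiff F u -> mdiff G u -> mdiff (fun x => projCP (F x) (G x)) u.
Proof.
move=> h1 h2; have h3 := mdiff_mul (mdiff_mul h1 h2) h1.
exact: (mdiff_add (mdiff_add (mdiff_mul h2 h1) (mdiff_mul h1 h2))
  (mdiff_opp (mdiff_add h3 h3))).
Qed.

End Mdiff.
End MoreSmooth.

Lemma T_torsion_part {R : realType} {m : nat} (P N : 'M[R[i]]_m.+1) A k X Y :
  CP P -> TCP P N -> fs N N = 1 -> (forall X, Thyp P N X -> Thyp P N (A X)) ->
  Thyp P N X -> Thyp P N Y -> Thyp P N (torsion_part P N A k X Y).
Proof.
move=> hP hN NN AT hX hY.
have hE : Thyp P N (- cpJ P N) by exact: Thyp_Reeb.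
have Tphi Z : Thyp P N Z -> Thyp P N (phiv P N Z) by move=> [hZ _]; exact: Thyp_phi.
apply: ThypD; last by apply/ThypN/ThypZ/Tphi.
by apply: ThypD; [exact: ThypZ|apply/ThypN/ThypZ/Tphi/AT].
Qed.

(** * The operators of the hypersurface computed in a chart *)

Section LocalFields.
Context {R : realType} {m n : nat} {M : manifold (R := R) n}.
Context (f : M -> 'M[R[i]]_m.+1) (V : set M) (N : M -> 'M[R[i]]_m.+1).
Context (c : chart (R := R) n M).
Hypotheses (f_immersion : smooth_immersion f) (fCP : forall p, CP (f p)).
Hypotheses (dim : n.+1 = (m + m)%N) (oV : open V) (uN : unit_normal f V N) (ac : atlas c).
Implicit Types (u : 'rV[R]_n) (X Y Z W : M -> 'M[R[i]]_m.+1).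

Let U : set 'rV[R]_n := c.1 `&` c.2 @^-1` V.
Let F : 'rV[R]_n -> 'M[R[i]]_m.+1 := f \o c.2.
Let Nc : 'rV[R]_n -> 'M[R[i]]_m.+1 := N \o c.2.

Lemma chart_domain_open : open U.
Proof. by apply: open_chart_preimage => //; exact: atlas_chart. Qed.
Let oU := chart_domain_open.

Lemma chart_F_smooth : smooth_mx U F.
Proof. by apply: (smooth_mx_subset _ (smooth_chart f_immersion ac)) => x []. Qed.
Let sF := chart_F_smooth.

Lemma chart_F_CP u : U u -> CP (F u). Proof. by move=> _; exact: fCP. Qed.
Let cF := chart_F_CP.

Lemma chart_F_inj u : U u -> injective (dm F u).
Proof. by move=> [cu _]; exact: (inj_chart f_immersion ac cu). Qed.
Let iF := chart_F_inj.

Lemma chart_N_smooth : smooth_mx U Nc. Proof. exact: uN.1 c ac. Qed.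
Let sN := chart_N_smooth.

Lemma chart_N_TCP u : U u -> TCP (F u) (Nc u).
Proof. by move=> [_ Vu]; have [] := uN.2 _ Vu. Qed.
Let hN := chart_N_TCP.

Lemma chart_N_unit u : U u -> fs (Nc u) (Nc u) = 1.
Proof. by move=> [_ Vu]; have [] := uN.2 _ Vu. Qed.
Let NN := chart_N_unit.

Lemma chart_N_normal u w : U u -> fs (Nc u) (dm F u w) = 0.
Proof.
move=> [cu Vu]; have [_ _] := uN.2 _ Vu; apply.
by rewrite (tangent_chart f_immersion ac cu); exists w.
Qed.
Let NT := chart_N_normal.

Local Notation T u := (Thyp (F u) (Nc u)).
Local Notation tfld := (tfield (U := U) F Nc).

Lemma tangent_Thyp u : U u -> tangent f (c.2 u) = T u.
Proof.
move=> Uu; rewrite (tangent_chart f_immersion ac Uu.1).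
exact: (range_dmx oU sF cF iF hN NN NT dim Uu).
Qed.

Lemma tfield_herm (Y : 'rV[R]_n -> 'M[R[i]]_m.+1) u w : tfld Y -> U u ->
  adjmx (dm Y u w) = dm Y u w.
Proof.
move=> tY Uu; have [dY _] := tY u Uu.
rewrite -(mDE (mD_adjmx dY)); apply: dmx_near.
by apply: (near_open oU Uu) => x Ux; case: (tY x Ux) => _ [[]].
Qed.

Lemma nabla_chart X Y u : U u -> T u (X (c.2 u)) -> mdiff (Y \o c.2) u ->
  (forall w, adjmx (dm (Y \o c.2) u w) = dm (Y \o c.2) u w) ->
  nabla f X Y (c.2 u) = cnab F Nc (X \o c.2) (Y \o c.2) u.
Proof.
move=> Uu hX dY Yh; rewrite /nabla (tangent_Thyp Uu).
have e := dm_crd oU sF cF iF hN NN NT dim Uu hX.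
have -> : dir_deriv f (c.2 u) (X (c.2 u)) Y = dm (Y \o c.2) u (crd F u (X (c.2 u))).
  by rewrite -[in LHS]e (dir_deriv_chart f_immersion _ ac Uu.1 dY).
exact: (tproj_Thyp (cF Uu) (hN Uu) (NN Uu) (Yh _)).
Qed.

Lemma shape_chart X u : U u -> T u (X (c.2 u)) ->
  Defs.shape f N X (c.2 u) = shpv F Nc u (X (c.2 u)).
Proof.
move=> Uu hX; rewrite /Defs.shape /nablabar /shpv shpE; congr (- _).
have e := dm_crd oU sF cF iF hN NN NT dim Uu hX.
have dN : mdiff (N \o c.2) u := smooth_mx_mdiff sN Uu.
have -> : dir_deriv f (c.2 u) (X (c.2 u)) N = dm Nc u (crd F u (X (c.2 u))).
  by rewrite -[in LHS]e (dir_deriv_chart f_immersion _ ac Uu.1 dN).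
exact: (tproj_TCP (cF Uu) (dN_herm oU sN hN _ Uu)).
Qed.

Lemma tfield_cnab (Y Z : 'rV[R]_n -> 'M[R[i]]_m.+1) : tfld Y -> tfld Z -> smooth_mx U Z ->
  tfld (cnab F Nc Y Z).
Proof.
move=> tY tZ sZ u Uu; split; first exact: (mdiff_cnab oU sF cF iF sN sZ tY Uu).
apply: (Thyp_projhyp (cF Uu) (hN Uu) (NN Uu)); exact: tfield_herm.
Qed.

Lemma tfield_near (Y Y' : 'rV[R]_n -> 'M[R[i]]_m.+1) : (forall u, U u -> Y u = Y' u) ->
  tfld Y -> tfld Y'.
Proof.
move=> YY tY u Uu; have [dY hY] := tY u Uu; split; last by rewrite -YY.
by apply: (mdiff_near _ dY); exact: (near_open oU Uu).
Qed.

Lemma tfield_sub (Y Y' : 'rV[R]_n -> 'M[R[i]]_m.+1) : tfld Y -> tfld Y' ->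
  tfld (fun u => Y u - Y' u).
Proof.
move=> tY tY' u Uu; have [dY hY] := tY u Uu; have [dY' hY'] := tY' u Uu; split.
  by apply: mdiff_add => //; exact: mdiff_opp.
by apply: ThypD => //; exact: ThypN.
Qed.

Lemma tfield_add (Y Y' : 'rV[R]_n -> 'M[R[i]]_m.+1) : tfld Y -> tfld Y' ->
  tfld (fun u => Y u + Y' u).
Proof.
move=> tY tY' u Uu; have [dY hY] := tY u Uu; have [dY' hY'] := tY' u Uu; split.
  exact: mdiff_add.
exact: ThypD.
Qed.

Lemma nabla_tfield X Y u : tfld (X \o c.2) -> tfld (Y \o c.2) -> U u ->
  nabla f X Y (c.2 u) = cnab F Nc (X \o c.2) (Y \o c.2) u.
Proof.
move=> tX tY Uu; apply: nabla_chart => //; first exact: (tX u Uu).2.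
  exact: (tY u Uu).1.
by move=> w; exact: tfield_herm.
Qed.

(** The inner derivative is known in the chart only over [U], which is enough because the outer one
    depends only on germs. *)
Lemma nabla_nabla_chart X Y Z u : tfld (X \o c.2) -> tfld (Y \o c.2) -> tfld (Z \o c.2) ->
  smooth_mx U (Z \o c.2) -> U u ->
  nabla f X (nabla f Y Z) (c.2 u) =
  cnab F Nc (X \o c.2) (cnab F Nc (Y \o c.2) (Z \o c.2)) u.
Proof.
move=> tX tY tZ sZ Uu; have tYZ := tfield_cnab tY tZ sZ.
have E x : U x -> cnab F Nc (Y \o c.2) (Z \o c.2) x = (nabla f Y Z \o c.2) x.
  by move=> Ux; rewrite /= nabla_tfield.
have tYZ' := tfield_near E tYZ.
rewrite (nabla_tfield tX tYZ' Uu); congr (projhyp _ _ _).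
by apply: dmx_near; apply: (near_open oU Uu) => x Ux; rewrite -E.
Qed.

Let sR : smooth_mx U (Reeb F Nc). Proof. exact: smooth_Reeb. Qed.
Let tR : tfld (Reeb F Nc).
Proof. by move=> t Ut; split; [exact: smooth_mx_mdiff sR Ut|exact: (T_Reeb cF hN Ut)]. Qed.

Lemma Rxi_chart W u : tfld (W \o c.2) -> U u ->
  Rxi f N W (c.2 u) = ccurv F Nc (W \o c.2) (Reeb F Nc) (Reeb F Nc) u.
Proof.
move=> tW Uu; rewrite /Rxi /curvature.
have tR' : tfld (xi f N \o c.2) := tR.
have lieE : lie f W (xi f N) (c.2 u) = clie F Nc (W \o c.2) (Reeb F Nc) u.
  by rewrite /lie (nabla_tfield tW tR' Uu) (nabla_tfield tR' tW Uu).
have E1 := nabla_nabla_chart tW tR' tR' sR Uu.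
have E2 := nabla_nabla_chart tR' tW tR' sR Uu.
have hlie : T u (lie f W (xi f N) (c.2 u)).
  rewrite lieE (clieE oU sF cF iF hN NN NT dim tW tR Uu).
  exact: (T_dmx oU sF cF NT _ Uu).
have E3 := nabla_chart (Y := xi f N) Uu hlie (tR Uu).1 (fun w => tfield_herm w tR Uu).
rewrite /ccurv; congr (_ - _ - _); [exact: E1|exact: E2|].
exact: (etrans E3 (congr1 (fun A : 'M[R[i]]_m.+1 =>
  projhyp (F u) (Nc u) (dm (Reeb F Nc) u (crd F u A))) lieE)).
Qed.

Lemma fs_Rxi W u (Z : 'M[R[i]]_m.+1) : tfld (W \o c.2) -> U u -> T u Z ->
  fs (Rxi f N W (c.2 u)) Z = jacobi_form (F u) (Nc u) (shpv F Nc u) (W (c.2 u)) Z.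
Proof.
move=> tW Uu hZ; rewrite (Rxi_chart tW Uu).
exact: (fs_ccurv_Reeb oU sF cF iF sN hN NN NT dim tW Uu hZ).
Qed.

Lemma T_Rxi W u : tfld (W \o c.2) -> U u -> T u (Rxi f N W (c.2 u)).
Proof.
move=> tW Uu; rewrite (Rxi_chart tW Uu) /ccurv.
have t1 := tfield_cnab tW (tfield_cnab tR tR sR).
have Tc (A : 'rV[R]_n -> 'M[R[i]]_m.+1) B : tfld B -> T u (cnab F Nc A B u).
  move=> tB; apply: (Thyp_projhyp (cF Uu) (hN Uu) (NN Uu)); exact: tfield_herm.
apply: ThypD; last by apply/ThypN/Tc.
apply: ThypD; first by apply: Tc; exact: tfield_cnab.
by apply/ThypN/Tc; exact: tfield_cnab.
Qed.

Lemma shpv_tangent u (X : 'M[R[i]]_m.+1) : U u -> T u (shpv F Nc u X).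
Proof. by move=> Uu; exact: (T_shp oU cF sN hN NN _ Uu). Qed.

Lemma nablak_chart k X Y u : U u -> T u (X (c.2 u)) ->
  nablak f N k X Y (c.2 u) = nabla f X Y (c.2 u) +
    torsion_part (F u) (Nc u) (shpv F Nc u) k (X (c.2 u)) (Y (c.2 u)).
Proof.
move=> Uu hX; rewrite /nablak /torsion_part -!(shape_chart Uu hX).
by rewrite [RHS]addrA [in RHS]addrA.
Qed.

Lemma liek_chart k X Y u : U u -> T u (X (c.2 u)) -> T u (Y (c.2 u)) ->
  liek f N k X Y (c.2 u) = lie f X Y (c.2 u) +
    lie_defect (F u) (Nc u) (shpv F Nc u) k (X (c.2 u)) (Y (c.2 u)).
Proof.
move=> Uu hX hY; rewrite /liek (nablak_chart _ _ Uu hX) (nablak_chart _ _ Uu hY).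
by rewrite /lie /lie_defect opprD addrACA.
Qed.

Lemma tfield_torsion k (X Y : 'rV[R]_n -> 'M[R[i]]_m.+1) : tfld X -> tfld Y ->
  tfld (fun u => torsion_part (F u) (Nc u) (shpv F Nc u) k (X u) (Y u)).
Proof.
move=> tX tY u Uu; have [dX hX] := tX u Uu; have [dY hY] := tY u Uu; split; last first.
  apply: (T_torsion_part _ (cF Uu) (hN Uu) (NN Uu)) => // Z _; exact: shpv_tangent.
have dF := smooth_mx_mdiff sF Uu; have dN := smooth_mx_mdiff sN Uu.
have dR := (tR Uu).1.
have dphi (Z : 'rV[R]_n -> 'M[R[i]]_m.+1) : mdiff Z u ->
    mdiff (fun u => phiv (F u) (Nc u) (Z u)) u.
  move=> dZ; apply: mdiff_add; first exact: mdiff_cpJ.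
  by apply: mdiff_opp; exact: (mdiff_fsZ1 dZ dR dN).
have dA : mdiff (fun u => shpv F Nc u (X u)) u.
  have d1 := mD_mdiff (along_tfield oU sF cF iF sN tX Uu).
  apply: (mdiff_near _ (mdiff_opp (mdiff_projCP dF d1))).
  by apply: (near_open oU Uu) => x Ux; rewrite /shpv shpE.
apply: mdiff_add; last by apply: mdiff_opp; exact: (mdiff_fsZ k dX dR (dphi _ dY)).
apply: mdiff_add; first exact: (mdiff_fsZ1 (dphi _ dA) dY dR).
by apply: mdiff_opp; exact: (mdiff_fsZ1 dY dR (dphi _ dA)).
Qed.

Lemma tfield_lie X Y : tfld (X \o c.2) -> tfld (Y \o c.2) ->
  smooth_mx U (X \o c.2) -> smooth_mx U (Y \o c.2) -> tfld (lie f X Y \o c.2).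
Proof.
move=> tX tY sX sY.
have t := tfield_sub (tfield_cnab tX tY sY) (tfield_cnab tY tX sX).
by apply: (tfield_near _ t) => u Uu; rewrite /= /lie !nabla_tfield.
Qed.

(** The condition applies the Jacobi operator to this field, and [fs_Rxi] asks for a differentiable
    tangent field. *)
Lemma tfield_liek k X Y : tfld (X \o c.2) -> tfld (Y \o c.2) ->
  smooth_mx U (X \o c.2) -> smooth_mx U (Y \o c.2) -> tfld (liek f N k X Y \o c.2).
Proof.
move=> tX tY sX sY.
have t := tfield_add (tfield_lie tX tY sX sY)
  (tfield_sub (tfield_torsion k tX tY) (tfield_torsion k tY tX)).
apply: (tfield_near _ t) => u Uu /=.
by rewrite (liek_chart k Uu (tX u Uu).2 (tY u Uu).2).
Qed.

End LocalFields.

(** * Extension of tangent vectors to vector fields *)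

Section TangentExtension.
Context {R : realType} {m n : nat} {M : manifold (R := R) n}.
Context (f : M -> 'M[R[i]]_m.+1) (V : set M) (N : M -> 'M[R[i]]_m.+1).
Hypotheses (f_immersion : smooth_immersion f) (fCP : forall p, CP (f p)).
Hypotheses (dim : n.+1 = (m + m)%N) (oV : open V) (uN : unit_normal f V N).

Definition extension (A : 'M[R[i]]_m.+1) p := projhyp (f p) (N p) A.

Lemma extension_smooth A (c : chart (R := R) n M) : atlas c ->
  smooth_mx (c.1 `&` c.2 @^-1` V) (extension A \o c.2).
Proof.
move=> ac; have oU := chart_domain_open oV ac.
exact: (smooth_projhyp oU (chart_F_smooth V f_immersion ac) (chart_N_smooth uN ac)
  (smooth_mx_cst oU A)).
Qed.

Lemma extension_vfield A : adjmx A = A -> vfield f V (extension A).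
Proof.
move=> Ah; split=> [c ac|p Vp]; first exact: extension_smooth.
have [c ac [u cu cup]] := atlas_cover p; rewrite -cup in Vp *.
have Uu : (c.1 `&` c.2 @^-1` V) u by [].
rewrite (tangent_Thyp f_immersion fCP dim oV uN ac Uu).
exact: (Thyp_projhyp (fCP _) (chart_N_TCP uN Uu) (chart_N_unit uN Uu) Ah).
Qed.

End TangentExtension.

(** * The Jacobi condition as an identity between tangent vectors *)

Section JacobiAtPoint.
Context {R : realType} {m n : nat} {M : manifold (R := R) n}.
Context (f : M -> 'M[R[i]]_m.+1) (V : set M) (N : M -> 'M[R[i]]_m.+1).
Context (c : chart (R := R) n M).
Hypotheses (f_immersion : smooth_immersion f) (fCP : forall p, CP (f p)).
Hypotheses (dim : n.+1 = (m + m)%N) (oV : open V) (uN : unit_normal f V N) (ac : atlas c).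

Let U : set 'rV[R]_n := c.1 `&` c.2 @^-1` V.
Let F : 'rV[R]_n -> 'M[R[i]]_m.+1 := f \o c.2.
Let Nc : 'rV[R]_n -> 'M[R[i]]_m.+1 := N \o c.2.
Let oU : open U := chart_domain_open oV ac.
Let sF : smooth_mx U F := chart_F_smooth V f_immersion ac.
Let cF u : U u -> CP (F u) := fun _ => fCP _.
Let iF u (Uu : U u) : injective (dm F u) := chart_F_inj f_immersion ac Uu.
Let sN : smooth_mx U Nc := chart_N_smooth uN ac.
Let hN u (Uu : U u) : TCP (F u) (Nc u) := chart_N_TCP uN Uu.
Let NN u (Uu : U u) : fs (Nc u) (Nc u) = 1 := chart_N_unit uN Uu.
Let NT u w (Uu : U u) : fs (Nc u) (dm F u w) = 0 := chart_N_normal f_immersion uN ac w Uu.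

Local Notation T u := (Thyp (F u) (Nc u)).

Lemma extension_tfield (A : 'M[R[i]]_m.+1) : adjmx A = A ->
  tfield (U := U) F Nc (extension f N A \o c.2).
Proof.
move=> Ah u Uu; split.
  exact: (smooth_mx_mdiff (extension_smooth f_immersion oV uN A ac) Uu).
exact: (Thyp_projhyp (cF Uu) (hN Uu) (NN Uu) Ah).
Qed.

Lemma jacobi_formB P L (B : 'M[R[i]]_m.+1 -> 'M[R[i]]_m.+1) (X Y W : 'M[R[i]]_m.+1) :
  (forall X Y, B (X + Y) = B X + B Y) ->
  jacobi_form P L B (X + Y) W - jacobi_form P L B X W = jacobi_form P L B Y W.
Proof.
move=> BD; have formula (a b s d e g h a' b' e' g' : R) :
    a + a' - (b + b') * s + d * (e + e') - (g + g') * h - (a - b * s + d * e - g * h) =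
    a' - b' * s + d * e' - g' * h by ring.
by rewrite /jacobi_form BD 4!fsDl; exact: formula.
Qed.

Lemma shpvD u (X Y : 'M[R[i]]_m.+1) : U u ->
  shpv F Nc u (X + Y) = shpv F Nc u X + shpv F Nc u Y.
Proof.
move=> Uu; have := dmx_lin (smooth_mx_mdiff sN Uu) 1 (crd F u X) (crd F u Y).
by rewrite scale1r rmorph1 scale1r /shpv !shpE crdD => ->; rewrite projCPD opprD.
Qed.

Lemma shpvZ u a (X : 'M[R[i]]_m.+1) : U u -> shpv F Nc u (a *:r X) = a *:r shpv F Nc u X.
Proof.
move=> Uu; have dN := smooth_mx_mdiff sN Uu.
have D0 : dm Nc u 0 = 0.
  have := dmB 0 0 dN; rewrite subr0 subrr //.
have := dmx_lin dN a (crd F u X) 0.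
by rewrite !addr0 D0 addr0 /shpv !shpE crdZ => ->; rewrite -/(rscale a _) projCPZ rscaleNr.
Qed.

(** The condition on fields is applied to the extensions of [X] and [Y]; [RX] and [RY] are the
    values at [u] of the Jacobi operator on them. *)
Lemma jacobi_at k u (X Y : 'M[R[i]]_m.+1) : U u ->
  (forall X Y, vfield f V X -> vfield f V Y -> forall q, V q ->
      deriv_op (liek f N k) (Rxi f N) X Y q - deriv_op (lie f) (Rxi f N) X Y q =
      deriv_op (liek f N k) (Rxi f N) Y X q - deriv_op (lie f) (Rxi f N) Y X q) ->
  T u X -> T u Y ->
  exists RX RY, [/\ T u RX, T u RY,
  forall W, T u W -> fs RX W = jacobi_form (F u) (Nc u) (shpv F Nc u) X W,
  forall W, T u W -> fs RY W = jacobi_form (F u) (Nc u) (shpv F Nc u) Y W &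
  forall W, T u W ->
    fs (lie_defect (F u) (Nc u) (shpv F Nc u) k X RY) W
    - jacobi_form (F u) (Nc u) (shpv F Nc u)
        (lie_defect (F u) (Nc u) (shpv F Nc u) k X Y) W =
    fs (lie_defect (F u) (Nc u) (shpv F Nc u) k Y RX) W
    - jacobi_form (F u) (Nc u) (shpv F Nc u)
        (lie_defect (F u) (Nc u) (shpv F Nc u) k Y X) W].
Proof.
move=> Uu jac hX hY.
have Xh : adjmx X = X by case: hX => -[].
have Yh : adjmx Y = Y by case: hY => -[].
pose Xf := extension f N X; pose Yf := extension f N Y.
have XfE : Xf (c.2 u) = X by exact: (projhyp_id (cF Uu) hX).
have YfE : Yf (c.2 u) = Y by exact: (projhyp_id (cF Uu) hY).
have tX := extension_tfield Xh; have tY := extension_tfield Yh.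
have vX := extension_vfield f_immersion fCP dim oV uN Xh.
have vY := extension_vfield f_immersion fCP dim oV uN Yh.
have sX := extension_smooth f_immersion oV uN X ac.
have sY := extension_smooth f_immersion oV uN Y ac.
have TR W (tW : tfield (U := U) F Nc (W \o c.2)) : T u (Rxi f N W (c.2 u)).
  exact: (T_Rxi f_immersion fCP dim oV uN ac tW Uu).
have RE (W : M -> 'M[R[i]]_m.+1) Z (tW : tfield (U := U) F Nc (W \o c.2)) (hZ : T u Z) :
    fs (Rxi f N W (c.2 u)) Z = jacobi_form (F u) (Nc u) (shpv F Nc u) (W (c.2 u)) Z.
  exact: (fs_Rxi f_immersion fCP dim oV uN ac tW Uu hZ).
(* The brackets [liek] and [lie] differ by [lie_defect], so additivity of [jacobi_form] leaves an
   expression in the values at the point. *)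
have lie_op (A B : M -> 'M[R[i]]_m.+1) Z : tfield (U := U) F Nc (A \o c.2) ->
    tfield (U := U) F Nc (B \o c.2) -> smooth_mx U (A \o c.2) -> smooth_mx U (B \o c.2) ->
    T u Z ->
    fs (deriv_op (liek f N k) (Rxi f N) A B (c.2 u) - deriv_op (lie f) (Rxi f N) A B (c.2 u)) Z =
    fs (lie_defect (F u) (Nc u) (shpv F Nc u) k (A (c.2 u)) (Rxi f N B (c.2 u))) Z
    - jacobi_form (F u) (Nc u) (shpv F Nc u)
        (lie_defect (F u) (Nc u) (shpv F Nc u) k (A (c.2 u)) (B (c.2 u))) Z.
  move=> tA tB sA sB hZ.
  have e1 := liek_chart f_immersion fCP dim oV uN ac k (X := A) (Y := Rxi f N B) Uu
    (tA u Uu).2 (TR _ tB).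
  have e2 := liek_chart f_immersion fCP dim oV uN ac k (X := A) (Y := B) Uu
    (tA u Uu).2 (tB u Uu).2.
  have tlie := tfield_lie f_immersion fCP dim oV uN ac tA tB sA sB.
  have tliek := tfield_liek f_immersion fCP dim oV uN ac k tA tB sA sB.
  have r1 := RE _ _ tlie hZ; have r2 := RE _ _ tliek hZ.
  have e3 := congr1 (fun C => jacobi_form (F u) (Nc u) (shpv F Nc u) C Z) e2.
  have e4 := jacobi_formB (F u) (Nc u) (lie f A B (c.2 u))
    (lie_defect (F u) (Nc u) (shpv F Nc u) k (A (c.2 u)) (B (c.2 u))) Z (fun X Y => shpvD X Y Uu).
  have regroup (a b c' d e : 'M[R[i]]_m.+1) : a = c' + e ->
      fs (a - b - (c' - d)) Z = fs e Z - (fs b Z - fs d Z).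
    by move=> ->; rewrite !fsDl !fsNl !fsDl !fsNl; ring.
  apply: (etrans (regroup _ _ _ _ _ e1)); congr (_ - _).
  exact: etrans (congr2 (fun a b => a - b) (etrans r2 e3) r1) e4.
exists (Rxi f N Xf (c.2 u)), (Rxi f N Yf (c.2 u)); split.
- exact: (TR Xf tX).
- exact: (TR Yf tY).
- move=> W hW; apply: (etrans (RE Xf W tX hW)).
  exact: (congr1 (fun C => jacobi_form _ _ _ C W) XfE).
- move=> W hW; apply: (etrans (RE Yf W tY hW)).
  exact: (congr1 (fun C => jacobi_form _ _ _ C W) YfE).
move=> W hW; have jacW := congr1 (fun A => fs A W) (jac _ _ vX vY _ Uu.2).
pose Q A B := fs (lie_defect (F u) (Nc u) (shpv F Nc u) k A (Rxi f N Yf (c.2 u))) W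
    - jacobi_form (F u) (Nc u) (shpv F Nc u)
        (lie_defect (F u) (Nc u) (shpv F Nc u) k A B) W =
    fs (lie_defect (F u) (Nc u) (shpv F Nc u) k B (Rxi f N Xf (c.2 u))) W
    - jacobi_form (F u) (Nc u) (shpv F Nc u)
        (lie_defect (F u) (Nc u) (shpv F Nc u) k B A) W.
have QE A B : A = X -> B = Y -> Q A B -> Q X Y by move=> -> ->.
apply: (QE _ _ XfE YfE).
exact: (etrans (etrans (esym (lie_op Xf Yf W tX tY sX sY hW)) jacW)
  (lie_op Yf Xf W tY tX sY sX hW)).
Qed.

End JacobiAtPoint.

Theorem theorem1 (R : realType) (m : nat) (hm : (3 <= m)%N) :
  ~ exists (M : manifold (R := R) (2 * m - 1)) (f : M -> 'M[R[i]]_m.+1),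
      [/\ real_hypersurface f, hopf f
        & exists k : R, k != 0 /\ jacobi_condition f k].
Proof.
move=> [M [f [[_ [p0 _] _ fCP fi] hopf_f [k [k0 jac]]]]].
have [V [N [oV Vp uN J]]] := jac p0.
(* The Hopf condition is applied to the very normal for which the Jacobi condition holds near
   [p0]. *)
have [al alE] := hopf_f V N oV uN.
have [c ac [u cu cup]] := atlas_cover p0.
(* The subtraction is truncated, so positivity of [m] is used here. *)
have dim : (2 * m - 1).+1 = (m + m)%N.
  by rewrite subn1 prednK ?mul2n ?addnn// double_gt0; exact: leq_trans hm.
pose U := c.1 `&` c.2 @^-1` V; pose F := f \o c.2; pose Nc := N \o c.2.
have Uu : U u by split=> //=; rewrite cup.
have oU : open U := chart_domain_open oV ac.
have sF : smooth_mx U F := chart_F_smooth V fi ac.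
have cF x : U x -> CP (F x) by move=> _; exact: fCP.
have iF x : U x -> injective (dm F x) by move=> Ux; exact: (chart_F_inj fi ac Ux).
have sN : smooth_mx U Nc := chart_N_smooth uN ac.
have hN x : U x -> TCP (F x) (Nc x) by move=> Ux; exact: (chart_N_TCP uN Ux).
have NN x : U x -> fs (Nc x) (Nc x) = 1 by move=> Ux; exact: (chart_N_unit uN Ux).
have NT x w : U x -> fs (Nc x) (dm F x w) = 0.
  by move=> Ux; exact: (chart_N_normal fi uN ac w Ux).
have hopfE x : U x -> shpv F Nc x (Reeb F Nc x) = (al \o c.2) x *:r Reeb F Nc x.
  move=> Ux; have hR : Thyp (F x) (Nc x) (xi f N (c.2 x)) := T_Reeb cF hN Ux.
  exact: (etrans (esym (shape_chart fi fCP dim oV uN ac (X := xi f N) Ux hR)) (alE _ Ux.2)).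
have crdK (X : 'M[R[i]]_m.+1) : Thyp (F u) (Nc u) X -> dm F u (crd F u X) = X.
  by move=> hX; exact: (dm_crd oU sF cF iF hN NN NT dim Uu hX).
apply: (hopf_point_contradiction (A := shpv F Nc u) (cF u Uu) (hN u Uu) (NN u Uu)
  _ _ _ _ (hopfE u Uu) _ _ _ k0).
- by move=> X _; exact: (T_shp oU cF sN hN NN _ Uu).
- by move=> X Y; exact: (shpvD uN ac X Y Uu).
- by move=> a X; exact: (shpvZ uN ac a X Uu).
- move=> X Y hX hY; have := shp_sym oU sF cF sN NT (crd F u X) (crd F u Y) Uu.
  by rewrite (crdK X hX) (crdK Y hY).
- move=> X Y hX hY XE YE.
  have eX := crdK X hX; have eY := crdK Y hY.
  have XE' : fs (dm F u (crd F u X)) (Reeb F Nc u) = 0 by rewrite eX.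
  have YE' : fs (dm F u (crd F u Y)) (Reeb F Nc u) = 0 by rewrite eY.
  have := codazzi_hopf oU sF cF iF sN hN NN NT dim hopfE Uu XE' YE'.
  by rewrite eX eY.
- by move=> X Y; exact: (jacobi_at fi fCP dim oV uN ac Uu J).
- exact: leq_trans hm.
Qed.
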